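(* Let $k\ge1$ and $i\ge1$ be integers. In the algebra $TL_{(k,i)}$: (1) for each $t\in T(\Lambda_{k,i})$, $G_{t,t}$ is a primitive idempotent; (2) for each $\lambda\in\Lambda_{k,i}$ with $T(\lambda)\ne\emptyset$, $\sum_{t\in T(\lambda)}G_{t,t}$ is a primitive central idempotent; (3) $\{G_{t,t}: t\in T(\Lambda_{k,i})\}$ is a complete set of pairwise orthogonal idempotents; (4) $\{\sum_{t\in T(\lambda)}G_{t,t}: \lambda\in\Lambda_{k,i},\ T(\lambda)\neq\emptyset\}$ is a complete set of pairwise orthogonal idempotents.
   Context: Let $A$ be an indeterminate, work over the field $\mathbb{Q}(A)$, and put $\delta=-A^{2}-A^{-2}$. For $m,n\ge 0$ let $TL(m,n)$ be the vector space with basis the isotopy classes of crossingless diagrams (without closed loops) in a rectangle with $m$ marked points on the bottom and $n$ on the top. Diagrams are composed by stacking, $XY$ meaning $X$ on top of $Y$, each closed loop being removed at the cost of a factor $\delta$; $\otimes$ denotes horizontal juxtaposition; $\mathrm{id}_n$ is the identity diagram. $TL_n=TL(n,n)$ is the Temperley-Lieb algebra, generated by $1,e_1,\dots,e_{n-1}$ with $e_j^2=\delta e_j$, $e_je_{j\pm1}e_j=e_j$, $e_je_l=e_le_j$ for $|j-l|>1$. The map $X\mapsto X^*$, $TL(m,n)\to TL(n,m)$, is the $\mathbb{Q}(A)$-linear extension of reflecting diagrams in a horizontal line. The trace $\mathrm{tr}:TL_n\to\mathbb{Q}(A)$ sends a diagram to $\delta^{c}$, with $c$ the number of loops obtained by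 joining the $j$-th top point to the $j$-th bottom point for all $j$ by planar arcs outside the rectangle. The Jones-Wenzl idempotent $f_n\in TL_n$ is the unique nonzero idempotent with $e_jf_n=f_ne_j=0$ for all $1\le j\le n-1$ ($f_0$ is the empty diagram). $\Delta_n=\mathrm{tr}(f_n)=(-1)^n\frac{A^{2n+2}-A^{-2n-2}}{A^2-A^{-2}}$. Colored Temperley-Lieb algebra: let $F=f_i^{\otimes k}\in TL_{ki}$. Then $TL_{(k,i)}=\{FXF: X\in TL_{ki}\}$, an algebra with identity $F$. Admissibility: a triple $(x,y,z)$ of non-negative integers is admissible if $x+y+z$ is even and $x\le y+z$, $y\le x+z$, $z\le x+y$. For $(x,y,z)$ admissible put $p=\frac{x+y-z}{2}$, $r=\frac{x+z-y}{2}$, $q=\frac{y+z-x}{2}$; the trivalent vertex is $V_{x,y}^{z}=f_z\,E\,(f_x\otimes f_y)\in TL(x+y,z)$, where $E\in TL(x+y,z)$ joins the last $p$ of the first $x$ bottom points to the first $p$ of the last $y$ bottom points by nested arcs, and the remaining $r+q=z$ bottom points to the top points without crossings. $\theta(x,y,z)=\mathrm{tr}\big(V_{x,y}^{z}(V_{x,y}^{z})^{*}\big)$. An $i$-admissible sequence of length $k$ is a sequence $s=(s_1,\dots,s_k)$ of non-negative integers with $s_1=i$ and $(s_{j-1},s_j,i)$ admissible for $1<j\le k$; its weight is $\omega(s)=s_k$. Define $v_s\in TL(ki,s_k)$ recursively by $v_{(i)}=f_i$, $v_{(s_1,\dots,s_m)}=V_{s_{m-1},i}^{s_m}(v_{(s_1,\dots,s_{m-1})}\otimes\mathrm{id}_i)$,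 and put $\eta(s)=\prod_{j=1}^{k-1}\frac{\theta(s_{j+1},s_j,i)}{\Delta_{s_{j+1}}}$ (nonzero). $\Lambda_{k,i}=\{ki-2j: j=0,\dots,\lfloor ki/2\rfloor\}$; for $\lambda\in\Lambda_{k,i}$, $T(\lambda)$ is the set of $i$-admissible sequences of length $k$ and weight $\lambda$, and $T(\Lambda_{k,i})=\bigcup_\lambda T(\lambda)$. For $s,t\in T(\lambda)$, $G_{s,t}=\frac{1}{\eta(s)}v_s^{*}v_t\in TL_{(k,i)}$. A set of pairwise orthogonal idempotents is complete if its elements sum to the identity of the algebra. A primitive central idempotent is a nonzero central idempotent that is not a sum of two nonzero orthogonal central idempotents. *)

(* Defs.v *)
From HB Require Import structures.
From mathcomp Require Import all_boot all_order all_algebra.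
From mathcomp Require Import boolp classical_sets functions cardinality fsbigop.

Set Implicit Arguments.
Unset Strict Implicit.
Unset Printing Implicit Defensive.

Import Order.TTheory GRing.Theory Num.Theory.
Local Open Scope classical_set_scope.
Local Open Scope ring_scope.

                     
Definition QA : fieldType := {fraction {poly rat}}.
Definition A : QA := tofrac 'X.
Definition delta : QA := - A ^+ 2 - A ^- 2.

                                                                            
                                                                              
                                                                             
                         
Definition pos m n (p : 'I_m + 'I_n) : nat :=
  match p with inl j => j | inr j => (m + (n - j.+1))%N end.

Definition swap (X Y : Type) (p : X + Y) : Y + X :=
  match p with inl j => inr j | inr j => inl j end.

                                                                               
                                                                               
                        
Definition is_diag m n (d : {ffun 'I_m + 'I_n -> 'I_m + 'I_n}) : bool :=
  [&& [forall p, d (d p) == p], [forall p, d p != p] &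
      [forall p, forall q, ~~ [&& (pos p < pos q)%N, (pos q < pos (d p))%N &
                                  (pos (d p) < pos (d q))%N]]].

Record diag (m n : nat) := Diag {
  strand :> {ffun 'I_m + 'I_n -> 'I_m + 'I_n};
  _ : is_diag strand }.

HB.instance Definition _ m n := [isSub for @strand m n].
HB.instance Definition _ m n := [Finite of diag m n by <:].

                                                      
Notation TL m n := {ffun diag m n -> QA^o}.

                                                                            
                                                 
Definition the_diag m n (P : pred (diag m n)) : TL m n := [ffun d => (P d)%:R].

                                                                                
                                                                               
                                
Section Stacking.
Variables (l m n : nat) (x : diag m n) (y : diag l m).

Definition upper (p : 'I_m + 'I_n) : 'I_l + 'I_m + 'I_n :=
  match p with inl j => inl (inr j) | inr j => inr j end.

Definition outer (p : 'I_l + 'I_n) : 'I_l + 'I_m + 'I_n :=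
  match p with inl j => inl (inl j) | inr j => inr j end.

Definition glue : rel ('I_l + 'I_m + 'I_n) := fun u v =>
  [exists p, (u == inl p) && (v == inl (y p))]
  || [exists p, (u == upper p) && (v == upper (x p))].

Definition stacks_to (z : diag l n) : bool :=
  [forall p, connect glue (outer p) (outer (z p))].

                                                                        
Definition stack_loops : nat :=
  n_comp glue [pred u | [forall p, ~~ connect glue u (outer p)]].

End Stacking.

Definition comp l m n (X : TL m n) (Y : TL l m) : TL l n :=
  \sum_(x : diag m n) \sum_(y : diag l m)
     (X x * Y y * delta ^+ stack_loops x y) *: the_diag (stacks_to x y).

Reserved Notation "X ** Y" (at level 40, left associativity).
Notation "X ** Y" := (comp X Y) : ring_scope.

Definition left_pt m m' n n' (p : 'I_m + 'I_n) : 'I_(m + m') + 'I_(n + n') :=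
  match p with inl j => inl (lshift m' j) | inr j => inr (lshift n' j) end.

Definition right_pt m m' n n' (p : 'I_m' + 'I_n') : 'I_(m + m') + 'I_(n + n') :=
  match p with inl j => inl (rshift m j) | inr j => inr (rshift n j) end.

Definition juxtaposes_to m m' n n' (x : diag m n) (y : diag m' n')
    (z : diag (m + m') (n + n')) : bool :=
  [forall p, z (left_pt m' n' p) == left_pt m' n' (x p)]
  && [forall p, z (right_pt m n p) == right_pt m n (y p)].

Definition tens m m' n n' (X : TL m n) (Y : TL m' n') : TL (m + m') (n + n') :=
  \sum_(x : diag m n) \sum_(y : diag m' n')
     (X x * Y y) *: the_diag (juxtaposes_to x y).

Definition star m n (X : TL m n) : TL n m :=
  \sum_(x : diag m n)
     X x *: the_diag (fun z : diag n m => [forall p, z (swap p) == swap (x p)]).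

                                                                                 
Definition closure_rel n (x : diag n n) : rel ('I_n + 'I_n) :=
  fun u v => (v == x u) || (v == swap u).

Definition tr n (X : TL n n) : QA :=
  \sum_(x : diag n n) X x * delta ^+ n_comp (closure_rel x) predT.

Definition idTL n : TL n n :=
  the_diag (fun d : diag n n => [forall j, d (inl j) == inr j]).

                                                                            
                    
Definition e_gen n (j : nat) : TL n n :=
  the_diag (fun d : diag n n =>
    [forall a : 'I_n, forall b : 'I_n,
       ((a == j :> nat) && (b == j.+1 :> nat)) ==>
       ((d (inl a) == inl b) && (d (inr a) == inr b))]
    && [forall a : 'I_n,
       ((a != j :> nat) && (a != j.+1 :> nat)) ==> (d (inl a) == inr a)]).

Definition is_jones_wenzl n (f : TL n n) : Prop :=
  [/\ f <> 0, f ** f = f &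
      forall j, (j.+1 < n)%N -> e_gen n j ** f = 0 /\ f ** e_gen n j = 0].

                                                                           
                                                 
Definition jw n : TL n n := xget 0 (@is_jones_wenzl n).

Definition Delta n : QA := tr (jw n).

Definition admissible (x y z : nat) : bool :=
  [&& ~~ odd (x + y + z), (x <= y + z)%N, (y <= x + z)%N & (z <= x + y)%N].

                                                                                   
                                                                      
                                                        
Definition vertex_diag x y z : TL (x + y) z :=
  let p := ((x + y - z)./2)%N in
  the_diag (fun d : diag (x + y) z => [forall u : 'I_(x + y),
    if (x - p <= u < x + p)%N
    then [exists v, (d (inl u) == inl v) && ((u + v).+1 == x.*2)%N]
    else [exists v : 'I_z, (d (inl u) == inr v)
            && (v == (if (u < x - p)%N then nat_of_ord u else (u - p.*2)%N) :> nat)]]).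

Definition vertex x y z : TL (x + y) z :=
  jw z ** vertex_diag x y z ** tens (jw x) (jw y).

Definition theta x y z : QA := tr (vertex x y z ** star (vertex x y z)).

                                                                
Fixpoint width (i k : nat) : nat :=
  if k is k'.+1 then (width i k' + i)%N else 0%N.

Lemma widthE i k : width i k = (k * i)%N.
Proof. by elim: k => // k /= ->; rewrite mulSn addnC. Qed.

Fixpoint tens_pow i k : TL (width i k) (width i k) :=
  if k is k'.+1 then tens (tens_pow i k') (jw i) else idTL 0.

                                                                   
Definition colored_TL k i : set (TL (width i k) (width i k)) :=
  [set Y | exists X, Y = tens_pow i k ** X ** tens_pow i k].
Arguments colored_TL k i _ : clear implicits.

Definition adm_seq k i (s : seq nat) : Prop :=
  [/\ size s = k, head 0%N s = i & sorted (fun a b => admissible a b i) s].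

Definition weight (s : seq nat) : nat := last 0%N s.

Definition Lambda k i : set nat :=
  [set (k * i - 2 * j)%N | j in [set j | (j <= (k * i)./2)%N]].

Definition T k i (lam : nat) : set (seq nat) :=
  [set s | adm_seq k i s /\ weight s = lam].

Definition TLambda k i : set (seq nat) := \bigcup_(lam in Lambda k i) T k i lam.

                                                                              
                                        
Definition entry i (s : seq nat) (j : nat) : nat :=
  match j with 0 => 0%N | 1 => i | j'.+2 => nth 0%N s j'.+1 end.

                                                                       
Definition v_step i (s : seq nat) (k : nat) :
    TL (width i k) (entry i s k) -> TL (width i k.+1) (entry i s k.+1) :=
  match k with
  | 0 => fun=> jw i
  | k'.+1 => fun X =>
      vertex (entry i s k'.+1) i (entry i s k'.+2) ** tens X (idTL i)
  end.

Fixpoint v i (s : seq nat) (k : nat) : TL (width i k) (entry i s k) :=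
  if k is k'.+1 then v_step (v i s k') else idTL 0.

Definition eta k i (s : seq nat) : QA :=
  \prod_(1 <= j < k)
     (theta (entry i s j.+1) (entry i s j) i / Delta (entry i s j.+1)).

                                    
Definition G k i (t : seq nat) : TL (width i k) (width i k) :=
  (eta k i t)^-1 *: (star (v i t k) ** v i t k).

                                                                  
Section Idempotents.
Variables (n : nat) (S : set (TL n n)).

Definition is_idempotent (e : TL n n) : Prop := S e /\ e ** e = e.

Definition is_central (e : TL n n) : Prop := forall x, S x -> e ** x = x ** e.

Definition are_orthogonal (a b : TL n n) : Prop := a ** b = 0 /\ b ** a = 0.

Definition primitive_idempotent (e : TL n n) : Prop :=
  [/\ is_idempotent e, e <> 0 &
      ~ exists a b, [/\ is_idempotent a /\ a <> 0, is_idempotent b /\ b <> 0,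
                        are_orthogonal a b & e = a + b]].

Definition primitive_central_idempotent (e : TL n n) : Prop :=
  [/\ is_idempotent e, is_central e, e <> 0 &
      ~ exists a b, [/\ [/\ is_idempotent a, is_central a & a <> 0],
                        [/\ is_idempotent b, is_central b & b <> 0],
                        are_orthogonal a b & e = a + b]].

                                                                         
Definition complete_orthogonal_idempotents (one : TL n n)
    (I : choiceType) (D : set I) (E : I -> TL n n) : Prop :=
  [/\ forall a, D a -> is_idempotent (E a),
      forall a b, D a -> D b -> a <> b -> are_orthogonal (E a) (E b) &
      \sum_(a \in D) E a = one].

End Idempotents.

                                                                              
                                                  
Lemma finite_Lambda k i : finite_set (Lambda k i).
Proof.
apply: (@sub_finite_set _ _ `I_(k * i).+1); last exact: finite_II.
by move=> _ [j _ <-] /=; rewrite ltnS leq_subr.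
Qed.

Lemma adm_seq_le k i s : adm_seq k i s -> {in s, forall a, (a <= k * i)%N}.
Proof.
case=> [<- hd]; case: s hd => [//|a s] /= -> {a} ps.
suff H b : path (fun a b => admissible a b i) b s ->
    forall c, c \in b :: s -> (c <= b + size s * i)%N.
  by move=> c cs; rewrite mulSn; apply: H.
elim: s b {ps} => [|c s IH] b /=.
  by move=> _ d; rewrite inE mul0n addn0 => /eqP ->.
move=> /andP[/and4P[_ _ cle _] /IH H] d; rewrite inE => /orP[/eqP->|/H].
  exact: leq_addr.
by move=> /leq_trans; apply; rewrite mulSn addnA leq_add2r.
Qed.

Lemma finite_T k i lam : finite_set (T k i lam).
Proof.
pose f (t : k.-tuple 'I_(k * i).+1) : seq nat := [seq val a | a <- t].
apply: (@sub_finite_set _ _ (f @` setT)); last exact/finite_image/finite_finset.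
move=> s [sP _]; have sk : size s = k by case: sP.
have szs : size [seq inord a : 'I_(k * i).+1 | a <- s] == k.
  by rewrite size_map sk.
exists (Tuple szs) => //; rewrite /f /= -map_comp -[RHS]map_id.
by apply/eq_in_map => a /(adm_seq_le sP) ale /=; rewrite inordK.
Qed.

Lemma finite_TLambda k i : finite_set (TLambda k i).
Proof.
by apply: bigcup_finite; [exact: finite_Lambda | move=> *; exact: finite_T].
Qed.

(* Main.v *)
(* Colour the boundary points of a diagram by two signs and weight cups and caps
   as in the Kauffman bracket state model. This is a faithful functor from the
   Temperley-Lieb category to matrices over Q(A), which turns [*] into a signed
   transpose; as Q(A) is formally real, X X^* = 0 forces X = 0. Hence f_n is the
   identity minus its orthogonal projection to the span of the other diagrams,
   and no Delta_n or theta(x,y,z) vanishes. Among the diagrams from x + y to z only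
   the one without arcs inside a block survives between projectors, so V V^* is a
   multiple of f_z, and the multiple is theta/Delta because the theta net can be
   rotated. A map out of f_x (x) f_y vanishes once all vertices kill it, which
   gives the fusion identity f_x (x) f_y = sum_z (Delta_z/theta) V^* V. Iterating
   it yields F = sum_t G_tt with v_s v_t^* = delta_st eta(s) f, and
   f_a X f_b is 0 or a scalar multiple of f_a: the G_st are matrix units and
   TL_(k,i) is a sum of full matrix algebras, one for each weight. *)
Require Import Defs.
From mathcomp Require Import all_boot all_order all_algebra.
From mathcomp Require Import boolp.
From mathcomp Require Import zify ring.

Set Implicit Arguments.
Unset Strict Implicit.
Unset Printing Implicit Defensive.

Import Order.TTheory GRing.Theory Num.Theory.
Local Open Scope ring_scope.

(** * Positivity in Q(A) *)

(** No closed formula for [Delta] or [theta] is computed: existence of [f_n] and every division rest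
    on positivity instead.

    Stacking and closing are given combinatorially, through [connect] and [n_comp], so even
    associativity is not immediate. Both are decomposed into single caps between neighbouring
    boundary points: a cap either closes a loop or straightens two arcs into one. Once the state sum
    respects this, each law of the category is a rearrangement of finite sums.

    The order of the arguments of [theta] is a genuine obstacle. With V the vertex from s_j and i to
    s_{j+1}, contracting V with its dual gives theta(s_j, i, s_{j+1}), whereas [eta] contains
    theta(s_{j+1}, s_j, i). The two are rotations of one net, but the weights of the model are not
    rotation invariant: a boundary point carried once around contributes [turn_wt]. These factors
    cancel by charge conservation, because the colours at the two ends of a projector have the same
    characters. *)

Definition nonneg_poly (a : QA) : Prop :=
  exists p q : {poly rat},
    [/\ q != 0, a * tofrac q ^+ 2 = tofrac p & forall x, 0 <= p.[x]].

(** The rationals 0, 1, ... supply [size p] distinct roots, one more than the degree of a nonzero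
    polynomial allows. *)
Lemma poly_rat_eq0 (p : {poly rat}) : (forall x, p.[x] = 0) -> p = 0.
Proof.
move=> p0; apply/eqP; apply/negPn/negP => pn0.
have := @max_poly_roots _ p [seq k%:R | k <- iota 0 (size p)] pn0.
rewrite size_map size_iota ltnn => H; suff: false by []; apply: H; first by apply/allP => x _; apply/eqP.
rewrite map_inj_uniq ?iota_uniq //.
by move=> a b /eqP; rewrite eqr_nat => /eqP.
Qed.

Lemma nonneg_polyD a b : nonneg_poly a -> nonneg_poly b -> nonneg_poly (a + b).
Proof.
case=> p [q [q0 e pos]] [r [s [s0 f rpos]]].
exists (p * s ^+ 2 + r * q ^+ 2), (q * s); split; first by rewrite mulf_neq0.
  have -> : tofrac (p * s ^+ 2 + r * q ^+ 2)
      = tofrac p * tofrac s ^+ 2 + tofrac r * tofrac q ^+ 2 by ring.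
  by rewrite -e -f; ring.
move=> x; rewrite hornerD (hornerM p) (hornerM r) !horner_exp.
by rewrite addr_ge0 // mulr_ge0 // sqr_ge0.
Qed.

Lemma frac_numden (a : QA) :
  exists p q : {poly rat}, q != 0 /\ a * tofrac q = tofrac p.
Proof.
elim/quotW: a => x; exists (frac x).1, (frac x).2.
split; first exact: denom_ratioP.
unlock FracField.tofrac; rewrite -[LHS]FracField.pi_mul.
apply/eqmodP; rewrite /= FracField.equivfE /FracField.mulf.
rewrite !numden_Ratio ?mulf_neq0 ?oner_neq0 ?denom_ratioP //.
by rewrite !mulr1 mulrC.
Qed.

Lemma nonneg_polyX a : nonneg_poly (a ^+ 2).
Proof.
have [p [q [q0 e]]] := frac_numden a.
exists (p ^+ 2), q; split=> //; first by rewrite -exprMn e rmorphXn.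
by move=> x; rewrite horner_exp sqr_ge0.
Qed.

(** After clearing denominators, two polynomials with nonnegative values at all rationals add up to
    0. Each vanishes at every rational, hence identically, and the nonzero denominators cancel. *)
Lemma nonneg_polyD_eq0 a b :
  nonneg_poly a -> nonneg_poly b -> a + b = 0 -> a = 0.
Proof.
case=> p [q [q0 e pos]] [r [s [s0 f rpos]]] ab0.
have h : p * s ^+ 2 + r * q ^+ 2 = 0.
  apply/eqP; rewrite -tofrac_eq0.
  have -> : tofrac (p * s ^+ 2 + r * q ^+ 2)
      = tofrac p * tofrac s ^+ 2 + tofrac r * tofrac q ^+ 2 by ring.
  rewrite -e -f; have -> : b = - a by apply/eqP; rewrite -addr_eq0 addrC ab0.
  by apply/eqP; ring.
have : p * s ^+ 2 = 0.
  apply: poly_rat_eq0 => x; apply/eqP; rewrite eq_le; apply/andP; split.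
    have := congr1 (horner^~ x) h; rewrite hornerD horner0 => /eqP.
    rewrite addr_eq0 => /eqP ->; rewrite oppr_le0 hornerM horner_exp.
    by rewrite mulr_ge0 ?sqr_ge0.
  by rewrite hornerM horner_exp mulr_ge0 ?sqr_ge0.
move/eqP; rewrite mulf_eq0 expf_eq0 (negPf s0) andbF orbF => /eqP p0.
apply/eqP; move/eqP: e; rewrite p0 rmorph0 mulf_eq0 expf_eq0 /= tofrac_eq0.
by rewrite (negPf q0) orbF.
Qed.

Lemma sum_sqr_eq0 (I : finType) (F : I -> QA) :
  \sum_i F i ^+ 2 = 0 -> forall i, F i = 0.
Proof.
move=> h i; apply/eqP; rewrite -sqrf_eq0; apply/eqP.
apply: nonneg_polyD_eq0 (nonneg_polyX _) _ (_ : _ + \sum_(j | j != i) F j ^+ 2 = 0).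
  apply: (big_ind nonneg_poly); last by move=> j _; exact: nonneg_polyX.
    by have := nonneg_polyX 0; rewrite expr0n.
  exact: nonneg_polyD.
by rewrite -[RHS]h [RHS](bigD1 i).
Qed.

Lemma A_neq0 : A != 0.
Proof. by rewrite /A tofrac_eq0 polyX_eq0. Qed.

(** [- delta] is the sum of the squares of [A] and of its inverse. *)
Lemma delta_neq0 : delta != 0.
Proof.
rewrite /delta -opprD oppr_eq0; apply/eqP => h.
have := @sum_sqr_eq0 bool (fun b => if b then A else A^-1).
rewrite big_bool /= exprVn h => /(_ erefl true) /eqP.
by rewrite (negPf A_neq0).
Qed.

(** * Weights of the Kauffman bracket state model *)

Section Weights.
Variables (K : fieldType) (A : K).
Hypothesis A0 : A != 0.

(* The cup vector and the cap covector of the Kauffman bracket state model,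
   mutually inverse as 2 x 2 matrices. *)
Definition cup_wt (a b : bool) : K :=
  if a then (if b then 0 else A) else (if b then - A^-1 else 0).
Definition cap_wt (a b : bool) : K := - cup_wt a b.

Lemma cup_wt_neq0 a b : (cup_wt a b != 0) = (b == ~~ a).
Proof.
by case: a b => [] []; rewrite /cup_wt ?oppr_eq0 ?invr_eq0 ?A0 ?eqxx.
Qed.

Lemma cup_wt_negb a b : cup_wt (~~ a) (~~ b) = cup_wt b a.
Proof. by case: a b => [] []. Qed.

(** Straightening relations: a cap between neighbouring ends of two arcs leaves a single arc. The
    three identities are the three planar positions: arcs side by side, nested arcs capped at their
    right ends, nested arcs capped at their left ends. *)
Lemma zigzag_cup x y :
  \sum_c \sum_e cap_wt c e * (cup_wt x c * cup_wt e y) = cup_wt x y.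
Proof. by rewrite !big_bool; case: x y => [] []; rewrite /cap_wt /=; field. Qed.

Lemma cup_cup_left x y :
  \sum_c \sum_e cap_wt c e * (cup_wt x c * cup_wt y e) = cup_wt y x.
Proof. by rewrite !big_bool; case: x y => [] []; rewrite /cap_wt /=; field. Qed.

Lemma cup_cup_right x y :
  \sum_c \sum_e cap_wt c e * (cup_wt c x * cup_wt e y) = cup_wt y x.
Proof. by rewrite !big_bool; case: x y => [] []; rewrite /cap_wt /=; field. Qed.

Lemma cap_cup_loop :
  \sum_c \sum_e cap_wt c e * cup_wt c e = - A ^+ 2 - A ^- 2.
Proof. by rewrite !big_bool /cap_wt /=; field. Qed.

End Weights.

(** * Planar matchings and state sums *)

Section Matching.
Variables (P : finType) (ps : P -> nat).
Hypothesis ps_inj : injective ps.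
Implicit Types (D : {set P}) (M : P -> P) (s : P -> bool).

Definition matching D M :=
  {in D, forall p, [/\ M p \in D, M (M p) = p & M p != p]}.
Definition noncrossing D M := {in D &, forall p q,
  ~~ [&& (ps p < ps q)%N, (ps q < ps (M p))%N & (ps (M p) < ps (M q))%N]}.
(** Planarity stated as: a point under an arc has its partner under the same arc. It does not ask
    which end of the other arc comes first, which suits the case analyses. *)
Definition nested D M := forall q p, q \in D -> p \in D ->
  (ps q < ps p < ps (M q))%N -> (ps q < ps (M p) < ps (M q))%N.
Definition opener M : pred P := fun p => (ps p < ps (M p))%N.
Lemma big_matching (R : Type) (idx : R) (op : Monoid.com_law idx)
    D M (Q : pred P) F : matching D M ->
  \big[op/idx]_(p in D | Q p) F p = \big[op/idx]_(p in D | Q (M p)) F (M p).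
Proof.
move=> mM; rewrite (reindex_onto M M) /= => [|p /andP[/mM[]]//].
apply: eq_bigl => p; apply/andP/andP => [[/andP[Mp q] /eqP e]|[Dp q]].
  by split=> //; rewrite -e; case: (mM _ Mp).
by have [-> -> _] := mM _ Dp.
Qed.

Lemma openerM D M p : matching D M -> p \in D -> opener M (M p) = ~~ opener M p.
Proof.
move=> mM /mM[_ e n]; rewrite /opener e -leqNgt [RHS]leq_eqVlt.
by rewrite (inj_eq ps_inj) (negPf n).
Qed.

Lemma big_arcs (R : Type) (idx : R) (op : Monoid.com_law idx) D M F :
  matching D M ->
  \big[op/idx]_(p in D) F p
    = \big[op/idx]_(p in D | opener M p) op (F p) (F (M p)).
Proof.
move=> mM; rewrite big_split (bigID (opener M)) /=; congr (op _ _).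
rewrite (big_matching _ _ _ mM); apply: eq_bigl => p.
by case Dp: (p \in D) => //=; rewrite (openerM mM Dp) negbK.
Qed.

(** Serves to compare two orders on the same points: the openers for the other order pick one end of
    each arc, not necessarily the end that comes first here. A rotation of the boundary creates this
    situation. *)
Lemma big_transversal (R : Type) (idx : R) (op : Monoid.com_law idx)
    D M (o : pred P) F :
  matching D M -> {in D, forall p, o (M p) = ~~ o p} ->
  \big[op/idx]_(p in D | o p) F p
    = \big[op/idx]_(p in D | opener M p) (if o p then F p else F (M p)).
Proof.
move=> mM oM; rewrite (bigID (opener M)) [RHS](bigID o) /=; congr (op _ _).
  by apply: eq_big => p; [rewrite andbAC | case/andP=> [/andP[_ ->]]].
under eq_bigl do rewrite -andbA; rewrite (big_matching _ _ _ mM).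
under [RHS]eq_bigl do rewrite -andbA.
apply: eq_big => p; last by case/and3P=> Dp; rewrite oM // => /negPf ->.
by case Dp: (p \in D) => //=; rewrite (openerM mM Dp) oM // negbK andbC.
Qed.

Lemma noncrossing_nested D M : matching D M -> noncrossing D M <-> nested D M.
Proof.
move=> mM; split=> [nc q p Dq Dp /andP[qp pMq]|ns p q Dp Dq]; last first.
  by apply/and3P => -[pq qMp MpMq]; have := ns p q Dp Dq; rewrite pq qMp; lia.
have [DMp MMp nMp] := mM _ Dp; have [DMq MMq nMq] := mM _ Dq.
have neq x y : x != y -> ps x != ps y by rewrite (inj_eq ps_inj).
have /neq n1 : M p != q.
  by apply: contraTneq pMq => <-; rewrite MMp ltnn.
have /neq n2 : M p != M q.
  by apply: contraTneq qp => e; rewrite -MMq -e MMp ltnn.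
have := nc q p Dq Dp; have := nc (M p) q DMp Dq; rewrite MMp; lia.
Qed.

Lemma matchingD1 D M p : matching D M -> p \in D -> matching (D :\ p :\ M p) M.
Proof.
move=> mM Dp q; rewrite !inE => /and3P[qM qp Dq].
have [DM MM nM] := mM _ Dq; have [DMp MMp nMp] := mM _ Dp.
split=> //; rewrite DM andbT; apply/andP; split; apply/eqP => e.
  by move/eqP: qp; rewrite -MM e MMp.
by move/eqP: qM; rewrite -MM e.
Qed.

(** What remains of a matching when [a] and [b] are joined by a cap: their partners become partners.
    If [a] and [b] were partners already, the altered values lie outside the remaining points. *)
Definition capM M a b : P -> P :=
  fun q => if q == M a then M b else if q == M b then M a else M q.

Section Cap.
Variables (D : {set P}) (M : P -> P) (a b : P).
Hypotheses (mM : matching D M) (ncM : noncrossing D M).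
Hypotheses (Da : a \in D) (Db : b \in D) (ab : (ps a < ps b)%N).
Hypothesis adj : {in D, forall p, ~~ ((ps a < ps p)%N && (ps p < ps b)%N)}.
Let D' := D :\ a :\ b.
Let M' := capM M a b.

Let neq_ab : a != b.
Proof. by apply: contraTneq ab => ->; rewrite ltnn. Qed.

Let Minj x y : x \in D -> y \in D -> M x = M y -> x = y.
Proof. by move=> /mM[_ ex _] /mM[_ ey _] e; rewrite -[x]ex e ey. Qed.

Lemma capM_matching : matching D' M'.
Proof.
have [DMa MMa nMa] := mM Da; have [DMb MMb nMb] := mM Db.
move=> q; rewrite !inE /M' /capM => /and3P[qb qa Dq]; have [DMq MMq nMq] := mM Dq.
have MaMb : M b != M a.
  by apply: contraNneq neq_ab => /(Minj Db Da) ->.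
have [e|qMa] /= := eqVneq q (M a).
  rewrite (negPf MaMb) eqxx e DMb nMb MaMb; split=> //; rewrite !andbT /=.
  by apply: contraNneq qb => f; rewrite e -f MMb.
have [e|qMb] /= := eqVneq q (M b).
  rewrite eqxx e DMa nMa [M a == M b]eq_sym MaMb; split=> //; rewrite !andbT /=.
  by apply: contraNneq qa => f; rewrite e -f MMa.
have Mqa : M q != a by apply: contraNneq qMa => <-; rewrite MMq.
have Mqb : M q != b by apply: contraNneq qMb => <-; rewrite MMq.
have -> : (M q == M a) = false by apply: contraNF qa => /eqP/(Minj Dq Da) ->.
have -> : (M q == M b) = false by apply: contraNF qb => /eqP/(Minj Dq Db) ->.
by rewrite Mqa Mqb.
Qed.

Let nD' p : p \in D' -> [/\ p \in D, ps p <> ps a & ps p <> ps b].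
Proof.
rewrite !inE => /and3P[pb pa Dp]; split=> //; apply/eqP; rewrite (inj_eq ps_inj);
  by [].
Qed.

Let nD'_adj p : p \in D' -> (ps p < ps a)%N \/ (ps b < ps p)%N.
Proof. by move=> /nD'[Dp pa pb]; have := adj Dp; lia. Qed.

(** No point of [D] lies between [a] and [b], so each remaining point is before both or after both.
    According to the sides of [M a] and [M b], nestedness of the old arcs settles every case. *)
Lemma capM_noncrossing : noncrossing D' M'.
Proof.
apply/noncrossing_nested; first exact: capM_matching.
have ns : nested D M by apply/noncrossing_nested.
have [DMa MMa nMa] := mM Da; have [DMb MMb nMb] := mM Db.
have neq x y : x != y -> ps x <> ps y.
  by move=> n; apply/eqP; rewrite (inj_eq ps_inj).
have psMM x y : x \in D -> y \in D -> x != y -> ps (M x) <> ps (M y).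
  by move=> Dx Dy; rewrite -(inj_in_eq Minj) // => /neq.
have side x : x \in D -> ps x <> ps a -> ps x <> ps b ->
    (ps x < ps a)%N \/ (ps b < ps x)%N.
  by move=> /adj; clear; lia.
have Mside x : x \in D -> x != M a -> x != M b ->
    (ps (M x) < ps a)%N \/ (ps b < ps (M x))%N.
  move=> Dx xa xb; have [DMx MMx _] := mM Dx; apply: side => //; apply: neq.
    by apply: contraNneq xa => <-; rewrite MMx.
  by apply: contraNneq xb => <-; rewrite MMx.
have nMab : M a != M b by apply: contraNneq neq_ab => /(Minj Da Db) ->.
move=> q x D'q D'x; have [Dq qa qb] := nD' D'q; have [Dx xa xb] := nD' D'x.
have [DMx MMx nMx] := mM Dx.
have sx := nD'_adj D'x; have nxa : ps (M x) <> ps (M a).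
  by apply: psMM => //; apply: contraPneq xa => ->.
have nxb : ps (M x) <> ps (M b).
  by apply: psMM => //; apply: contraPneq xb => ->.
rewrite /M' /capM; have [eq|qMa] /= := eqVneq q (M a).
  move: qa qb; rewrite {q D'q Dq}eq => qa qb.
  have [->|xMa] /= := eqVneq x (M a); first by rewrite ltnn.
  have [->|xMb] /= := eqVneq x (M b); first by rewrite ltnn andbF.
  have Mba : ps (M b) <> ps a.
    by apply: neq; apply: contraPneq qb => <-; rewrite MMb.
  move=> /andP[l r].
  have [h1|h1] := side _ DMa qa qb; have [h2|h2] := side _ DMb Mba (neq _ _ nMb).
  - have := ns (M a) (M b) DMa DMb; rewrite MMa MMb; clear -l r h1 h2 ab; lia.
  - case: sx => h3.
      have := ns (M a) x DMa Dx; rewrite MMa; clear -l r h1 h2 h3 ab; lia.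
    have := ns b x Db Dx; clear -l r h1 h2 h3 ab; lia.
  - clear -l r h1 h2 ab; lia.
  - have := ns b (M a) Db DMa; rewrite MMa; clear -l r h1 h2 ab; lia.
have [eq|qMb] /= := eqVneq q (M b).
  move: qa qb; rewrite {q D'q Dq qMa}eq => qa qb.
  have [->|xMa] /= := eqVneq x (M a); first by rewrite ltnn andbF.
  have [->|xMb] /= := eqVneq x (M b); first by rewrite ltnn.
  have Mab : ps (M a) <> ps b.
    by apply: neq; apply: contraPneq qa => <-; rewrite MMa.
  move=> /andP[l r]; have sMx := Mside _ Dx xMa xMb.
  have [h1|h1] := side _ DMa (neq _ _ nMa) Mab; have [h2|h2] := side _ DMb qa qb.
  - have := ns (M b) x DMb Dx; have := ns (M a) (M x) DMa DMx.
    rewrite MMa MMb MMx; case: sMx => h3; clear -l r h1 h2 h3 ab nxa; lia.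
  - clear -l r h1 h2 ab; lia.
  - have := ns (M b) a DMb Da; rewrite MMb; clear -l r h1 h2 ab; lia.
  - have := ns a x Da Dx; have := ns b (M x) Db DMx; rewrite MMx.
    case: sMx => h3; clear -l r h1 h2 h3 ab nxb; lia.
have [ex|xMa] /= := eqVneq x (M a).
  have := ns q x Dq Dx; have := ns q b Dq Db; rewrite ex MMa.
  by case: (Mside _ Dq qMa qMb) => h3; clear -qa qb h3 ab; lia.
have [ex|xMb] /= := eqVneq x (M b); last exact: ns.
have := ns q x Dq Dx; have := ns q a Dq Da; rewrite ex MMb.
by case: (nD'_adj D'q) => h3; clear -qa qb h3 ab; lia.
Qed.

End Cap.
Variables (K : fieldType) (A : K).
Hypothesis A0 : A != 0.
Notation cup_wt := (cup_wt A).
Notation cap_wt := (cap_wt A).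

Definition wt D M s : K :=
  \prod_(p in D | opener M p) cup_wt (s p) (s (M p)).

Lemma eq_wt D M s s' : matching D M -> {in D, s =1 s'} -> wt D M s = wt D M s'.
Proof.
by move=> mM e; apply: eq_bigr => p /andP[Dp _]; rewrite !e //; case: (mM _ Dp).
Qed.

Lemma eq_wtM D M M' s : {in D, M =1 M'} -> wt D M s = wt D M' s.
Proof.
move=> e; rewrite /wt (eq_bigl (fun p => (p \in D) && opener M' p)) => [|p].
  by apply: eq_bigr => p /andP[Dp _]; rewrite e.
by case Dp: (p \in D); rewrite //= /opener e.
Qed.

Lemma wt_neq0 D M s : wt D M s != 0 ->
  {in D, forall p, opener M p -> s (M p) = ~~ s p}.
Proof.
move=> w p Dp o; apply/eqP; rewrite -(cup_wt_neq0 A0); apply: contra w => /eqP w0.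
by rewrite /wt (bigD1 p) ?Dp //= w0 mul0r.
Qed.

(** Charge conservation: where the weight does not vanish, every arc has one end of each colour, so
    [g] contributes the same factor on each arc. *)
Lemma wt_charge D M s (g : bool -> K) : matching D M -> wt D M s != 0 ->
  \prod_(p in D) g (s p) = (g true * g false) ^+ (#|D|./2).
Proof.
move=> mM w; rewrite (big_arcs _ _ mM).
rewrite (eq_bigr (fun=> g true * g false)) => [|p /andP[Dp o]]; last first.
  by rewrite (wt_neq0 w) //; case: (s p); rewrite //= mulrC.
rewrite big_const iter_mulr_1; congr (_ ^+ _).
have -> : #|D| = \sum_(p in D | opener M p) 2 by rewrite -sum1_card (big_arcs _ _ mM).
by rewrite sum_nat_const muln2 doubleK; apply: eq_card.
Qed.

Definition arc_wt s p q : K :=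
  if (ps p < ps q)%N then cup_wt (s p) (s q) else cup_wt (s q) (s p).

Lemma wtD1 D M s p : matching D M -> p \in D ->
  wt D M s = arc_wt s p (M p) * wt (D :\ p :\ M p) M s.
Proof.
move=> mM Dp; have [DM MM nM] := mM _ Dp; rewrite /wt /arc_wt.
have [o|o] := boolP (opener M p).
  rewrite (bigD1 p) ?Dp //=; rewrite -/(opener M p) o; congr (_ * _).
  apply: eq_bigl => q; rewrite !inE.
  case: (q =P M p) => [->|_] /=; first by rewrite (openerM mM) // o andbF.
  by rewrite andbAC [_ && (q \in D)]andbC.
rewrite (bigD1 (M p)) ?DM ?(openerM mM) ?o //=; rewrite -/(opener M p) (negPf o) MM.
congr (_ * _); apply: eq_bigl => q; rewrite !inE.
case: (q =P p) => [->|_] /=; first by rewrite (negPf o) !andbF.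
by rewrite andbC andbA.
Qed.

Definition upd s p c : P -> bool := fun q => if q == p then c else s q.

Definition cap (a b : P) (f : (P -> bool) -> K) s : K :=
  \sum_c \sum_e cap_wt c e * f (upd (upd s a c) b e).

Section WtCap.
Variables (D : {set P}) (M : P -> P) (a b : P).
Hypotheses (mM : matching D M) (ncM : noncrossing D M).
Hypotheses (Da : a \in D) (Db : b \in D) (ab : (ps a < ps b)%N).
Hypothesis adj : {in D, forall p, ~~ ((ps a < ps p)%N && (ps p < ps b)%N)}.
Let D' := D :\ a :\ b.
Let M' := capM M a b.

Let neq_ab : a != b.
Proof. by apply: contraTneq ab => ->; rewrite ltnn. Qed.

Let Minj x y : x \in D -> y \in D -> M x = M y -> x = y.
Proof. by move=> /mM[_ ex _] /mM[_ ey _] e; rewrite -[x]ex e ey. Qed.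

Let mM' : matching D' M'. Proof. exact: capM_matching ab. Qed.

(** If [a] and [b] are partners the cap closes a loop; otherwise it fuses the arcs at [a] and [b],
    whose relative position selects one of the straightening relations. *)
Lemma wt_cap s : cap a b (wt D M) s = (- A ^+ 2 - A ^- 2) ^+ (M a == b) * wt D' M' s.
Proof.
have [DMa MMa nMa] := mM Da; have [DMb MMb nMb] := mM Db.
have ns : nested D M by apply/noncrossing_nested.
rewrite /cap; have [e|n] /= := eqVneq (M a) b.
  rewrite expr1 -(cap_cup_loop A0) mulr_suml; apply: eq_bigr => c _.
  rewrite mulr_suml; apply: eq_bigr => d _; rewrite -mulrA; congr (_ * _).
  rewrite (wtD1 _ mM Da) e /arc_wt ab; congr (_ * _).
    by rewrite /upd eqxx (negPf neq_ab) eqxx.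
  have mD' := matchingD1 mM Da; rewrite e in mD'.
  rewrite (@eq_wtM _ M M') => [|q]; last first.
    rewrite !inE /M' /capM e => /and3P[/negPf -> qa Dq].
    by have -> : M b = a; rewrite -?e // (negPf qa).
  apply: eq_wt => [|q]; first exact: mM'.
  by rewrite !inE /upd => /and3P[/negPf -> /negPf ->].
have MaMb : M a != M b by apply: contraNneq neq_ab => /(Minj Da Db) ->.
have nMba : M b != a by apply: contraNneq n => <-; rewrite MMb.
have m1 := matchingD1 mM Da; have Db1 : b \in D :\ a :\ M a.
  by rewrite !inE Db eq_sym n eq_sym neq_ab.
have m2 := matchingD1 m1 Db1.
have D'Ma : M a \in D' by rewrite !inE DMa nMa n.
have M'Ma : M' (M a) = M b by rewrite /M' /capM eqxx.
rewrite expr0 mul1r (wtD1 s mM' D'Ma) M'Ma.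
have eD : D :\ a :\ M a :\ b :\ M b = D' :\ M a :\ M b.
  by apply/setP => q; rewrite !inE; do ![case: eqP => _ //=].
have -> : wt (D' :\ M a :\ M b) M' s = wt (D :\ a :\ M a :\ b :\ M b) M s.
  rewrite eD; apply: eq_wtM => q; rewrite !inE /M' /capM.
  by case/and3P=> /negPf -> /negPf ->.
transitivity (\sum_c \sum_e cap_wt c e *
   (arc_wt (upd (upd s a c) b e) a (M a) * arc_wt (upd (upd s a c) b e) b (M b)) *
   wt (D :\ a :\ M a :\ b :\ M b) M s).
  apply: eq_bigr => c _; apply: eq_bigr => e _.
  rewrite (wtD1 _ mM Da) (wtD1 _ m1 Db1) -!mulrA; do 3 congr (_ * _).
  apply: eq_wt => // q; rewrite !inE /upd.
  by case/and5P=> _ /negPf -> _ /negPf ->.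
under eq_bigr do rewrite -mulr_suml.
rewrite -mulr_suml; congr (_ * _).
rewrite /arc_wt /upd eqxx (negPf neq_ab) eqxx (negPf n) (negPf nMa) (negPf nMb) (negPf nMba).
have neq x y : x != y -> ps x <> ps y.
  by move=> k; apply/eqP; rewrite (inj_eq ps_inj).
have h1 := adj DMa; have h2 := adj DMb.
have h3 := neq _ _ nMa; have h4 := neq _ _ nMb; have h5 := neq _ _ n.
have h6 := neq _ _ nMba; have h7 := neq _ _ MaMb.
have h8 := ns (M b) a DMb Da; have h9 := ns b (M a) Db DMa.
have ha := ns (M a) (M b) DMa DMb; have hb := ns a (M b) Da DMb.
rewrite MMa MMb in h8 h9 ha hb.
(* Of the eight sign patterns planarity leaves three, one for each straightening relation. *)
case: (ltnP (ps a) (ps (M a))) => aMa; case: (ltnP (ps b) (ps (M b))) => bMb;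
  case: (ltnP (ps (M a)) (ps (M b))) => MaMb'.
all: try by exfalso; clear -h1 h2 h3 h4 h5 h6 h7 h8 h9 ha hb aMa bMb MaMb' ab; lia.
- exact: cup_cup_right.
- exact: zigzag_cup.
- exact: cup_cup_left.
Qed.

End WtCap.
End Matching.

(** * Contracting a nested family of caps *)

Section Contract.
Variables (K : fieldType) (A : K).
Hypothesis A0 : A != 0.
Variables (P : finType) (ps : P -> nat).
Hypothesis ps_inj : injective ps.
Variables (J : eqType) (a b : J -> P).
Implicit Types (D : {set P}) (M : P -> P) (s : seq J).

Local Notation loop_wt := (- A ^+ 2 - A ^- 2).

Definition gluing D M s : rel P := fun u v =>
  (u \in D) && (v == M u)
  || has (fun j => (u == a j) && (v == b j) || (u == b j) && (v == a j)) s.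

(** Adjacency is demanded only after the earlier pairs are removed, so the caps may be nested inside
    one another. Stacking and trace closure both have this form. *)
Fixpoint nested_pairs D s : Prop :=
  if s is j :: s' then
    [/\ a j \in D, b j \in D, (ps (a j) < ps (b j))%N,
        {in D, forall p, ~~ ((ps (a j) < ps p)%N && (ps p < ps (b j))%N)} &
        nested_pairs (D :\ a j :\ b j) s']
  else True.

Fixpoint unglued D s : {set P} :=
  if s is j :: s' then unglued (D :\ a j :\ b j) s' else D.

Fixpoint caps s (f : (P -> bool) -> K) : (P -> bool) -> K :=
  if s is j :: s' then caps s' (cap A (a j) (b j) f) else f.

Lemma unglued_sub D s : unglued D s \subset D.
Proof.
elim: s D => [|j s IH] D /=; first exact: subxx.
apply: subset_trans (IH _) _; by apply/subsetP => p; rewrite !inE => /and3P[].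
Qed.

Lemma nested_pairs_in D s j : nested_pairs D s -> j \in s -> a j \in D /\ b j \in D.
Proof.
elim: s D => //= i s IH D [ai bi _ _ /IH{}IH]; rewrite inE => /orP[/eqP->//|/IH].
by rewrite !inE => -[/and3P[_ _ ->] /and3P[_ _ ->]].
Qed.

Lemma gluing_sym D M s : matching D M -> connect_sym (gluing D M s).
Proof.
move=> mM; apply: sym_connect_sym => u v; rewrite /gluing.
congr (_ || _).
  apply/andP/andP => -[Du /eqP ->]; by have [-> ->] := mM _ Du.
by apply: eq_has => j; rewrite orbC ![(v == _) && _]andbC.
Qed.

Lemma gluing_nil D M u v : matching D M -> u \in D ->
  connect (gluing D M [::]) u v = (v == u) || (v == M u).
Proof.
move=> mM Du; apply/idP/idP => [|/orP[]/eqP ->]; last first.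
- by apply: connect1; rewrite /gluing Du eqxx.
- exact: connect0.
have [DM MM _] := mM _ Du.
suff cl : closed (gluing D M [::]) [pred x | (x == u) || (x == M u)].
  by move/(closed_connect cl); rewrite !inE eqxx => <-.
apply: intro_closed => [|x y]; first exact: gluing_sym.
rewrite /gluing orbF !inE => /andP[_ /eqP ->] /orP[]/eqP ->.
  by rewrite eqxx orbT.
by rewrite MM eqxx.
Qed.

Section Step.
Variables (D : {set P}) (M : P -> P) (j : J) (s : seq J).
Hypotheses (mM : matching D M) (ncM : noncrossing ps D M).
Hypothesis ns : nested_pairs D (j :: s).
Let D' := D :\ a j :\ b j.
Let M' := capM M (a j) (b j).
(** Slides the two capped points along their arcs to their partners; when they are not partners of
    each other, this retracts [D] onto the points that remain. *)
Let h p := if p == a j then M (a j) else if p == b j then M (b j) else p.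
Let g := gluing D M (j :: s).
Let g' := gluing D' M' s.

Let Da : a j \in D. Proof. by case: ns. Qed.
Let Db : b j \in D. Proof. by case: ns. Qed.
Let ab : (ps (a j) < ps (b j))%N. Proof. by case: ns. Qed.
Let neq_ab : a j != b j.
Proof. by apply: contraTneq ab => ->; rewrite ltnn. Qed.
Let mM' : matching D' M'.
Proof. exact: capM_matching ab. Qed.
Let sg : connect_sym g. Proof. exact: gluing_sym. Qed.
Let sg' : connect_sym g'. Proof. exact: gluing_sym. Qed.

Let ns' : nested_pairs D' s. Proof. by case: ns. Qed.

Let closedD' : closed g' [pred p in D'].
Proof.
apply: intro_closed => // x y; rewrite /g' /gluing => /orP[/andP[Dx /eqP ->] _|].
  by case: (mM' Dx).
case/hasP=> i si /orP[] /andP[_ /eqP ->] _;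
  by case: (nested_pairs_in ns' si).
Qed.

Let h_id p : p \in D' -> h p = p.
Proof. by rewrite !inE /h => /and3P[/negPf -> /negPf ->]. Qed.

Let gM p : p \in D -> g p (M p).
Proof. by move=> Dp; rewrite /g /gluing Dp eqxx. Qed.

Let g_ab : g (a j) (b j).
Proof. by rewrite /g /gluing /= !eqxx /= orbT. Qed.

Let g_tail x y : has (fun i => (x == a i) && (y == b i)
    || (x == b i) && (y == a i)) s -> g x y.
Proof. by move=> H; rewrite /g /gluing /= H !orbT. Qed.

Let g'_tail x y : has (fun i => (x == a i) && (y == b i)
    || (x == b i) && (y == a i)) s -> [/\ g' x y, x \in D' & y \in D'].
Proof.
move=> H; rewrite /g' /gluing H orbT; case/hasP: H => i si.
have [ai bi] := nested_pairs_in ns' si.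
by case/orP=> /andP[/eqP -> /eqP ->].
Qed.

(** An adjunction of relations transfers both [connect] and [n_comp], so the glued graph can be
    replaced by the smaller one in either count. *)
Lemma contract_adjunction : rel_adjunction h g' g [pred p in D'].
Proof.
have [_ MMa nMa] := mM Da; have [_ MMb nMb] := mM Db.
apply: (intro_adjunction sg closedD' (fun x _ => x)) => [x D'x|x D'hx].
  rewrite h_id //; split=> [|y D'y]; first exact: connect0.
  rewrite /g' /gluing => /orP[/andP[_ /eqP ->]|/g_tail]; last exact: connect1.
  rewrite /M' /capM; have [->|xMa] := eqVneq x (M (a j)).
    apply: connect_trans (connect1 (gM Db)).
    apply: connect_trans (connect1 g_ab).
    by rewrite sg connect1 // gM.
  have [->|xMb] := eqVneq x (M (b j)).
    apply: connect_trans (connect1 (gM Da)).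
    rewrite sg; apply: connect_trans (connect1 g_ab) (connect1 _); exact: gM.
  by apply/connect1/gM; move: D'x; rewrite !inE => /and3P[].
have D'Ma p : h p \in D' -> p = a j -> M (a j) != b j.
  by rewrite /h => + e; rewrite e eqxx !inE => /and3P[].
have D'Mb p : h p \in D' -> p = b j -> M (a j) != b j.
  rewrite /h => + e; rewrite e eq_sym (negPf neq_ab) eqxx !inE => /and3P[_ n _].
  by apply: contraNneq n => <-; rewrite MMa.
split.
  rewrite /h; case: eqP => [->|_]; first exact/connect1/gM.
  by case: eqP => [->|_]; [exact/connect1/gM | exact: connect0].
have MaMb : M (a j) != M (b j).
  by apply: contraNneq neq_ab => e; rewrite -MMa e MMb.
have g'ab : M (a j) != b j -> connect g' (M (a j)) (M (b j)).
  move=> n; apply: connect1; rewrite /g' /gluing /M' /capM eqxx.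
  by rewrite !inE n nMa /=; have [-> _ _] := mM Da; rewrite eqxx.
have hMa : M (a j) != b j -> h (M (a j)) = M (a j).
  by rewrite /h (negPf nMa) => /negPf ->.
have hMb : M (a j) != b j -> h (M (b j)) = M (b j).
  rewrite /h (negPf nMb) => n; case: eqP => // e.
  by case/eqP: n; rewrite -e MMb.
have hb : h (b j) = M (b j) by rewrite /h eq_sym (negPf neq_ab) eqxx.
have ha : h (a j) = M (a j) by rewrite /h eqxx.
move=> y; rewrite /g /gluing /= => /or3P[/andP[Dx /eqP ->]|ejj|].
- have [ex|xa] := eqVneq x (a j).
    by have n := D'Ma _ D'hx ex; rewrite ex ha hMa.
  have [ex|xb] := eqVneq x (b j).
    by have n := D'Mb _ D'hx ex; rewrite ex hb hMb.
  have D'x : x \in D' by rewrite !inE xa xb Dx.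
  rewrite (h_id D'x); have [_ MMx _] := mM Dx.
  have [e|Mxa] := eqVneq (M x) (a j); first by rewrite e ha -e MMx.
  have [e|Mxb] := eqVneq (M x) (b j); first by rewrite e hb -e MMx.
  rewrite /h (negPf Mxa) (negPf Mxb); apply: connect1; rewrite /g' /gluing D'x.
  rewrite /M' /capM.
  have -> : (x == M (a j)) = false by apply: contraNF Mxa => /eqP ->; rewrite MMa.
  have -> : (x == M (b j)) = false by apply: contraNF Mxb => /eqP ->; rewrite MMb.
  by rewrite eqxx.
- case/orP: ejj => /andP[/eqP ex /eqP ->].
    by have n := D'Ma _ D'hx ex; rewrite ex ha hb; exact: g'ab.
  by have n := D'Mb _ D'hx ex; rewrite ex ha hb sg'; exact: g'ab.
- by case/g'_tail=> gxy D'x D'y; rewrite !h_id //; exact: connect1.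
Qed.

Lemma contract_connect u v : u \in D' -> v \in D' -> connect g u v = connect g' u v.
Proof.
move=> D'u D'v; have [_ f] := contract_adjunction.
by rewrite f ?h_id.
Qed.

(** If [a j] and [b j] are partners, arc and cap close up and the pair is a component by itself,
    lost under [h]; otherwise the components on the two sides correspond. *)
Lemma contract_n_comp (O : {set P}) : O \subset D' ->
  n_comp g [pred p in D | [forall q in O, ~~ connect g p q]]
    = ((M (a j) == b j) +
       n_comp g' [pred p in D' | [forall q in O, ~~ connect g' p q]])%N.
Proof.
move=> /subsetP OD'; pose c' := [pred p in D' | [forall q in O, ~~ connect g' p q]].
have inD' p : (p \in D') = [&& p != b j, p != a j & p \in D] by rewrite !inE.
have [hu hf] := contract_adjunction; clearbody D'.
have adj' : rel_adjunction h g' g c'.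
  split=> [x /andP[D'x _]|x y /andP[D'x _]].
    exact: hu.
  exact: hf.
have cl' : closed g' c'.
  apply: intro_closed => // x y gxy; rewrite !inE => /andP[D'x /forall_inP H].
  have D'y : y \in D' by have := closedD' gxy; rewrite inE D'x => <-.
  rewrite D'y; apply/forall_inP => q /H; apply: contra.
  exact/connect_trans/connect1.
rewrite (adjunction_n_comp h sg' sg cl' adj').
have hD' p : p \in D -> (h p \in D') = (p \in D') || (M (a j) != b j).
  move=> Dp; have [_ MMa nMa] := mM Da; have [_ MMb nMb] := mM Db.
  rewrite /h !inD' Dp; have [->|pa] := eqVneq p (a j).
    by have [-> _ _] := mM Da; rewrite nMa !andbT andbF.
  have [_|pb] /= := eqVneq p (b j); last by rewrite pa pb Dp.
  have [-> _ _] := mM Db; rewrite nMb /= andbT.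
  by congr (~~ _); apply/eqP/eqP => <-; rewrite ?MMb ?MMa.
have hnD p : p \notin D -> h p \notin D'.
  move=> nD; rewrite /h; case: eqP nD => [->|_]; first by rewrite Da.
  case: eqP => [->|_]; first by rewrite Db.
  by apply: contra; rewrite inD' => /and3P[].
have hc p : h p \in D' -> [forall q in O, ~~ connect g' (h p) q]
    = [forall q in O, ~~ connect g p q].
  move=> D'hp; apply: eq_forallb => q; case Oq: (q \in O) => //=.
  by rewrite hf // (h_id (OD' _ Oq)).
have [e|n] /= := eqVneq (M (a j)) (b j); last first.
  apply: eq_card => p; congr (_ && _); rewrite !inE.
  have [Dp|nDp] := boolP (p \in D); last by rewrite (negPf (hnD _ nDp)).
  have D'hp : h p \in D' by rewrite hD' // n orbT.
  by rewrite D'hp /= hc.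
have cab q : connect g (a j) q = (q == a j) || (q == b j).
  apply/idP/orP => [|[]/eqP->]; [move=> Cq; apply/orP; move: Cq | exact: connect0 | exact: connect1].
  suff cl : closed g [pred x | (x == a j) || (x == b j)].
    by move/(closed_connect cl); rewrite !inE eqxx => <-.
  have Mb : M (b j) = a j by rewrite -e; case: (mM Da).
  apply: intro_closed => // x y; rewrite /g /gluing /= !inE.
  case/or3P => [/andP[_ /eqP ->]|ejj _|/g'_tail[_ D'x D'y]].
  - by case/orP=> /eqP ->; rewrite ?e ?Mb eqxx ?orbT.
  - by case/orP: ejj => /andP[_ /eqP ->]; rewrite eqxx ?orbT.
  - by move: D'x; rewrite inD' => /and3P[/negPf -> /negPf ->].
rewrite -[1%N](n_comp_connect sg (a j)) /n_comp_mem.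
rewrite -(cardID (connect g (a j))); congr (_ + _)%N.
  apply: eq_card => p; rewrite !inE; have [Cp|] := boolP (connect g (a j) p); rewrite ?andbF //.
  rewrite !andbT; case: (roots g p) => //=; apply/andP; split.
    by move: Cp; rewrite cab => /orP[]/eqP ->.
  apply/forall_inP => q Oq; apply/negP => pq.
  have := connect_trans Cp pq; rewrite cab; have := OD' _ Oq.
  by rewrite inD' => /and3P[/negPf -> /negPf ->].
apply: eq_card => p; rewrite !inE cab.
have [Dp|nDp] := boolP (p \in D); last first.
  by rewrite (negPf (hnD _ nDp)) !andbF.
rewrite andbCA; case: (roots g p) => //=.
have := hD' p Dp; rewrite e eqxx orbF => ->; rewrite inD' Dp andbT -negb_or orbC.
case: orP => //= np; apply/esym/hc; rewrite hD' // inD' Dp.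
by move/orP: np; rewrite negb_or andbT => ->.
Qed.

End Step.

(** One induction treats the combinatorial and the algebraic side together: [Z] is pinned down by
    connectivity in the glued graph, and the components that miss all remaining points are the
    loops. *)
Theorem contract D M s :
  matching D M -> noncrossing ps D M -> nested_pairs D s ->
  exists Z : P -> P, let O := unglued D s in
  [/\ matching O Z, noncrossing ps O Z,
      {in O &, forall p q, connect (gluing D M s) p q = (q == p) || (q == Z p)} &
      forall x, caps s (wt ps A D M) x
        = loop_wt ^+ n_comp (gluing D M s)
                       [pred p in D | [forall q in O, ~~ connect (gluing D M s) p q]]
          * wt ps A O Z x].
Proof.
elim: s D M => [|j s IH] D M mM nc ns /=.
  exists M; split=> // [p q Dp _|x]; first by rewrite gluing_nil.
  rewrite (_ : n_comp _ _ = 0%N) ?expr0 ?mul1r //; apply: eq_card0 => p.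
  rewrite !inE; apply/negP => /and3P[_ Dp /forall_inP/(_ p Dp)].
  by rewrite connect0.
have [Da Db ab adj ns'] := ns.
have mM' := capM_matching mM Da Db ab.
have [Z [mZ nZ cZ wZ]] := IH _ _ mM' (capM_noncrossing ps_inj mM nc Da Db ab adj) ns'.
have OD' := unglued_sub (D :\ a j :\ b j) s.
exists Z; split=> // [p q Op Oq|x].
  by rewrite (contract_connect mM ns) ?cZ // (subsetP OD').
rewrite (contract_n_comp mM ns OD') exprD -mulrA -wZ.
have capsZ r c f (y : P -> bool) : caps r (fun z => c * f z) y = c * caps r f y.
  elim: r f y => //= i r IHr f y; rewrite -IHr; congr caps.
  apply/funext => z; rewrite /cap mulr_sumr; apply: eq_bigr => u _.
  by rewrite mulr_sumr; apply: eq_bigr => v _; rewrite mulrCA.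
rewrite -capsZ; congr caps; apply/funext => z.
exact: (wt_cap ps_inj A0 mM nc Da Db ab adj).
Qed.

End Contract.

Section CapsSum.
Variables (K : fieldType) (A : K).
Variables (P J : finType) (a b : J -> P).
Hypothesis a_inj : injective a.
Hypothesis b_inj : injective b.
Hypothesis a_neq_b : forall i j, a i != b j.
Implicit Types (s : seq J) (c : {ffun J -> bool}) (x : P -> bool).

(** [cap_wt] vanishes on equal colours, so one colour per pair suffices: [b j] receives the opposite
    of the colour of [a j]. *)
Definition recolor s c x : P -> bool :=
  foldr (fun j y => upd (upd y (a j) (c j)) (b j) (~~ c j)) x s.

Lemma recolor_a s c x j : j \in s -> recolor s c x (a j) = c j.
Proof.
elim: s => //= i s IH; rewrite /upd (negPf (a_neq_b _ _)) (inj_eq a_inj) inE.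
by case: eqP => [->|_] //=.
Qed.

Lemma recolor_b s c x j : j \in s -> recolor s c x (b j) = ~~ c j.
Proof.
elim: s => //= i s IH; rewrite /upd eq_sym (eq_sym (b j)) (negPf (a_neq_b _ _)).
by rewrite (inj_eq b_inj) inE eq_sym; case: eqP => [->|_] //=.
Qed.

Lemma recolor_out s c x p : (forall j, p != a j) -> (forall j, p != b j) ->
  recolor s c x p = x p.
Proof.
by move=> na nb; elim: s => //= i s IH; rewrite /upd (negPf (na i)) (negPf (nb i)).
Qed.

Lemma eq_recolor s c c' x : {in s, c =1 c'} -> recolor s c x = recolor s c' x.
Proof.
elim: s => //= i s IH e; rewrite e ?mem_head ?IH // => j sj.
by rewrite e // inE sj orbT.
Qed.

(** Colourings are functions on all of [J]; the default [false] off [s] makes each colouring of [s]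
    count once. *)
Definition recolorable s c := [forall j, (j \notin s) ==> ~~ c j].
Definition ffun_upd c j e : {ffun J -> bool} :=
  [ffun i => if i == j then e else c i].

Lemma sum_recolorable_cons j s (F : {ffun J -> bool} -> K) : j \notin s ->
  \sum_(c | recolorable (j :: s) c) F c
    = \sum_(c | recolorable s c) \sum_e F (ffun_upd c j e).
Proof.
move=> js; rewrite exchange_big (partition_big (fun c => c j) xpredT) //=.
apply: eq_bigr => e _.
rewrite (reindex_onto (fun c => ffun_upd c j e) (fun c => ffun_upd c j false)).
  apply: eq_bigl => c; apply/idP/idP.
    case/andP=> /andP[/forallP r _] /eqP <-; apply/forallP => i.
    apply/implyP => si; rewrite ffunE; case: eqP => // /eqP ij.
    by rewrite ffunE (negPf ij); have := r i; rewrite inE negb_or ij si ffunE (negPf ij).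
  move=> /forallP r; rewrite !ffunE eqxx; apply/andP; split.
    rewrite eqxx andbT; apply/forallP => i; apply/implyP.
    rewrite inE negb_or ffunE => /andP[/negPf -> si]; exact: (implyP (r i)).
  apply/eqP/ffunP => i; rewrite !ffunE; case: eqP => // ->.
  by have := r j; rewrite js => /negPf ->.
move=> c /andP[_ /eqP <-]; apply/ffunP => i; rewrite !ffunE.
by case: eqP => // ->.
Qed.

Lemma caps_sum s f x : uniq s ->
  caps A a b s f x = \sum_(c | recolorable s c)
    (\prod_(j <- s) cap_wt A (c j) (~~ c j)) * f (recolor s c x).
Proof.
elim: s f x => [|j s IH] f x /=.
  move=> _; rewrite (big_pred1 [ffun=> false]) ?big_nil ?mul1r // => c.
  apply/forallP/eqP => [h|-> j]; last by rewrite ffunE.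
  by apply/ffunP => j; rewrite ffunE; have := h j; rewrite in_nil /= => /negPf.
case/andP=> js us; rewrite IH // sum_recolorable_cons //.
apply: eq_bigr => c _; rewrite /cap !big_bool /=.
have upd_s (g : bool -> K) e : \prod_(i <- s) g (ffun_upd c j e i) = \prod_(i <- s) g (c i).
  apply: eq_big_seq => i si; rewrite ffunE; case: eqP => // e'.
  by move: js; rewrite -e' si.
have rec_s e : recolor s (ffun_upd c j e) x = recolor s c x.
  apply: eq_recolor => i si; rewrite ffunE; case: eqP => // e'.
  by move: js; rewrite -e' si.
rewrite !big_cons !rec_s !(upd_s (fun u => cap_wt A u (~~ u))) !ffunE eqxx /=.
by rewrite /cap_wt /cup_wt; ring.
Qed.

Lemma caps_sum_all s f x : uniq s -> (forall j, j \in s) ->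
  caps A a b s f x = \sum_(c : {ffun J -> bool})
    (\prod_j cap_wt A (c j) (~~ c j)) * f (recolor s c x).
Proof.
move=> us sT; rewrite caps_sum //; apply: eq_big => [c|c _].
  by apply/forallP => j; rewrite sT.
by congr (_ * _); rewrite big_uniq //=; apply: eq_bigl => j; rewrite sT.
Qed.

End CapsSum.

(** * State sums of diagrams *)

Lemma unglued_in (P : finType) (J : eqType) (a b : J -> P) (D : {set P}) s p :
  p \in unglued a b D s
    = (p \in D) && all (fun j => (p != a j) && (p != b j)) s.
Proof.
elim: s D => [|j s IH] D /=; first by rewrite andbT.
by rewrite IH !inE; case: (p == a j); case: (p == b j); rewrite ?andbF //= andbF.
Qed.

Lemma wt_inj (K : fieldType) (A : K) (P1 P2 : finType) (ps1 : P1 -> nat)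
    (ps2 : P2 -> nat) (h : P1 -> P2) (D1 : {set P1}) M1 M2 x :
  injective h ->
  (forall p q, (ps2 (h p) < ps2 (h q))%N = (ps1 p < ps1 q)%N) ->
  {in D1, forall p, M2 (h p) = h (M1 p)} ->
  wt ps2 A (h @: D1) M2 x = wt ps1 A D1 M1 (x \o h).
Proof.
move=> h_inj hlt hM; rewrite /wt big_imset_cond /=; last by move=> ? ? _ _; exact: h_inj.
apply: eq_big => [p|p /andP[Dp _]]; last by rewrite /= hM.
by case Dp: (p \in D1); rewrite //= /opener hM.
Qed.

Section Diagrams.
Variables (m n : nat).

Lemma pos_lt p : (@pos m n p < m + n)%N.
Proof. by case: p => [j|j] /=; have := ltn_ord j; lia. Qed.

Lemma pos_inj : injective (@pos m n).
Proof.
case=> [i|i] [j|j] /= e; have := ltn_ord i; have := ltn_ord j => hj hi;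
  by [congr inl; apply: val_inj|exfalso; lia|congr inr; apply: val_inj; rewrite /=; lia].
Qed.

Lemma diag_matching (d : diag m n) : matching [set: 'I_m + 'I_n] d.
Proof.
case: d => d dP p _ /=; case/and3P: dP => /forallP/(_ p)/eqP -> /forallP/(_ p) -> _.
by rewrite inE.
Qed.

Lemma diag_noncrossing (d : diag m n) : noncrossing (@pos m n) [set: 'I_m + 'I_n] d.
Proof.
case: d => d dP p q _ _ /=; case/and3P: dP => _ _ /forallP/(_ p)/forallP/(_ q).
by [].
Qed.

Lemma diagK (d : diag m n) p : d (d p) = p.
Proof. by have [] := diag_matching d (in_setT p). Qed.

Lemma diag_neq (d : diag m n) p : d p != p.
Proof. by have [] := diag_matching d (in_setT p). Qed.

Lemma diag_inj (d : diag m n) : injective d.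
Proof. exact: can_inj (diagK d). Qed.

Lemma diag_exists (M : 'I_m + 'I_n -> 'I_m + 'I_n) :
  (forall p, M (M p) = p) -> (forall p, M p != p) ->
  (forall p q, ~~ [&& pos p < pos q, pos q < pos (M p) & pos (M p) < pos (M q)]%N) ->
  exists d : diag m n, d =1 M.
Proof.
move=> MM nM nc; have dP : is_diag [ffun p => M p].
  apply/and3P; split.
  - by apply/forallP => p; rewrite !ffunE MM.
  - by apply/forallP => p; rewrite ffunE nM.
  - by apply/forallP => p; apply/forallP => q; rewrite !ffunE nc.
by exists (Diag dP) => p; rewrite /= ffunE.
Qed.

Lemma eq_diag (d d' : diag m n) : d =1 d' -> d = d'.
Proof. by move=> e; apply: val_inj; apply/ffunP. Qed.

End Diagrams.

Section Amplitude.
Variables (K : fieldType) (A : K).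

(** The ends of an arc carry opposite colours. Negating the bottom colours lets a through strand
    have the same colour at both ends, so the identity diagram becomes the identity matrix. *)
Definition boundary m n (c : {ffun 'I_m -> bool}) (e : {ffun 'I_n -> bool})
    (p : 'I_m + 'I_n) : bool :=
  match p with inl j => ~~ c j | inr j => e j end.

Definition arcs_wt m n (d : diag m n) x : K := wt (@pos m n) A setT d x.

(** The weight of caps bending the bottom points into inputs. With this factor stacking becomes the
    matrix product: the bends of the middle points are the caps that glue the two diagrams. *)
Definition bend m (c : {ffun 'I_m -> bool}) : K :=
  \prod_j cap_wt A (c j) (~~ c j).

Definition amplitude m n (d : diag m n) c e : K :=
  bend c * arcs_wt d (boundary c e).

End Amplitude.

(** * Stacking as matrix multiplication *)

Section Stack.
Variables (l m n : nat) (x : diag m n) (y : diag l m).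

Let P : Type := (('I_l + 'I_m) + ('I_m + 'I_n))%type.
Let M (p : P) : P := match p with inl q => inl (y q) | inr q => inr (x q) end.
Let ps (p : P) : nat :=
  match p with inl q => pos q | inr q => (l + m + pos q)%N end.
Let a (j : 'I_m) : P := inl (inr j).
Let b (j : 'I_m) : P := inr (inl j).
Let s : seq 'I_m := enum 'I_m.
Let out (p : 'I_l + 'I_n) : P :=
  match p with inl j => inl (inl j) | inr j => inr (inr j) end.
Let O := unglued a b setT s.

Let ps_inj : injective ps.
Proof.
case=> [p|p] [q|q] /= e.
- by congr inl; apply: pos_inj.
- by exfalso; have := pos_lt p; lia.
- by exfalso; have := pos_lt q; lia.
- by congr inr; apply: pos_inj; lia.
Qed.

Let mM : matching setT M.
Proof.
case=> p _; rewrite !inE /= diagK; split=> //; apply/eqP => -[] /eqP; apply/negP;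
  exact: diag_neq.
Qed.

Let ncM : noncrossing ps setT M.
Proof.
case=> [p|p] [q|q] _ _ /=; rewrite ?ltn_add2l.
- exact: (diag_noncrossing y (in_setT p) (in_setT q)).
- by apply/and3P => -[_ + _]; have := pos_lt (y p); lia.
- by apply/and3P => -[+ _ _]; have := pos_lt q; lia.
- exact: (diag_noncrossing x (in_setT p) (in_setT q)).
Qed.

Let a_inj : injective a. Proof. by move=> i j []. Qed.
Let b_inj : injective b. Proof. by move=> i j []. Qed.

(** Boundary positions read the top of [y] from right to left and then the bottom of [x] from left
    to right. So the two copies of point 0 are adjacent, and the pairs nest outwards as [j]
    grows. *)
Let nested_s : nested_pairs ps a b setT s.
Proof.
have : sorted ltn [seq val j | j <- s].
  by rewrite val_enum_ord iota_ltn_sorted.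
have : forall i, (a i \in [set: P]) = (i \in s) by move=> i; rewrite inE mem_enum.
have : forall i, (b i \in [set: P]) = (i \in s) by move=> i; rewrite inE mem_enum.
elim: s [set: P] => //= j r IH D bD aD jr.
have jmin i : i \in r -> (j < i)%N.
  move=> ir; have := order_path_min ltn_trans jr.
  by move=> /allP/(_ (val i)); apply; apply/mapP; exists i.
have jnr : j \notin r by apply/negP => /jmin; rewrite ltnn.
split; rewrite ?aD ?bD ?mem_head //=.
- by have := ltn_ord j; lia.
- case=> -[i|i] Di /=; apply/negP; have := ltn_ord i; have := ltn_ord j => hj hi.
  + lia.
  + have := aD i; rewrite Di inE => /esym/orP[/eqP ->|/jmin]; lia.
  + have := bD i; rewrite Di inE => /esym/orP[/eqP ->|/jmin]; lia.
  + lia.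
apply: IH => [i|i|]; last exact: path_sorted jr.
  rewrite !in_setD1 bD inE (inj_eq b_inj).
  by have [->|] //= := eqVneq i j; rewrite (negPf jnr).
rewrite !in_setD1 aD inE (inj_eq a_inj).
by have [->|] //= := eqVneq i j; rewrite (negPf jnr).
Qed.

Let in_O p : reflect (exists q, p = out q) (p \in O).
Proof.
rewrite /O unglued_in inE /=; apply: (iffP allP) => [h|[q -> j _]]; last first.
  by case: q.
case: p h => -[i|i] h.
- by exists (inl i).
- by have := h i (mem_enum _ _); rewrite eqxx.
- by have := h i (mem_enum _ _); rewrite eqxx andbF.
- by exists (inr i).
Qed.

Let out_inj : injective out.
Proof. by case=> [i|i] [j|j] //= []->. Qed.

Let out_lt p q : (ps (out p) < ps (out q))%N = (pos p < pos q)%N.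
Proof.
by case: p q => [i|i] [j|j] /=; have := ltn_ord i; have := ltn_ord j; lia.
Qed.

Let unout (p : P) (q : 'I_l + 'I_n) : 'I_l + 'I_n :=
  match p with inl (inl i) => inl i | inr (inr i) => inr i | _ => q end.

Let outK p q : unout (out p) q = p.
Proof. by case: p. Qed.

(* [P] has two copies of each middle point, which [glue] identifies. *)
Let h (p : P) : 'I_l + 'I_m + 'I_n :=
  match p with inl q => inl q | inr q => @upper l m n q end.
Let h' (u : 'I_l + 'I_m + 'I_n) : P :=
  match u with inl q => inl q | inr j => inr (inr j) end.
Let g := gluing a b setT M s.

Let glue_sym : connect_sym (glue x y).
Proof.
suff sub u v : glue x y u v -> glue x y v u.
  by apply: sym_connect_sym => u v; apply/idP/idP; exact: sub.
case/orP => /existsP[p /andP[/eqP -> /eqP ->]]; apply/orP; [left|right];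
  apply/existsP; [exists (y p)|exists (x p)]; by rewrite diagK !eqxx.
Qed.

Let g_sym : connect_sym g. Proof. exact: gluing_sym. Qed.

Let g_ab j : connect g (a j) (b j).
Proof.
apply: connect1; rewrite /g /gluing; apply/orP; right; apply/hasP; exists j.
  exact: mem_enum.
by rewrite !eqxx.
Qed.

Let h'h p : connect g (h' (h p)) p.
Proof. by case: p => [q|[j|j]]; [exact: connect0 | exact: g_ab | exact: connect0]. Qed.

Let gM p : connect g p (M p).
Proof. by apply: connect1; rewrite /g /gluing inE eqxx. Qed.

Let glue_adjunction : rel_adjunction h (glue x y) g predT.
Proof.
apply: (@intro_adjunction _ _ h (glue x y) g g_sym predT _ (fun u _ => h' u)) => //.
  move=> u _; split=> [|v _]; first by case: u => [q|j]; exact: connect0.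
  case/orP=> /existsP[p /andP[/eqP -> /eqP ->]] /=; first exact: (gM (inl p)).
  apply: connect_trans (h'h (inr p)) _; apply: connect_trans (gM (inr p)) _.
  by rewrite g_sym; exact: (h'h (inr (x p))).
move=> p _; split=> [|q]; first by rewrite g_sym.
rewrite /g /gluing inE /= => /orP[/eqP ->|/hasP[j _]].
  case: p => p /=; apply: connect1; apply/orP; [left|right]; apply/existsP;
    exists p; by rewrite !eqxx.
by case/orP => /andP[/eqP -> /eqP ->]; exact: connect0.
Qed.

Let glue_connect p q : connect (glue x y) (@outer l m n p) (@outer l m n q)
  = connect g (out p) (out q).
Proof.
have [_ f] := glue_adjunction; rewrite (f (out p) (out q)) //.
by case: p => i; case: q.
Qed.

Let stack_loopsE : stack_loops x y
  = n_comp g [pred p in setT | [forall q in O, ~~ connect g p q]].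
Proof.
have [hu hf] := glue_adjunction.
have cl : closed (glue x y)
    [pred u | [forall p, ~~ connect (glue x y) u (@outer l m n p)]].
  move=> u v uv; rewrite !inE; apply: eq_forallb => p.
  by rewrite (same_connect glue_sym (connect1 uv)).
rewrite /stack_loops (adjunction_n_comp h glue_sym g_sym cl); last first.
  by split=> [u _|p q _]; [exact: hu | exact: hf].
apply: eq_card => p; rewrite !inE; congr (_ && _).
apply/forallP/forall_inP => [H q /in_O[r ->]|H r].
  have := H r; rewrite (_ : @outer l m n r = h (out r)); last by case: r.
  by rewrite -hf.
rewrite (_ : @outer l m n r = h (out r)); last by case: r.
by rewrite -hf //; apply: H; apply/in_O; exists r.
Qed.

Theorem stack_exists : exists z : diag l n,
  (forall p q, connect (glue x y) (@outer l m n p) (@outer l m n q) = (q == p) || (q == z p)) /\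
  (forall (K : fieldType) (A : K) c e, A != 0 ->
     \sum_d amplitude A y c d * amplitude A x d e
       = (- A ^+ 2 - A ^- 2) ^+ stack_loops x y * amplitude A z c e).
Proof.
(* The stacked diagram must not depend on the field, so it is built from the contraction over the
   rationals with parameter 1. The contraction over [K] yields the same matching, because
   connectivity determines it. *)
have [Z [mZ nZ cZ _]] := contract (oner_neq0 rat) ps_inj mM ncM nested_s.
have outO p : out p \in O by apply/in_O; exists p.
pose Z' p := unout (Z (out p)) p.
have outZ p : out (Z' p) = Z (out p).
  rewrite /Z'; have [/in_O[q ->] _ _] := mZ _ (outO p); by rewrite outK.
have [z zE] : exists z : diag l n, z =1 Z'.
  apply: diag_exists => [p|p|p q].
  - by apply: out_inj; rewrite !outZ; have [] := mZ _ (outO p).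
  - by rewrite -(inj_eq out_inj) outZ; have [] := mZ _ (outO p).
  - by rewrite -!out_lt !outZ; exact: nZ.
have cz p q : connect (glue x y) (@outer l m n p) (@outer l m n q) = (q == p) || (q == z p).
  rewrite glue_connect cZ // -outZ !(inj_eq out_inj); by rewrite zE.
exists z; split=> // K A c e A0.
have [Z2 [mZ2 nZ2 cZ2 wZ2]] := contract A0 ps_inj mM ncM nested_s.
have outZ2 p : Z2 (out p) = out (z p).
  have [O2 _ n2] := mZ2 _ (outO p); have := cZ2 _ _ (outO p) O2.
  rewrite eqxx orbT cZ // => /orP[/eqP e2|/eqP ->]; last by rewrite zE outZ.
  by rewrite e2 eqxx in n2.
pose x0 (p : P) := match p with inl (inl i) => ~~ c i | inr (inr j) => e j | _ => false end.
have := wZ2 x0; rewrite caps_sum_all ?enum_uniq //; last first.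
  by move=> j; rewrite mem_enum.
rewrite -/O -/g -stack_loopsE => E.
have -> : amplitude A z c e = bend A c * wt ps A O Z2 x0.
  rewrite /amplitude /arcs_wt; congr (_ * _).
  rewrite (_ : O = out @: setT); last first.
    apply/setP => p; apply/idP/imsetP => [/in_O[q ->]|[q _ ->]]; by [exists q|].
  rewrite (wt_inj _ _ out_inj out_lt (M1 := z)) //.
  by apply: eq_wt => [|p _]; [exact: diag_matching | case: p].
rewrite mulrCA -E mulr_sumr; apply: eq_bigr => d _.
rewrite /amplitude mulrACA -!mulrA; congr (_ * _).
congr (_ * _).
have rE p : recolor a b s d x0 p = match p with
    | inl q => boundary c d q | inr q => boundary d e q end.
  case: p => -[i|i] /=.
  - by rewrite recolor_out.
  - by rewrite (recolor_a a_inj) // mem_enum.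
  - by rewrite (recolor_b b_inj) // mem_enum.
  - by rewrite recolor_out.
rewrite /arcs_wt /wt [RHS]big_sumType /=; congr (_ * _).
  apply: eq_big => [p|p _]; last by rewrite !rE.
  by rewrite !inE.
apply: eq_big => [p|p _]; last by rewrite !rE.
by rewrite !inE /opener /= ltn_add2l.
Qed.

End Stack.

(** * Linear independence of the state sums *)

Section Openers.
Variables (m n : nat).
Implicit Types d : diag m n.

Lemma diag_nested d : nested (@pos m n) setT d.
Proof.
apply/noncrossing_nested; [exact: pos_inj|exact: diag_matching|].
exact: diag_noncrossing.
Qed.

Lemma opener_diag d p : opener (@pos m n) d (d p) = ~~ opener (@pos m n) d p.
Proof. by rewrite (openerM (@pos_inj m n) (diag_matching d)) ?in_setT. Qed.

Lemma same_openers_step d d' p :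
  opener (@pos m n) d =1 opener (@pos m n) d' -> (pos p < pos (d p))%N ->
  (forall q, opener (@pos m n) d q -> (pos p < pos q)%N -> d q = d' q) ->
  ~~ (pos (d p) < pos (d' p))%N.
Proof.
move=> eo op IH; apply/negP => lt.
have := @diag_nested d' p (d p) (in_setT _) (in_setT _).
rewrite op lt => /(_ isT) /andP[lt1 _].
have : opener (@pos m n) d (d' (d p)).
  by rewrite eo opener_diag -eo opener_diag negbK.
move=> o; have := IH _ o lt1; rewrite diagK => e.
by have := ltnn (pos p); rewrite -{2}(diagK d p) -e diagK lt1.
Qed.

(** A planar matching is determined by its bracket word. The two partners are compared at the last
    opener where the diagrams differ. *)
Lemma opener_inj d d' :
  opener (@pos m n) d =1 opener (@pos m n) d' -> d = d'.
Proof.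
move=> eo; apply: eq_diag => p0; apply/eqP/negPn/negP => ne.
pose Q p := opener (@pos m n) d p && (d p != d' p).
have [p1 Qp1] : exists p, Q p.
  have [o|o] := boolP (opener (@pos m n) d p0); first by exists p0; rewrite /Q o.
  exists (d p0); rewrite /Q opener_diag o diagK /=.
  by apply: contraNneq ne => e; rewrite -(diagK d' (d p0)) -e.
have := erefl [arg max_(p > p1 | Q p) @pos m n p].
case: {1}arg_maxnP => // p /andP[op np] pmax _.
have IH q : opener (@pos m n) d q -> (pos p < pos q)%N -> d q = d' q.
  move=> oq; apply: contraTeq => nq; rewrite -leqNgt.
  by apply: pmax; rewrite /Q oq.
have op' : opener (@pos m n) d' p by rewrite -eo.
have h1 := same_openers_step eo op IH.
have h2 : ~~ (pos (d' p) < pos (d p))%N.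
  apply: same_openers_step op' _ => [q|q]; first by rewrite eo.
  by rewrite -eo => oq /(IH q oq).
case/eqP: np; apply: (@pos_inj m n); lia.
Qed.

Definition color_moment (x : 'I_m + 'I_n -> bool) : nat :=
  (\sum_(p in setT) x p * pos p)%N.

(** On each arc exactly one end is coloured [true]. The contribution is least when this is the
    opener, the end that comes first. *)
Lemma color_moment_min (K : fieldType) (A : K) d x : A != 0 ->
  arcs_wt A d x != 0 ->
  (color_moment (opener (@pos m n) d) <= color_moment x
     ?= iff [forall p, x p == opener (@pos m n) d p])%N.
Proof.
move=> A0 w; have neg := wt_neq0 A0 w.
rewrite /color_moment !(big_arcs (@pos_inj m n) _ _ (diag_matching d)) /=.
rewrite (_ : [forall p, _] = [forall (p | (p \in setT) && opener (@pos m n) d p), x p]).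
  apply: leqif_sum => p /andP[pT o]; rewrite opener_diag neg // o.
  rewrite mul1n mul0n addn0; case: (x p); rewrite !(mul1n, mul0n, addn0, add0n).
    exact/leqif_refl.
  by apply/leqifP; rewrite /= -/(opener _ _ _).
apply/forallP/forallP => h p; last first.
  have [o|o] := boolP (opener (@pos m n) d p).
    by have := h p; rewrite in_setT o /= => ->.
  have := h (d p); rewrite in_setT opener_diag o /= => xd.
  by have := neg (d p) (in_setT _); rewrite opener_diag o diagK xd => ->.
by apply/implyP => /andP[_ o]; rewrite (eqP (h p)).
Qed.

(** Triangularity: take [d] in the support of [X] with least opener moment and evaluate at its
    opener colouring. Any other diagram of the support with nonzero weight there has the same
    moment, hence the same openers, hence equals [d]. *)
Lemma arcs_wt_free (K : fieldType) (A : K) (X : diag m n -> K) : A != 0 ->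
  (forall x, \sum_d X d * arcs_wt A d x = 0) -> forall d, X d = 0.
Proof.
move=> A0 h d0; apply/eqP/negPn/negP => n0.
case: (@arg_minnP _ d0 (fun d => X d != 0)
  (fun d => color_moment (opener (@pos m n) d)) n0) => d nd dmin.
have := h (opener (@pos m n) d); rewrite (bigD1 d) //= big1 => [|d' nd'].
  rewrite addr0 => /eqP; rewrite mulf_eq0 (negPf nd) /=; apply/negP.
  apply/prodf_neq0 => p /andP[_ o].
  by rewrite cup_wt_neq0 // opener_diag o.
apply/eqP; rewrite mulf_eq0; apply/norP => -[nX nw].
have := color_moment_min A0 nw => -[le]; rewrite eqn_leq le dmin //=.
move=> /esym/forallP H; case/eqP: nd'; apply: opener_inj => p.
by rewrite (eqP (H p)).
Qed.

End Openers.

(** * Juxtaposition and reflection of diagrams *)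

Section Juxtapose.
Variables (m m' n n' : nat) (x : diag m n) (y : diag m' n').
Let L := @left_pt m m' n n'.
Let Rt := @right_pt m m' n n'.

Lemma left_pt_inj : injective L.
Proof.
by case=> [i|i] [j|j] //= [] e; [congr inl|congr inr]; exact: val_inj.
Qed.

Lemma right_pt_inj : injective Rt.
Proof.
by case=> [i|i] [j|j] //= [] /addnI e; [congr inl|congr inr]; exact: val_inj.
Qed.

Lemma left_pt_lt p q : (pos (L p) < pos (L q))%N = (pos p < pos q)%N.
Proof.
by case: p q => [i|i] [j|j] /=; have := ltn_ord i; have := ltn_ord j; lia.
Qed.

Lemma pos_right_pt p : pos (Rt p) = (m + pos p)%N.
Proof. by case: p => i /=; have := ltn_ord i; lia. Qed.

Lemma pos_left_pt p :
  pos (L p) = if (pos p < m)%N then pos p else (pos p + (m' + n'))%N.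
Proof.
case: p => i /=; have := ltn_ord i; first by move=> ->.
by move=> hi; rewrite ltnNge leq_addr /=; lia.
Qed.

Lemma left_right_cover p : (exists q, p = L q) \/ (exists q, p = Rt q).
Proof.
case: p => i; case: (split_ordP i) => j ->.
- by left; exists (inl j).
- by right; exists (inl j).
- by left; exists (inr j).
- by right; exists (inr j).
Qed.

Lemma left_neq_right p q : L p != Rt q.
Proof.
by apply/eqP => e; have := pos_left_pt p; rewrite e pos_right_pt;
  case: ltnP => ? ?; have := pos_lt q; lia.
Qed.

Lemma juxtapose_exists : exists z : diag (m + m') (n + n'),
  (forall p, z (L p) = L (x p)) /\ (forall p, z (Rt p) = Rt (y p)).
Proof.
pose f (p : 'I_(m + m') + 'I_(n + n')) := match p with
  | inl i => match split i with inl j => L (x (inl j)) | inr j => Rt (y (inl j)) end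
  | inr i => match split i with inl j => L (x (inr j)) | inr j => Rt (y (inr j)) end
  end.
have fL p : f (L p) = L (x p).
  by case: p => j; rewrite /f /= -/(unsplit (inl j)) unsplitK.
have fR p : f (Rt p) = Rt (y p).
  by case: p => j; rewrite /f /= -/(unsplit (inr j)) unsplitK.
have [z zE] : exists z : diag (m + m') (n + n'), z =1 f.
  apply: diag_exists => [p|p|p q].
  - by have [[q ->]|[q ->]] := left_right_cover p; rewrite ?fL ?fR ?fL ?fR diagK.
  - have [[q ->]|[q ->]] := left_right_cover p; rewrite ?fL ?fR.
      by rewrite (inj_eq left_pt_inj) diag_neq.
    by rewrite (inj_eq right_pt_inj) diag_neq.
  have [[{}p ->]|[{}p ->]] := left_right_cover p;
    have [[{}q ->]|[{}q ->]] := left_right_cover q; rewrite ?fL ?fR.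
  - by rewrite !left_pt_lt; exact: (diag_noncrossing x (in_setT p) (in_setT q)).
  - rewrite !pos_left_pt !pos_right_pt; case: (ltnP (pos p)) => ?; case: (ltnP (pos (x p))) => ?;
      have := pos_lt q; have := pos_lt (y q); lia.
  - rewrite !pos_left_pt !pos_right_pt; case: (ltnP (pos q)) => ?; case: (ltnP (pos (x q))) => ?;
      have := pos_lt p; have := pos_lt (y p); lia.
  - rewrite !pos_right_pt !ltn_add2l.
    exact: (diag_noncrossing y (in_setT p) (in_setT q)).
by exists z; split=> p; rewrite zE.
Qed.

Definition lcolor (c : {ffun 'I_(m + m') -> bool}) : {ffun 'I_m -> bool} :=
  [ffun i => c (lshift m' i)].
Definition rcolor (c : {ffun 'I_(m + m') -> bool}) : {ffun 'I_m' -> bool} :=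
  [ffun i => c (rshift m i)].

End Juxtapose.

Lemma wtU (K : fieldType) (A : K) (P : finType) (ps : P -> nat)
    (D1 D2 : {set P}) M x :
  [disjoint D1 & D2] ->
  wt ps A (D1 :|: D2) M x = wt ps A D1 M x * wt ps A D2 M x.
Proof.
move=> d12; rewrite /wt big_mkcondr (eq_bigl [predU D1 & D2]) => [|p].
  by rewrite bigU //= -!big_mkcondr.
by rewrite !inE.
Qed.

Lemma star_exists m n (d : diag m n) :
  exists z : diag n m, forall p, z (swap p) = swap (d p).
Proof.
have sK a b : cancel (@swap 'I_a 'I_b) (@swap 'I_b 'I_a) by case.
have ps (p : 'I_n + 'I_m) : pos p = (m + n - (pos (swap p)).+1)%N.
  by case: p => i /=; have := ltn_ord i; lia.
have [z zE] : exists z : diag n m, z =1 (fun p => swap (d (swap p))).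
  apply: diag_exists => [p|p|p q].
  - by rewrite sK diagK sK.
  - by rewrite -(inj_eq (can_inj (sK n m))) sK diag_neq.
  rewrite !ps !sK.
  have := diag_noncrossing d (in_setT (d (swap q))) (in_setT (d (swap p))).
  rewrite !diagK; have h1 := pos_lt (swap p); have h2 := pos_lt (swap q).
  have h3 := pos_lt (d (swap p)); have h4 := pos_lt (d (swap q)).
  move: (pos (swap p)) (pos (swap q)) (pos (d (swap p))) (pos (d (swap q))) h1 h2 h3 h4.
  by clear; lia.
by exists z => p; rewrite zE sK.
Qed.

Section AmplitudeOps.
Variables (K : fieldType) (A : K).
Hypothesis A0 : A != 0.

Lemma bend_split m m' (c : {ffun 'I_(m + m') -> bool}) :
  bend A c = bend A (lcolor c) * bend A (rcolor c).
Proof.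
by rewrite /bend big_split_ord; congr (_ * _); apply: eq_bigr => i _; rewrite !ffunE.
Qed.

Lemma amplitude_juxtapose m m' n n' (x : diag m n) (y : diag m' n')
    (z : diag (m + m') (n + n')) c e :
  (forall p, z (left_pt m' n' p) = left_pt m' n' (x p)) ->
  (forall p, z (right_pt m n p) = right_pt m n (y p)) ->
  amplitude A z c e = amplitude A x (lcolor c) (lcolor e)
                      * amplitude A y (rcolor c) (rcolor e).
Proof.
move=> zL zR; rewrite /amplitude bend_split mulrACA; congr (_ * _).
rewrite /arcs_wt (_ : [set: _] = @left_pt m m' n n' @: setT :|: @right_pt m m' n n' @: setT).
  rewrite wtU; last first.
    apply/pred0P => p /=; apply/negP => /andP[/imsetP[q _ ->] /imsetP[r _]].
    exact/eqP/left_neq_right.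
  rewrite (wt_inj _ _ (@left_pt_inj m m' n n') (@left_pt_lt m m' n n') (M1 := x)) //.
  rewrite (wt_inj _ _ (@right_pt_inj m m' n n') _ (M1 := y) (ps1 := @pos m' n')) //.
    congr (_ * _); apply: eq_wt; try exact: diag_matching;
      by case=> i _; rewrite /= ffunE.
  by move=> p q; rewrite !pos_right_pt ltn_add2l.
apply/setP => p; rewrite !inE; apply/esym/orP.
have [[q ->]|[q ->]] := left_right_cover p; [left|right]; exact: imset_f.
Qed.

Definition color_char (g : bool -> K) m (c : {ffun 'I_m -> bool}) : K :=
  \prod_j g (c j).

Definition parity_wt (b : bool) : K := if b then -1 else 1.

Lemma color_char_neq0 g m (c : {ffun 'I_m -> bool}) :
  (forall b, g b != 0) -> color_char g c != 0.
Proof. by move=> g0; apply/prodf_neq0 => j _; exact: g0. Qed.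

(** Arcs contribute [g true * g false] each, and so do the negated bottom colours. If this product
    is 1 the numbers of points are immaterial; for endomorphisms both counts equal [n], so any
    nonvanishing [g] will do in [amplitude_charge_endo]. *)
Lemma amplitude_charge g m n (d : diag m n) c e :
  g true * g false = 1 -> amplitude A d c e != 0 ->
  color_char g c = color_char g e.
Proof.
move=> g1; rewrite mulf_eq0 => /norP[_ w].
have := wt_charge (@pos_inj m n) A0 g (diag_matching d) w.
rewrite g1 expr1n (eq_bigl xpredT) => [|p]; last by rewrite in_setT.
rewrite big_sumType /= => E.
have cN : color_char g c * (\prod_j g (~~ c j)) = 1.
  by rewrite -big_split big1 // => j _; case: (c j); rewrite //= mulrC.
by rewrite -[LHS]mulr1 -E mulrA cN mul1r.
Qed.

Lemma amplitude_charge_endo g n (d : diag n n) c e :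
  (forall b, g b != 0) -> amplitude A d c e != 0 -> color_char g c = color_char g e.
Proof.
move=> g0; rewrite mulf_eq0 => /norP[_ w].
have := wt_charge (@pos_inj n n) A0 g (diag_matching d) w.
rewrite (eq_bigl xpredT) => [|p]; last by rewrite in_setT.
rewrite big_sumType /= cardsT card_sum card_ord addnn doubleK => E.
have cN : color_char g c * (\prod_j g (~~ c j)) = (g true * g false) ^+ n.
  rewrite -big_split -[in RHS](card_ord n) -prodr_const.
  by apply: eq_bigr => j _; case: (c j); rewrite //= mulrC.
apply: (@mulIf _ (\prod_j g (~~ c j))); first by apply/prodf_neq0.
by rewrite cN -E mulrC.
Qed.

(** Reflection exchanges the first and last end of every arc and also negates the boundary colours;
    the two effects cancel in [cup_wt]. *)
Lemma arcs_wt_star m n (d : diag m n) (z : diag n m) c e :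
  (forall p, z (swap p) = swap (d p)) ->
  arcs_wt A z (boundary e c) = arcs_wt A d (boundary c e).
Proof.
move=> zE; pose sw := @swap 'I_m 'I_n.
have sw_inj : injective sw by apply: can_inj (@swap _ _) _; case.
have ps (p : 'I_m + 'I_n) : pos (sw p) = (m + n - (pos p).+1)%N.
  by case: p => i /=; have := ltn_ord i; lia.
have swT : [set: 'I_n + 'I_m] = sw @: setT.
  by apply/setP => p; rewrite inE; apply/esym/imsetP; exists (swap p); case: p.
rewrite /arcs_wt /wt swT big_imset_cond /=; last by move=> ? ? _ _; exact: sw_inj.
rewrite (eq_bigl (fun p => (p \in setT) && ~~ opener (@pos m n) d p)) => [|p].
  rewrite (big_matching _ _ _ (diag_matching d)).
  apply: eq_big => p; first by rewrite opener_diag negbK.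
  case/andP=> _; rewrite opener_diag negbK => o.
  rewrite zE diagK -cup_wt_negb.
  have bE q : ~~ boundary e c (sw q) = boundary c e q.
    by case: q => j //=; rewrite negbK.
  by rewrite !bE.
rewrite in_setT /= /opener zE !ps; have := pos_lt p; have := pos_lt (d p).
have : pos (d p) != pos p by rewrite (inj_eq (@pos_inj _ _)) diag_neq.
lia.
Qed.

Lemma bend_char m (c : {ffun 'I_m -> bool}) :
  bend A c = color_char parity_wt c * color_char (fun b => if b then A else A^-1) c.
Proof.
rewrite -big_split; apply: eq_bigr => j _; rewrite /cap_wt /cup_wt /parity_wt.
by case: (c j); rewrite /= ?mulN1r ?mul1r ?opprK.
Qed.

Lemma parity_char_sqr m (c : {ffun 'I_m -> bool}) :
  color_char parity_wt c * color_char parity_wt c = 1.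
Proof.
rewrite -big_split big1 // => j _; rewrite /parity_wt.
by case: (c j); rewrite /= ?mulrNN mulr1.
Qed.

(** Reflection replaces the bend weight of [c] by that of [e]. Their parts in powers of [A] agree by
    charge conservation, so only signs remain. *)
Lemma amplitude_star m n (d : diag m n) (z : diag n m) c e :
  (forall p, z (swap p) = swap (d p)) ->
  amplitude A z e c
    = color_char parity_wt c * color_char parity_wt e * amplitude A d c e.
Proof.
move=> zE; have E := arcs_wt_star c e zE.
have [w0|w] := eqVneq (amplitude A d c e) 0.
  rewrite w0 mulr0; move/eqP: w0; rewrite /amplitude E !mulf_eq0 => /orP[b0|/eqP ->].
    exfalso; move: b0; apply/negP/prodf_neq0 => j _.
    by rewrite oppr_eq0 cup_wt_neq0.
  by rewrite mulr0.
have := @amplitude_charge (fun b => if b then A else A^-1) _ _ d c e.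
rewrite mulfV // => /(_ erefl w) ce.
rewrite /amplitude E !bend_char ce mulrA; congr (_ * _).
rewrite mulrA -[LHS]mul1r -(parity_char_sqr c); ring.
Qed.

End AmplitudeOps.

(** * Rotation and closure of diagrams *)

Section TurnWeight.
Variables (K : fieldType) (A : K).
Hypothesis A0 : A != 0.

(* The weight picked up by a boundary point moved once around the disc. *)
Definition turn_wt (b : bool) : K := if b then - (A ^+ 2)^-1 else - A ^+ 2.

Lemma turn_wt_inv : turn_wt true * turn_wt false = 1.
Proof. by rewrite /turn_wt; field. Qed.

Lemma turn_wt_neq0 b : turn_wt b != 0.
Proof.
by case: b; rewrite /turn_wt oppr_eq0 ?invr_eq0 expf_eq0 /= (negPf A0).
Qed.

Lemma cup_wt_turn a e : cup_wt A e a = cup_wt A a e * turn_wt a.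
Proof.
by case: a e => [] []; rewrite /cup_wt /turn_wt ?mul0r //=; field.
Qed.

Lemma cup_wt_turn2 a e : cup_wt A a e * (turn_wt a * turn_wt e) = cup_wt A a e.
Proof.
by case: a e => [] []; rewrite /cup_wt ?mul0r // ?[turn_wt false * _]mulrC turn_wt_inv mulr1.
Qed.

Lemma cap_wt_turn a : cap_wt A a (~~ a) * turn_wt a = cap_wt A (~~ a) a.
Proof. by case: a; rewrite /cap_wt /cup_wt /turn_wt /=; field. Qed.

End TurnWeight.

Section Rotation.
Variables (m n m' n' : nat) (f : 'I_m + 'I_n -> 'I_m' + 'I_n') (b : nat).
Hypothesis f_bij : bijective f.
Hypothesis b_le : (b <= m + n)%N.
Hypothesis pos_f : forall p,
  pos (f p) = if (pos p < b)%N then (pos p + (m + n - b))%N else (pos p - b)%N.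

Lemma rotate_exists (d : diag m n) :
  exists d' : diag m' n', forall p, d' (f p) = f (d p).
Proof.
have [g fK gK] := f_bij.
have [d' dE] : exists d' : diag m' n', d' =1 (fun q => f (d (g q))).
  apply: diag_exists => [p|p|p q].
  - by rewrite fK diagK gK.
  - by rewrite -(inj_eq (can_inj gK)) fK diag_neq.
  rewrite -{1}(gK p) -{1 2}(gK q) !pos_f.
  move: (g p) (g q) => {}p {}q.
  have h1 := diag_noncrossing d (in_setT p) (in_setT q).
  have h2 := diag_noncrossing d (in_setT q) (in_setT (d p)).
  have h3 := diag_noncrossing d (in_setT (d p)) (in_setT (d q)).
  have h4 := diag_noncrossing d (in_setT (d q)) (in_setT p).
  rewrite ?diagK in h2 h3 h4.
  move: (pos_lt p) (pos_lt q) (pos_lt (d p)) (pos_lt (d q)) h1 h2 h3 h4.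
  move: (pos p) (pos q) (pos (d p)) (pos (d q)) => u v w z.
  move: b_le; clear; case: (ltnP u b) => ?; case: (ltnP v b) => ?;
    case: (ltnP w b) => ?; case: (ltnP z b) => ?; lia.
by exists d' => p; rewrite dE fK.
Qed.

(** The first [b] boundary points become the last ones. An arc with one end moved has its ends
    exchanged, at the price of one turn weight; if both ends move, the two turn weights multiply to
    1. *)
Lemma arcs_wt_rotate (K : fieldType) (A : K) (d : diag m n) (d' : diag m' n') x :
  A != 0 -> (forall p, d' (f p) = f (d p)) ->
  arcs_wt A d' x
    = arcs_wt A d (x \o f) * \prod_(p | (pos p < b)%N) turn_wt A (x (f p)).
Proof.
move=> A0 dE; have f_inj := bij_inj f_bij.
have fT : [set: 'I_m' + 'I_n'] = f @: setT.
  have [g fK gK] := f_bij.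
  by apply/setP => p; rewrite inE; apply/esym/imsetP; exists (g p).
rewrite {1}/arcs_wt /wt fT big_imset_cond /=; last by move=> ? ? _ _; exact: f_inj.
have dM := diag_matching d.
rewrite (big_transversal (@pos_inj m n) _ _ dM) => [|p _]; last first.
  by rewrite -dE opener_diag.
rewrite [X in _ = _ * X]big_mkcond [X in _ = _ * X](eq_bigl (fun p => p \in setT))
  /=; last by move=> p; rewrite in_setT.
rewrite (big_arcs (@pos_inj m n) _ _ dM) /= -big_split /=.
apply: eq_bigr => p /andP[_]; rewrite /opener !dE diagK !pos_f => lt.
have ltN := pos_lt (d p).
case: (ltnP (pos p) b) => pb; case: (ltnP (pos (d p)) b) => db.
- by rewrite ltn_add2r lt cup_wt_turn2.
- have -> : (pos p + (m + n - b) < pos (d p) - b)%N = false by lia.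
  by rewrite mulr1 cup_wt_turn.
- by exfalso; lia.
- have -> : (pos p - b < pos (d p) - b)%N by lia.
  by rewrite !mulr1.
Qed.

End Rotation.

Section HalfTurn.
Variables (n : nat).

Definition half_turn (p : 'I_n + 'I_n) : 'I_n + 'I_n :=
  match p with inl j => inr (rev_ord j) | inr j => inl (rev_ord j) end.

Lemma half_turnK : involutive half_turn.
Proof. by case=> j /=; rewrite rev_ordK. Qed.

Lemma half_turn_bij : bijective half_turn.
Proof. exact: inv_bij half_turnK. Qed.

Lemma pos_half_turn p :
  pos (half_turn p) = if (pos p < n)%N then (pos p + (n + n - n))%N else (pos p - n)%N.
Proof.
case: p => j /=; have hj := ltn_ord j; first by rewrite hj; lia.
by rewrite ltnNge leq_addr /=; lia.
Qed.

Definition turn_color (c : {ffun 'I_n -> bool}) : {ffun 'I_n -> bool} :=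
  [ffun j => ~~ c (rev_ord j)].

Lemma turn_colorK : involutive turn_color.
Proof. by move=> c; apply/ffunP => j; rewrite !ffunE rev_ordK negbK. Qed.

Lemma half_turn_exists (d : diag n n) :
  exists d' : diag n n, forall p, d' (half_turn p) = half_turn (d p).
Proof. exact: (rotate_exists half_turn_bij (leq_addr _ _) pos_half_turn). Qed.

Lemma color_char_turn (K : fieldType) (g : bool -> K) (c : {ffun 'I_n -> bool}) :
  color_char g (turn_color c) = color_char (fun b => g (~~ b)) c.
Proof.
rewrite /color_char (reindex_inj rev_ord_inj); apply: eq_bigr => j _.
by rewrite ffunE rev_ordK.
Qed.

(** The bottom points that pass to the top contribute turn weights on [e]. By charge conservation
    these combine with the bend weight into the bend weight of the turned colours. *)
Lemma amplitude_half_turn (K : fieldType) (A : K) (d d' : diag n n) c e :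
  A != 0 -> (forall p, d' (half_turn p) = half_turn (d p)) ->
  amplitude A d' c e = amplitude A d (turn_color e) (turn_color c).
Proof.
move=> A0 dE.
have E : arcs_wt A d' (boundary c e)
    = arcs_wt A d (boundary (turn_color e) (turn_color c)) * color_char (turn_wt A) e.
  rewrite (arcs_wt_rotate half_turn_bij (leq_addr _ _) pos_half_turn _ A0 dE).
  congr (_ * _).
    apply: eq_wt; first exact: diag_matching.
    by case=> j _ /=; rewrite ffunE ?negbK.
  rewrite big_sumType /= [X in _ * X]big_pred0 ?mulr1 => [|j]; last first.
    by rewrite ltnNge leq_addr.
  rewrite /color_char (reindex_inj rev_ord_inj) /=.
  apply: eq_big => j; last by rewrite rev_ordK.
  by have := ltn_ord j; lia.
rewrite /amplitude E; have [->|w] := eqVneq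
  (arcs_wt A d (boundary (turn_color e) (turn_color c))) 0.
  by rewrite !(mul0r, mulr0).
rewrite [_ * color_char _ _]mulrC mulrA; congr (_ * _).
have cap0 b : cap_wt A b (~~ b) != 0 by rewrite oppr_eq0 cup_wt_neq0.
have bE k (u : {ffun 'I_k -> bool}) :
  bend A u = color_char (fun b => cap_wt A b (~~ b)) u by [].
have nz : amplitude A d' c e != 0.
  rewrite /amplitude E bE mulf_neq0 ?mulf_neq0 ?color_char_neq0 //.
  exact: turn_wt_neq0.
rewrite !bE (amplitude_charge_endo A0 cap0 nz) color_char_turn -big_split /=.
by apply: eq_bigr => j _; rewrite cap_wt_turn // negbK.
Qed.

Lemma closure_sym (d : diag n n) : connect_sym (closure_rel d).
Proof.
have swK (p : 'I_n + 'I_n) : swap (swap p) = p by case: p.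
apply: sym_connect_sym => u v; rewrite /closure_rel; congr (_ || _).
  by apply/eqP/eqP => ->; rewrite diagK.
by apply/eqP/eqP => ->; rewrite swK.
Qed.

Lemma closure_half_turn (d d' : diag n n) :
  (forall p, d' (half_turn p) = half_turn (d p)) ->
  n_comp (closure_rel d') predT = n_comp (closure_rel d) predT.
Proof.
move=> dE; have hs (p : 'I_n + 'I_n) : half_turn (swap p) = swap (half_turn p).
  by case: p.
have cl : closed (closure_rel d') predT by [].
rewrite (adjunction_n_comp half_turn (@closure_sym d') (@closure_sym d) cl) //.
apply: strict_adjunction => //.
- exact: closure_sym.
- exact: inv_inj half_turnK.
- apply/subsetP => p _; apply/codomP; exists (half_turn p).
  by rewrite half_turnK.
- move=> u v _; rewrite /closure_rel dE -hs.
  by rewrite !(inj_eq (inv_inj half_turnK)).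
Qed.

End HalfTurn.

Section Trace.
Variables (n : nat) (d : diag n n).
Let a (j : 'I_n) : 'I_n + 'I_n := inl j.
Let b (j : 'I_n) : 'I_n + 'I_n := inr j.
Let s : seq 'I_n := rev (enum 'I_n).

Let a_inj : injective a. Proof. by move=> i j []. Qed.
Let b_inj : injective b. Proof. by move=> i j []. Qed.

(** The closing arcs join [inl j] to [inr j]. In boundary order the pair with the largest index is
    adjacent and the others enclose it, hence the reversed enumeration. *)
Let nested_s : nested_pairs (@pos n n) a b setT s.
Proof.
have : sorted (fun i j => j < i)%N [seq val j | j <- s].
  by rewrite /s map_rev val_enum_ord rev_sorted iota_ltn_sorted.
have : forall i, (a i \in [set: 'I_n + 'I_n]) = (i \in s).
  by move=> i; rewrite inE mem_rev mem_enum.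
have : forall i, (b i \in [set: 'I_n + 'I_n]) = (i \in s).
  by move=> i; rewrite inE mem_rev mem_enum.
elim: s [set: _] => //= j r IH D bD aD jr.
have jmax i : i \in r -> (i < j)%N.
  move=> ir; have tr : transitive (fun i j => j < i)%N.
    by move=> u v w vu uw; apply: ltn_trans uw vu.
  have := order_path_min tr jr.
  by move=> /allP/(_ (val i)); apply; apply/mapP; exists i.
have jnr : j \notin r by apply/negP => /jmax; rewrite ltnn.
split; rewrite ?aD ?bD ?mem_head //=.
- by have := ltn_ord j; lia.
- case=> i Di /=; apply/negP; have := ltn_ord i; have := ltn_ord j => hj hi.
  + have := aD i; rewrite Di inE => /esym/orP[/eqP ->|/jmax]; lia.
  + have := bD i; rewrite Di inE => /esym/orP[/eqP ->|/jmax]; lia.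
apply: IH => [i|i|]; last exact: path_sorted jr.
  rewrite !in_setD1 bD inE (inj_eq b_inj).
  by have [->|] //= := eqVneq i j; rewrite (negPf jnr).
rewrite !in_setD1 aD inE (inj_eq a_inj).
by have [->|] //= := eqVneq i j; rewrite (negPf jnr).
Qed.

Definition neg_color (c : {ffun 'I_n -> bool}) : {ffun 'I_n -> bool} :=
  [ffun j => ~~ c j].

Lemma neg_colorK : involutive neg_color.
Proof. by move=> c; apply/ffunP => j; rewrite !ffunE negbK. Qed.

(** Contracting all closing arcs leaves no point, so the state sum is the value of the loops. A
    closing cap has its ends in the order opposite to a bend; [turn_wt] is the quotient, and the
    trace becomes a weighted matrix trace. *)
Lemma closure_amplitude (K : fieldType) (A : K) : A != 0 ->
  (- A ^+ 2 - A ^- 2) ^+ n_comp (closure_rel d) predT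
    = \sum_c color_char (turn_wt A) c * amplitude A d c c.
Proof.
move=> A0.
have [Z [_ _ _ wZ]] := contract A0 (@pos_inj n n) (diag_matching d)
  (@diag_noncrossing n n d) nested_s.
have O0 : unglued a b setT s = set0.
  apply/setP => p; rewrite unglued_in !inE; apply/allP => h.
  by case: p h => j /(_ j); rewrite mem_rev mem_enum eqxx ?andbF => /(_ isT).
have eg : gluing a b setT d s =2 closure_rel d.
  move=> u v; rewrite /gluing /closure_rel inE /=; congr (_ || _).
  apply/hasP/eqP => [[j _ /orP[]/andP[/eqP -> /eqP ->]]//|->].
  case: u => j; exists j; rewrite ?mem_rev ?mem_enum //=; by rewrite !eqxx ?orbT.
have := wZ (fun=> false); rewrite O0 {2}/wt big_pred0 => [|p]; last by rewrite inE.
rewrite mulr1 (_ : n_comp _ _ = n_comp (closure_rel d) predT); last first.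
  rewrite (eq_n_comp (eq_connect eg)); apply: eq_n_comp_r => p; rewrite !inE.
  by apply/forall_inP => q; rewrite inE.
move=> <-; rewrite caps_sum_all ?rev_uniq ?enum_uniq //; last first.
  by move=> j; rewrite mem_rev mem_enum.
rewrite (reindex_inj (inv_inj neg_colorK)) /=; apply: eq_bigr => c _.
rewrite /amplitude mulrA; congr (_ * _).
  rewrite /bend -big_split; apply: eq_bigr => j _ /=; rewrite ffunE negbK.
  by rewrite mulrC cap_wt_turn.
apply: eq_wt; first exact: diag_matching.
case=> j _ /=; have sj : j \in s by rewrite mem_rev mem_enum.
  by rewrite (recolor_a a_inj) // ffunE.
by rewrite (recolor_b b_inj) // ffunE negbK.
Qed.

End Trace.

(** * The faithful representation of the Temperley-Lieb category *)

Notation amp := (amplitude A).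

Definition dlt m n (d : diag m n) : TL m n := [ffun d' => (d' == d)%:R].

Lemma the_diagE m n (Q : pred (diag m n)) d : Q =1 pred1 d -> the_diag Q = dlt d.
Proof. by move=> e; apply/ffunP => d'; rewrite !ffunE e. Qed.

Lemma TL_scaleE m n k (X : TL m n) d : (k *: X) d = k * X d.
Proof. by rewrite ffunE. Qed.

Lemma TL_sumE (I : Type) (r : seq I) (Q : pred I) m n (F : I -> TL m n) d :
  (\sum_(i <- r | Q i) F i) d = \sum_(i <- r | Q i) F i d.
Proof. by elim/big_rec2: _ => [|i y1 y2 _ <-]; rewrite ffunE. Qed.

Lemma TL_decomp m n (X : TL m n) : X = \sum_d X d *: dlt d.
Proof.
apply/ffunP => d; rewrite TL_sumE (bigD1 d) //= big1 => [|d' nd'].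
  by rewrite addr0 TL_scaleE ffunE eqxx mulr1.
by rewrite TL_scaleE ffunE eq_sym (negPf nd') mulr0.
Qed.

Lemma TL_ind m n (Q : TL m n -> Prop) :
  Q 0 -> (forall X Y, Q X -> Q Y -> Q (X + Y)) ->
  (forall k d, Q (k *: dlt d)) -> forall X, Q X.
Proof. by move=> Q0 QD Qd X; rewrite [X]TL_decomp; apply: big_ind. Qed.

Section Rep.
Variables (m n : nat).
Implicit Types (c : {ffun 'I_m -> bool}) (e : {ffun 'I_n -> bool}).

Definition rep (X : TL m n) c e : QA := \sum_d (X d : QA) * amp d c e.

Lemma repD X Y c e : rep (X + Y) c e = rep X c e + rep Y c e.
Proof. by rewrite /rep -big_split; apply: eq_bigr => d _; rewrite ffunE mulrDl. Qed.

Lemma repZ k X c e : rep (k *: X) c e = k * rep X c e.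
Proof.
by rewrite /rep mulr_sumr; apply: eq_bigr => d _; rewrite TL_scaleE mulrA.
Qed.

Lemma rep0 c e : rep 0 c e = 0.
Proof. by rewrite /rep big1 // => d _; rewrite ffunE mul0r. Qed.

Lemma repN X c e : rep (- X) c e = - rep X c e.
Proof. by rewrite -scaleN1r repZ mulN1r. Qed.

Lemma rep_sum (I : Type) (r : seq I) (Q : pred I) F c e :
  rep (\sum_(i <- r | Q i) F i) c e = \sum_(i <- r | Q i) rep (F i) c e.
Proof. by elim/big_rec2: _ => [|i y1 y2 _ <-]; rewrite ?rep0 ?repD. Qed.

Lemma rep_dlt d c e : rep (dlt d) c e = amp d c e.
Proof.
rewrite /rep (bigD1 d) //= big1 => [|d' nd']; first by rewrite ffunE eqxx mul1r addr0.
by rewrite ffunE (negPf nd') mul0r.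
Qed.

(** The extensionality principle behind the algebraic laws that follow: each reduces to an identity
    between sums of matrix entries. *)
Lemma rep_inj X Y : (forall c e, rep X c e = rep Y c e) -> X = Y.
Proof.
move=> h; apply/eqP; rewrite -subr_eq0; apply/eqP/ffunP => d; rewrite [RHS]ffunE.
apply: (@arcs_wt_free m n QA A (X - Y) A_neq0) => {d} x.
pose c : {ffun 'I_m -> bool} := [ffun j => ~~ x (inl j)].
pose e : {ffun 'I_n -> bool} := [ffun j => x (inr j)].
have bc0 : bend A c != 0.
  by apply/prodf_neq0 => j _; rewrite oppr_eq0 cup_wt_neq0 ?A_neq0.
apply: (mulfI bc0); rewrite mulr0 -[RHS](subrr (rep Y c e)) -{1}(h c e) -repN -repD.
rewrite /rep mulr_sumr; apply: eq_bigr => d _; rewrite mulrCA; congr (_ * _).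
rewrite /amplitude; congr (_ * _); apply: eq_wt; first exact: diag_matching.
by case=> j _ /=; rewrite ffunE ?negbK.
Qed.

Lemma rep_charge (g : bool -> QA) X c e : g true * g false = 1 ->
  rep X c e != 0 -> color_char g c = color_char g e.
Proof.
move=> g1; apply: contraNeq => ne; rewrite /rep big1 // => d _.
have [->|w] := eqVneq (amp d c e) 0; first by rewrite mulr0.
by case/eqP: ne; exact: (amplitude_charge A_neq0 g1 w).
Qed.

End Rep.

Lemma rep_charge_endo n (g : bool -> QA) (X : TL n n) c e :
  (forall b, g b != 0) -> rep X c e != 0 -> color_char g c = color_char g e.
Proof.
move=> g0; apply: contraNeq => ne; rewrite /rep big1 // => d _.
have [->|w] := eqVneq (amp d c e) 0; first by rewrite mulr0.
by case/eqP: ne; exact: (amplitude_charge_endo A_neq0 g0 w).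
Qed.

Lemma comp_dlt_exists l m n (x : diag m n) (y : diag l m) : exists z : diag l n,
  [/\ the_diag (stacks_to x y) = dlt z,
      forall p q, connect (glue x y) (@outer l m n p) (@outer l m n q)
                    = (q == p) || (q == z p) &
      forall c e, \sum_d amp y c d * amp x d e
                    = delta ^+ stack_loops x y * amp z c e].
Proof.
have [z [cz wz]] := stack_exists x y; exists z; split=> //; last first.
  by move=> c e; apply: wz; exact: A_neq0.
apply: the_diagE => z' /=; apply/forallP/eqP => [h|-> p]; last first.
  by rewrite cz eqxx orbT.
apply: eq_diag => p; have := h p; rewrite cz => /orP[]/eqP // e.
by have := diag_neq z' p; rewrite e eqxx.
Qed.

Lemma rep_comp l m n (X : TL m n) (Y : TL l m) c e :
  rep (X ** Y) c e = \sum_d rep Y c d * rep X d e.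
Proof.
transitivity (\sum_x \sum_y \sum_d
    ((Y y : QA) * amp y c d) * ((X x : QA) * amp x d e)).
  rewrite /comp rep_sum; apply: eq_bigr => x _.
  rewrite rep_sum; apply: eq_bigr => y _.
  have [z [-> _ wz]] := comp_dlt_exists x y.
  rewrite repZ rep_dlt; transitivity ((X x : QA) * (Y y : QA) *
      (delta ^+ stack_loops x y * amp z c e)); first by rewrite [RHS]mulrA.
  rewrite -wz mulr_sumr; apply: eq_bigr => d _.
  by rewrite [RHS]mulrACA [(Y y : QA) * _]mulrC.
under eq_bigr do rewrite exchange_big /=.
rewrite exchange_big /=; apply: eq_bigr => d _.
rewrite {2}/rep mulr_sumr; apply: eq_bigr => x _.
by rewrite /rep mulr_suml.
Qed.

Lemma juxtapose_dlt_exists m m' n n' (x : diag m n) (y : diag m' n') :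
  exists z : diag (m + m') (n + n'),
  [/\ the_diag (juxtaposes_to x y) = dlt z,
      forall p, z (left_pt m' n' p) = left_pt m' n' (x p) &
      forall p, z (right_pt m n p) = right_pt m n (y p)].
Proof.
have [z [zL zR]] := juxtapose_exists x y; exists z; split=> //.
apply: the_diagE => z' /=; apply/andP/eqP => [[/forallP hL /forallP hR]|->].
  apply: eq_diag => p; have [[q ->]|[q ->]] := left_right_cover p.
    by rewrite zL; exact/eqP/hL.
  by rewrite zR; exact/eqP/hR.
by split; apply/forallP => p; rewrite ?zL ?zR.
Qed.

Lemma rep_tens m m' n n' (X : TL m n) (Y : TL m' n') c e :
  rep (tens X Y) c e = rep X (lcolor c) (lcolor e) * rep Y (rcolor c) (rcolor e).
Proof.
rewrite /tens rep_sum {2}/rep mulr_suml; apply: eq_bigr => x _.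
rewrite rep_sum /rep mulr_sumr; apply: eq_bigr => y _.
have [z [-> zL zR]] := juxtapose_dlt_exists x y.
by rewrite -/(rep _ _ _) repZ rep_dlt (amplitude_juxtapose _ _ _ zL zR); ring.
Qed.

Lemma star_dlt_exists m n (d : diag m n) : exists z : diag n m,
  the_diag (fun z : diag n m => [forall p, z (swap p) == swap (d p)]) = dlt z
  /\ forall p, z (swap p) = swap (d p).
Proof.
have [z zE] := star_exists d; exists z; split=> //; apply: the_diagE => z' /=.
apply/forallP/eqP => [h|-> p]; last by rewrite zE.
apply: eq_diag => p; have -> : p = swap (swap p) by case: p.
by rewrite zE; exact/eqP.
Qed.

Notation parity := (color_char (parity_wt QA)).

Lemma rep_star m n (X : TL m n) c e :
  rep (star X) e c = parity c * parity e * rep X c e.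
Proof.
rewrite /star rep_sum {2}/rep mulr_sumr; apply: eq_bigr => x _.
have [z [-> zE]] := star_dlt_exists x.
by rewrite repZ rep_dlt (amplitude_star A_neq0 _ _ zE); ring.
Qed.

Definition rot n (X : TL n n) : TL n n :=
  \sum_(x : diag n n)
     X x *: the_diag (fun z : diag n n => [forall p, z (half_turn p) == half_turn (x p)]).

Lemma rot_dlt_exists n (d : diag n n) : exists z : diag n n,
  the_diag (fun z : diag n n => [forall p, z (half_turn p) == half_turn (d p)]) = dlt z
  /\ forall p, z (half_turn p) = half_turn (d p).
Proof.
have [z zE] := half_turn_exists d; exists z; split=> //; apply: the_diagE => z' /=.
apply/forallP/eqP => [h|-> p]; last by rewrite zE.
apply: eq_diag => p; rewrite -[p]half_turnK zE; exact/eqP.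
Qed.

Lemma rep_rot n (X : TL n n) c e :
  rep (rot X) c e = rep X (turn_color e) (turn_color c).
Proof.
rewrite /rot rep_sum {2}/rep; apply: eq_bigr => x _.
have [z [-> zE]] := rot_dlt_exists x.
by rewrite repZ rep_dlt (amplitude_half_turn _ _ A_neq0 zE).
Qed.

Notation turn_char := (color_char (turn_wt A)).

Lemma tr_rep n (X : TL n n) : tr X = \sum_c turn_char c * rep X c c.
Proof.
rewrite /tr.
under [RHS]eq_bigr do rewrite /rep mulr_sumr.
rewrite exchange_big /=; apply: eq_bigr => d _.
rewrite /delta (closure_amplitude d A_neq0) mulr_sumr; apply: eq_bigr => c _.
by rewrite mulrCA.
Qed.

Lemma tr_rot n (X : TL n n) : tr (rot X) = tr X.
Proof.
transitivity (\sum_d (X d : QA) *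
    \sum_c turn_char c * amp d (turn_color c) (turn_color c)).
  rewrite tr_rep; transitivity (\sum_c \sum_d
      (X d : QA) * (turn_char c * amp d (turn_color c) (turn_color c))).
    by apply: eq_bigr => c _; rewrite rep_rot mulr_sumr; apply: eq_bigr => d _;
      rewrite mulrCA.
  by rewrite exchange_big /=; apply: eq_bigr => d _; rewrite mulr_sumr.
rewrite /tr; apply: eq_bigr => d _; congr (_ * _).
have [z [_ zE]] := rot_dlt_exists d.
rewrite -(closure_half_turn zE) /delta (closure_amplitude z A_neq0).
apply: eq_bigr => c _; congr (_ * _).
by rewrite (amplitude_half_turn _ _ A_neq0 zE).
Qed.

(* The operations are sealed so that unification never unfolds the sums over
   diagrams that define them. *)
Definition mul l m n (X : TL m n) (Y : TL l m) : TL l n :=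
  locked (@Defs.comp) l m n X Y.
Definition juxt m m' n n' (X : TL m n) (Y : TL m' n') : TL (m + m') (n + n') :=
  locked (@tens) m m' n n' X Y.
Definition dual m n (X : TL m n) : TL n m := locked (@star) m n X.
Definition trace n (X : TL n n) : QA := locked (@tr) n X.
Definition turn n (X : TL n n) : TL n n := locked (@rot) n X.
Definition one n : TL n n := locked idTL n.
Infix "*d" := mul (at level 40, left associativity) : ring_scope.

Lemma mulE l m n (X : TL m n) (Y : TL l m) : X ** Y = X *d Y.
Proof. by rewrite /mul -lock. Qed.
Lemma juxtE m m' n n' (X : TL m n) (Y : TL m' n') : tens X Y = juxt X Y.
Proof. by rewrite /juxt -lock. Qed.
Lemma dualE m n (X : TL m n) : star X = dual X.
Proof. by rewrite /dual -lock. Qed.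
Lemma traceE n (X : TL n n) : tr X = trace X.
Proof. by rewrite /trace -lock. Qed.
Lemma turnE n (X : TL n n) : rot X = turn X.
Proof. by rewrite /turn -lock. Qed.
Lemma oneE n : idTL n = one n.
Proof. by rewrite /one -lock. Qed.

Lemma rep_mul l m n (X : TL m n) (Y : TL l m) c e :
  rep (X *d Y) c e = \sum_d rep Y c d * rep X d e.
Proof. by rewrite -mulE rep_comp. Qed.
Lemma rep_juxt m m' n n' (X : TL m n) (Y : TL m' n') c e :
  rep (juxt X Y) c e = rep X (lcolor c) (lcolor e) * rep Y (rcolor c) (rcolor e).
Proof. by rewrite -juxtE rep_tens. Qed.
Lemma rep_dual m n (X : TL m n) c e :
  rep (dual X) e c = parity c * parity e * rep X c e.
Proof. by rewrite -dualE rep_star. Qed.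
Lemma trace_rep n (X : TL n n) : trace X = \sum_c turn_char c * rep X c c.
Proof. by rewrite -traceE tr_rep. Qed.
Lemma rep_turn n (X : TL n n) c e :
  rep (turn X) c e = rep X (turn_color e) (turn_color c).
Proof. by rewrite -turnE rep_rot. Qed.
Lemma trace_turn n (X : TL n n) : trace (turn X) = trace X.
Proof. by rewrite -turnE -!traceE tr_rot. Qed.

(** * Laws of composition, juxtaposition, reflection and trace *)

Section Bilinear.
Variables (l m n : nat).
Implicit Types (X : TL m n) (Y : TL l m).

Lemma mulDl_TL X X' Y : (X + X') *d Y = X *d Y + X' *d Y.
Proof.
apply: rep_inj => c e; rewrite repD !rep_mul -big_split; apply: eq_bigr => d _.
by rewrite repD mulrDr.
Qed.

Lemma mulDr_TL X Y Y' : X *d (Y + Y') = X *d Y + X *d Y'.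
Proof.
apply: rep_inj => c e; rewrite repD !rep_mul -big_split; apply: eq_bigr => d _.
by rewrite repD mulrDl.
Qed.

Lemma mulZl_TL k X Y : (k *: X) *d Y = k *: (X *d Y).
Proof.
apply: rep_inj => c e; rewrite repZ !rep_mul mulr_sumr; apply: eq_bigr => d _.
by rewrite repZ mulrCA.
Qed.

Lemma mulZr_TL k X Y : X *d (k *: Y) = k *: (X *d Y).
Proof.
apply: rep_inj => c e; rewrite repZ !rep_mul mulr_sumr; apply: eq_bigr => d _.
by rewrite repZ mulrA.
Qed.

Lemma mul0l_TL Y : (0 : TL m n) *d Y = 0.
Proof. by rewrite -(scale0r 0) mulZl_TL !scale0r. Qed.

Lemma mul0r_TL X : X *d (0 : TL l m) = 0.
Proof. by rewrite -(scale0r 0) mulZr_TL !scale0r. Qed.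

Lemma mulNl_TL X Y : (- X) *d Y = - (X *d Y).
Proof. by rewrite -scaleN1r mulZl_TL scaleN1r. Qed.

Lemma mulNr_TL X Y : X *d (- Y) = - (X *d Y).
Proof. by rewrite -scaleN1r mulZr_TL scaleN1r. Qed.

Lemma mulBl_TL X X' Y : (X - X') *d Y = X *d Y - X' *d Y.
Proof. by rewrite mulDl_TL mulNl_TL. Qed.

Lemma mulBr_TL X Y Y' : X *d (Y - Y') = X *d Y - X *d Y'.
Proof. by rewrite mulDr_TL mulNr_TL. Qed.

Lemma mul_suml_TL (I : Type) (r : seq I) (Q : pred I) F Y :
  (\sum_(i <- r | Q i) F i : TL m n) *d Y = \sum_(i <- r | Q i) (F i *d Y).
Proof. by elim/big_rec2: _ => [|i y1 y2 _ <-]; rewrite ?mul0l_TL ?mulDl_TL. Qed.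

Lemma mul_sumr_TL (I : Type) (r : seq I) (Q : pred I) X F :
  X *d (\sum_(i <- r | Q i) F i : TL l m) = \sum_(i <- r | Q i) (X *d F i).
Proof. by elim/big_rec2: _ => [|i y1 y2 _ <-]; rewrite ?mul0r_TL ?mulDr_TL. Qed.

End Bilinear.

Lemma mulA_TL k l m n (X : TL m n) (Y : TL l m) (Z : TL k l) :
  X *d Y *d Z = X *d (Y *d Z).
Proof.
apply: rep_inj => c e; rewrite !rep_mul.
transitivity (\sum_u \sum_v rep Z c u * (rep Y u v * rep X v e)).
  by apply: eq_bigr => u _; rewrite rep_mul mulr_sumr.
rewrite exchange_big; apply: eq_bigr => v _; rewrite rep_mul mulr_suml.
by apply: eq_bigr => u _; rewrite mulrA.
Qed.

Lemma id_diag_exists n : exists d : diag n n, (forall j, d (inl j) = inr j)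
  /\ (forall j, d (inr j) = inl j).
Proof.
have sw (p : 'I_n + 'I_n) : pos (swap p) = (n + n - (pos p).+1)%N.
  by case: p => i /=; have := ltn_ord i; lia.
have [d dE] : exists d : diag n n, d =1 @swap 'I_n 'I_n.
  apply: diag_exists => [[]//|[]//|p q].
  by rewrite !sw; have := pos_lt p; have := pos_lt q; lia.
by exists d; split=> j; rewrite dE.
Qed.

Lemma idTL_dlt n (d : diag n n) :
  (forall j, d (inl j) = inr j) -> idTL n = dlt d.
Proof.
move=> dE; apply: the_diagE => d' /=; apply/forallP/eqP => [h|-> j]; last first.
  by rewrite dE.
apply: eq_diag; case=> j; rewrite ?dE; first exact/eqP.
by rewrite -{2}dE diagK -{1}(eqP (h j)) diagK.
Qed.

Lemma rep_one n c e : rep (one n) c e = (c == e)%:R.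
Proof.
rewrite -oneE.
have [d [dl dr]] := id_diag_exists n; rewrite (idTL_dlt dl) rep_dlt.
have cc b b' : cap_wt A b (~~ b) * cup_wt A (~~ b) b' = (b == b')%:R.
  by case: b b' => [] []; rewrite /cap_wt /= ?mulr0 // ?opprK ?mulrNN;
    rewrite ?mulfV ?mulVf ?A_neq0.
transitivity (\prod_j ((c j == e j)%:R : QA)).
  rewrite /amplitude /arcs_wt /wt big_sumType /= [X in _ * (_ * X)]big_pred0; last first.
    move=> j; rewrite /opener dr in_setT /=; have := ltn_ord j; lia.
  rewrite mulr1 [X in _ * X](eq_bigl xpredT) => [|j]; last first.
    rewrite /opener dl in_setT /=; have := ltn_ord j; lia.
  by rewrite -big_split; apply: eq_bigr => j _; rewrite dl /= cc.
have [->|ne] := eqVneq c e; first by rewrite big1 // => j _; rewrite eqxx.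
have [j nj] : exists j, c j != e j.
  by apply/existsP; apply: contraNT ne => /existsPn h; apply/eqP/ffunP => j;
    apply/eqP; have := h j; rewrite negbK.
by rewrite (bigD1 j) //= (negPf nj) mul0r.
Qed.

Lemma mul1_TL m n (X : TL m n) : one n *d X = X.
Proof.
apply: rep_inj => c e; rewrite rep_mul (bigD1 e) //= big1 => [|d nd].
  by rewrite rep_one eqxx mulr1 addr0.
by rewrite rep_one (negPf nd) mulr0.
Qed.

Lemma mul_TL1 m n (X : TL m n) : X *d one m = X.
Proof.
apply: rep_inj => c e; rewrite rep_mul (bigD1 c) //= big1 => [|d nd].
  by rewrite rep_one eqxx mul1r addr0.
by rewrite rep_one eq_sym (negPf nd) mul0r.
Qed.

Definition join_color m m' (u : {ffun 'I_m -> bool} * {ffun 'I_m' -> bool}) :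
    {ffun 'I_(m + m') -> bool} :=
  [ffun i => match split i with inl j => u.1 j | inr j => u.2 j end].

Lemma lcolor_join m m' u : lcolor (@join_color m m' u) = u.1.
Proof.
apply/ffunP => j; rewrite !ffunE -[lshift _ _]/(unsplit (inl j)) unsplitK //.
Qed.

Lemma rcolor_join m m' u : rcolor (@join_color m m' u) = u.2.
Proof.
apply/ffunP => j; rewrite !ffunE -[rshift _ _]/(unsplit (inr j)) unsplitK //.
Qed.

Lemma join_colorK m m' (c : {ffun 'I_(m + m') -> bool}) :
  join_color (lcolor c, rcolor c) = c.
Proof. by apply/ffunP => i; rewrite ffunE; case: split_ordP => j ->; rewrite ffunE. Qed.

Lemma sum_color_split m m' (F : {ffun 'I_(m + m') -> bool} -> QA) :
  \sum_c F c = \sum_c \sum_e F (join_color (c, e)).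
Proof.
rewrite pair_big /= (reindex (@join_color m m')) /=; last first.
  exists (fun c => (lcolor c, rcolor c)) => c _; last exact: join_colorK.
  by rewrite lcolor_join rcolor_join; case: c.
by apply: eq_bigr => -[].
Qed.

Section TensLinear.
Variables (m n m' n' : nat).
Implicit Types (X : TL m n) (Y : TL m' n').

Lemma juxtDl X X' Y : juxt (X + X') Y = juxt X Y + juxt X' Y.
Proof. by apply: rep_inj => c e; rewrite repD !rep_juxt repD mulrDl. Qed.

Lemma juxtDr X Y Y' : juxt X (Y + Y') = juxt X Y + juxt X Y'.
Proof. by apply: rep_inj => c e; rewrite repD !rep_juxt repD mulrDr. Qed.

Lemma juxtZl k X Y : juxt (k *: X) Y = k *: juxt X Y.
Proof. by apply: rep_inj => c e; rewrite repZ !rep_juxt repZ mulrA. Qed.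

Lemma juxtZr k X Y : juxt X (k *: Y) = k *: juxt X Y.
Proof. by apply: rep_inj => c e; rewrite repZ !rep_juxt repZ mulrCA. Qed.

Lemma juxt0l Y : juxt (0 : TL m n) Y = 0.
Proof. by rewrite -(scale0r 0) juxtZl !scale0r. Qed.

Lemma juxt0r X : juxt X (0 : TL m' n') = 0.
Proof. by rewrite -(scale0r 0) juxtZr !scale0r. Qed.

Lemma juxt_suml (I : Type) (r : seq I) (Q : pred I) F Y :
  juxt (\sum_(i <- r | Q i) F i : TL m n) Y = \sum_(i <- r | Q i) juxt (F i) Y.
Proof. by elim/big_rec2: _ => [|i y1 y2 _ <-]; rewrite ?juxt0l ?juxtDl. Qed.

End TensLinear.

Lemma juxt_mul m n l m' n' l' (X : TL m n) (Y : TL l m) (X' : TL m' n') (Y' : TL l' m') :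
  juxt (X *d Y) (X' *d Y') = juxt X X' *d juxt Y Y'.
Proof.
apply: rep_inj => c e; rewrite rep_juxt !rep_mul sum_color_split mulr_suml.
apply: eq_bigr => u _; rewrite mulr_sumr; apply: eq_bigr => v _.
by rewrite !rep_juxt lcolor_join rcolor_join mulrACA.
Qed.

Lemma juxt1 m n : juxt (one m) (one n) = one (m + n).
Proof.
apply: rep_inj => c e; rewrite rep_juxt !rep_one -natrM mulnb; congr (_%:R).
congr nat_of_bool; apply/andP/eqP => [[/eqP h1 /eqP h2]|->]; last by rewrite !eqxx.
by rewrite -(join_colorK c) h1 h2 join_colorK.
Qed.

Lemma juxt_id0 n (X : TL n n) : juxt (one 0) X = (X : TL (0 + n) (0 + n)).
Proof.
apply: rep_inj => c e; rewrite rep_juxt rep_one.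
have -> : lcolor c = lcolor e by apply/ffunP => -[].
rewrite eqxx mul1r; congr rep; apply/ffunP => j; rewrite ffunE;
  by congr (_ _); apply: val_inj.
Qed.

Section StarLaws.
Variables (m n : nat).
Implicit Types X : TL m n.

Lemma dualD X Y : dual (X + Y) = dual X + dual Y.
Proof. by apply: rep_inj => c e; rewrite repD !rep_dual repD mulrDr. Qed.

Lemma dualZ k X : dual (k *: X) = k *: dual X.
Proof. by apply: rep_inj => c e; rewrite repZ !rep_dual repZ mulrCA. Qed.

Lemma dual0 : dual (0 : TL m n) = 0.
Proof. by rewrite -(scale0r 0) dualZ !scale0r. Qed.

End StarLaws.

Lemma dualK m n (X : TL m n) : dual (dual X) = X.
Proof.
apply: rep_inj => c e; rewrite !rep_dual mulrA -[RHS]mul1r; congr (_ * _).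
rewrite -[RHS]mulr1 -{1}(parity_char_sqr QA c) -(parity_char_sqr QA e).
by move: (parity c) (parity e) => u v; ring.
Qed.

Lemma dual_mul l m n (X : TL m n) (Y : TL l m) : dual (X *d Y) = dual Y *d dual X.
Proof.
apply: rep_inj => e c; rewrite rep_dual !rep_mul mulr_sumr; apply: eq_bigr => d _.
rewrite !rep_dual.
rewrite -[parity c * parity e]mulr1 -(parity_char_sqr QA d).
move: (rep X d e) (rep Y c d) (parity c) (parity d) (parity e) => u v w z t.
by ring.
Qed.

Lemma dual_juxt m n m' n' (X : TL m n) (Y : TL m' n') :
  dual (juxt X Y) = juxt (dual X) (dual Y).
Proof.
apply: rep_inj => e c; rewrite rep_dual !rep_juxt !rep_dual.
have pE k k' (u : {ffun 'I_(k + k') -> bool}) :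
    parity u = parity (lcolor u) * parity (rcolor u).
  rewrite /color_char big_split_ord; congr (_ * _); apply: eq_bigr => i _;
    by rewrite ffunE.
rewrite (pE _ _ c) (pE _ _ e) [RHS]mulrACA; congr (_ * _).
by rewrite mulrACA.
Qed.

Lemma dual1 n : dual (one n) = one n.
Proof.
apply: rep_inj => c e; rewrite rep_dual !rep_one eq_sym.
by case: eqP => [->|_]; rewrite ?mulr0 ?mulr1 ?parity_char_sqr.
Qed.

(** For endomorphisms the signs of the two ends agree wherever the entry is nonzero, so [dual] is
    the honest transpose. *)
Lemma rep_dual_endo n (X : TL n n) c e : rep (dual X) e c = rep X c e.
Proof.
rewrite rep_dual; have [->|w] := eqVneq (rep X c e) 0; first by rewrite mulr0.
have p0 b : parity_wt QA b != 0 by case: b; rewrite /= ?oppr_eq0 oner_eq0.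
by rewrite (rep_charge_endo p0 w) parity_char_sqr mul1r.
Qed.

Lemma traceZ n k (X : TL n n) : trace (k *: X) = k * trace X.
Proof.
by rewrite !trace_rep mulr_sumr; apply: eq_bigr => c _; rewrite repZ mulrCA.
Qed.

(** The trace weight is a character with [turn_wt true * turn_wt false = 1], so charge conservation
    moves it across [Y] even when [m] and [n] differ. *)
Lemma traceC m n (X : TL m n) (Y : TL n m) : trace (X *d Y) = trace (Y *d X).
Proof.
rewrite !trace_rep.
transitivity (\sum_c \sum_d color_char (turn_wt A) c * (rep Y c d * rep X d c)).
  by apply: eq_bigr => c _; rewrite rep_mul mulr_sumr.
rewrite exchange_big /=; apply: eq_bigr => d _; rewrite rep_mul mulr_sumr.
apply: eq_bigr => c _; have [->|w] := eqVneq (rep Y c d) 0.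
  by rewrite mul0r !mulr0.
by rewrite (rep_charge (turn_wt_inv A_neq0) w) [rep X d c * _]mulrC.
Qed.

Lemma turnD n (X Y : TL n n) : turn (X + Y) = turn X + turn Y.
Proof. by apply: rep_inj => c e; rewrite repD !rep_turn repD. Qed.

Lemma turnZ n k (X : TL n n) : turn (k *: X) = k *: turn X.
Proof. by apply: rep_inj => c e; rewrite repZ !rep_turn repZ. Qed.

Lemma turnK n (X : TL n n) : turn (turn X) = X.
Proof. by apply: rep_inj => c e; rewrite !rep_turn !turn_colorK. Qed.

Lemma turn_mul n (X Y : TL n n) : turn (X *d Y) = turn Y *d turn X.
Proof.
apply: rep_inj => c e; rewrite rep_turn !rep_mul.
rewrite (reindex_inj (inv_inj (@turn_colorK n))); apply: eq_bigr => d _.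
by rewrite !rep_turn mulrC.
Qed.

(** * Innermost arcs and the augmentation *)

Section InnerArcs.
Variables (m n : nat) (d : diag m n).

Lemma pos_onto k : (k < m + n)%N -> exists p : 'I_m + 'I_n, pos p = k.
Proof.
move=> lk; have [lt|ge] := ltnP k m; first by exists (inl (Ordinal lt)).
have h : (n - (k - m).+1 < n)%N by lia.
by exists (inr (Ordinal h)) => /=; lia.
Qed.

(** Unless the next point is the partner of [p], its arc lies strictly under that of [p] and is
    shorter; descend. *)
Lemma inner_arc p : (pos p < pos (d p))%N ->
  exists q, [/\ (pos p <= pos q)%N, pos (d q) = (pos q).+1 & (pos (d q) <= pos (d p))%N].
Proof.
have [k le] := ubnP (pos (d p) - pos p)%N; elim: k p le => // k IH p le lt.
have [e|ne] := eqVneq (pos (d p)) (pos p).+1; first by exists p; rewrite e leqnn.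
have [|r rE] := @pos_onto (pos p).+1; first by have := pos_lt (d p); lia.
have := @diag_nested m n d p r (in_setT _) (in_setT _).
rewrite rE ltnSn; have -> : ((pos p).+1 < pos (d p))%N by lia.
move=> /(_ isT) /andP[h1 h2].
have nr : pos (d r) != pos r by rewrite (inj_eq (@pos_inj m n)) diag_neq.
have [||q [q1 q2 q3]] := IH r; [lia|lia|].
by exists q; split=> //; lia.
Qed.

(** The bounds matter later: when [i] and [j] lie in one block of points, the cap found lies in the
    same block. *)
Lemma bottom_cap i j : d (inl i) = inl j ->
  exists a b : 'I_m, [/\ (b = a.+1 :> nat), d (inl a) = inl b,
    (minn i j <= a)%N & (b <= maxn i j)%N].
Proof.
wlog ij : i j / (i < j)%N => [H e|e].
  have [lt|gt|eq] := ltngtP i j.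
  - by have := H _ _ lt e; rewrite (minn_idPl (ltnW lt)) (maxn_idPr (ltnW lt)).
  - have := H j i gt; rewrite (minn_idPl (ltnW gt)) (maxn_idPr (ltnW gt)).
    by apply; rewrite -e diagK.
  by have := diag_neq d (inl i); rewrite e (val_inj eq) eqxx.
have [|q [q1 q2 q3]] := @inner_arc (inl i); first by rewrite e.
rewrite e /= in q1 q2 q3.
have hj := ltn_ord j; case: q q1 q2 q3 => [a|a] /= q1 q2 q3; last by lia.
case db: (d (inl a)) q2 q3 => [b|b] /= q2 q3; last by lia.
by exists a, b; split=> //; lia.
Qed.

Lemma top_cup i j : d (inr i) = inr j ->
  exists a b : 'I_n, [/\ (b = a.+1 :> nat) & d (inr a) = inr b].
Proof.
wlog ij : i j / (j < i)%N => [H e|e].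
  have [gt|lt|eq] := ltngtP i j; last first.
  - by have := diag_neq d (inr i); rewrite e (val_inj eq) eqxx.
  - exact: H lt e.
  by apply: H gt _; rewrite -e diagK.
have [|q [q1 q2 q3]] := @inner_arc (inr i).
  by rewrite e /=; have := ltn_ord i; lia.
rewrite e /= in q1 q2 q3.
case: q q1 q2 q3 => [a|a] /= q1 q2 q3; first by have := ltn_ord a; lia.
case db: (d (inr a)) q2 q3 => [b|b] /= q2 q3; first by have := ltn_ord b; lia.
exists b, a; split; last by rewrite -db diagK.
by have := ltn_ord a; have := ltn_ord b; lia.
Qed.

Lemma no_bottom_arc : (forall i j, d (inl i) != inl j) ->
  exists f : 'I_m -> 'I_n, injective f /\ forall i, d (inl i) = inr (f i).
Proof.
move=> h; have H i : exists j, d (inl i) == inr j.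
  by case e: (d (inl i)) => [j|j]; [have := h i j; rewrite e eqxx | exists j].
exists (fun i => xchoose (H i)); split=> [i j e|i]; last exact: (eqP (xchooseP (H i))).
by have /eqP := xchooseP (H i); rewrite e -(eqP (xchooseP (H j))) => /diag_inj [].
Qed.

Lemma no_top_arc : (forall i j, d (inr i) != inr j) ->
  exists f : 'I_n -> 'I_m, injective f /\ forall i, d (inr i) = inl (f i).
Proof.
move=> h; have H i : exists j, d (inr i) == inl j.
  by case e: (d (inr i)) => [j|j]; [exists j | have := h i j; rewrite e eqxx].
exists (fun i => xchoose (H i)); split=> [i j e|i]; last exact: (eqP (xchooseP (H i))).
by have /eqP := xchooseP (H i); rewrite e -(eqP (xchooseP (H j))) => /diag_inj [].
Qed.

Lemma bottom_arc_lt : (n < m)%N -> exists i j, d (inl i) = inl j.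
Proof.
move=> lt; have [/existsP[i /existsP[j /eqP e]]|h] :=
  boolP [exists i, exists j, d (inl i) == inl j]; first by exists i, j.
have [i j|f [f_inj _]] := no_bottom_arc.
  by apply: contra h => e; apply/existsP; exists i; apply/existsP; exists j.
by have := leq_card _ f_inj; rewrite !card_ord leqNgt lt.
Qed.

Lemma top_arc_lt : (m < n)%N -> exists i j, d (inr i) = inr j.
Proof.
move=> lt; have [/existsP[i /existsP[j /eqP e]]|h] :=
  boolP [exists i, exists j, d (inr i) == inr j]; first by exists i, j.
have [i j|f [f_inj _]] := no_top_arc.
  by apply: contra h => e; apply/existsP; exists i; apply/existsP; exists j.
by have := leq_card _ f_inj; rewrite !card_ord leqNgt lt.
Qed.

End InnerArcs.

Lemma id_diag_subproof n : exists d : diag n n, [forall j, d (inl j) == inr j].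
Proof.
by have [d [dl _]] := id_diag_exists n; exists d; apply/forallP => j; rewrite dl.
Qed.

Definition id_diag n : diag n n := xchoose (id_diag_subproof n).

Lemma id_diagE n p : id_diag n p = swap p.
Proof.
have E j : id_diag n (inl j) = inr j.
  by have /forallP/(_ j)/eqP := xchooseP (id_diag_subproof n).
by case: p => j /=; rewrite ?E // -[in LHS]E diagK.
Qed.

Lemma one_dlt n : one n = dlt (id_diag n).
Proof. by rewrite -oneE; apply: idTL_dlt => j; rewrite id_diagE. Qed.

(** All bottom points open and all top points close, which is the bracket word of the identity. *)
Lemma id_diagP n (d : diag n n) :
  (exists f : 'I_n -> 'I_n, injective f /\ forall i, d (inl i) = inr (f i)) ->
  d = id_diag n.
Proof.
case=> f [f_inj fE]; have [g fK gK] := injF_bij f_inj.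
apply: opener_inj; case=> j; rewrite /opener id_diagE /=.
  by rewrite fE /=; have := ltn_ord j; lia.
rewrite -(gK j) -fE diagK /=; have := ltn_ord (g j); have := ltn_ord j.
have := ltn_ord (f (g j)); lia.
Qed.

Lemma nonid_arcs n (d : diag n n) : d != id_diag n ->
  (exists i j, d (inl i) = inl j) /\ (exists i j, d (inr i) = inr j).
Proof.
move=> nd; split.
  have [/existsP[i /existsP[j /eqP e]]|h] :=
    boolP [exists i, exists j, d (inl i) == inl j]; first by exists i, j.
  case/eqP: nd; apply/id_diagP/no_bottom_arc => i j.
  by apply: contra h => e; apply/existsP; exists i; apply/existsP; exists j.
have [/existsP[i /existsP[j /eqP e]]|h] :=
  boolP [exists i, exists j, d (inr i) == inr j]; first by exists i, j.
have [i j|f [f_inj fE]] := @no_top_arc n n d.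
  by apply: contra h => e; apply/existsP; exists i; apply/existsP; exists j.
have [g fK gK] := injF_bij f_inj.
case/eqP: nd; apply: id_diagP; exists g; split; first exact: can_inj gK.
by move=> i; rewrite -{1}(gK i) -fE diagK.
Qed.

Lemma mul_dlt l m n (x : diag m n) (y : diag l m) : exists (z : diag l n) k,
  dlt x *d dlt y = delta ^+ k *: dlt z /\
  (forall p q, connect (glue x y) (@outer l m n p) (@outer l m n q) -> p != q ->
     z p = q).
Proof.
have [z [_ cz wz]] := comp_dlt_exists x y; exists z, (stack_loops x y); split.
  apply: rep_inj => c e; rewrite rep_mul repZ rep_dlt -wz.
  by apply: eq_bigr => u _; rewrite !rep_dlt.
by move=> p q; rewrite cz eq_sym => /orP[/eqP ->|/eqP //]; rewrite eqxx.
Qed.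

Lemma glue_lower l m n (x : diag m n) (y : diag l m) p :
  connect (glue x y) (inl p) (inl (y p)).
Proof.
by apply/connect1/orP; left; apply/existsP; exists p; rewrite !eqxx.
Qed.

Lemma glue_upper l m n (x : diag m n) (y : diag l m) p :
  connect (glue x y) (@upper l m n p) (@upper l m n (x p)).
Proof.
by apply/connect1/orP; right; apply/existsP; exists p; rewrite !eqxx.
Qed.

Lemma mul_dlt_arcs l m n (x : diag m n) (y : diag l m) : exists (z : diag l n) k,
  [/\ dlt x *d dlt y = delta ^+ k *: dlt z,
      forall i j, y (inl i) = inl j -> z (inl i) = inl j &
      forall i j, x (inr i) = inr j -> z (inr i) = inr j].
Proof.
have [z [k [e h]]] := mul_dlt x y; exists z, k; split=> // i j f; apply: h.
- by rewrite /= -f; exact: glue_lower.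
- by apply/eqP => -[ij]; have := diag_neq y (inl i); rewrite f ij eqxx.
- by have := glue_upper x y (inr i); rewrite f.
- by apply/eqP => -[ij]; have := diag_neq x (inr i); rewrite f ij eqxx.
Qed.

(** The augmentation. It is multiplicative because the other diagrams span an ideal: such a diagram
    has an arc on each of its two sides, and an arc on an outer side survives stacking. *)
Definition aug n (X : TL n n) : QA := X (id_diag n).

Lemma augD n (X Y : TL n n) : aug (X + Y) = aug X + aug Y.
Proof. by rewrite /aug ffunE. Qed.

Lemma augZ n k (X : TL n n) : aug (k *: X) = k * aug X.
Proof. by rewrite /aug TL_scaleE. Qed.

Lemma aug0 n : aug (0 : TL n n) = 0.
Proof. by rewrite /aug ffunE. Qed.

Lemma aug_dlt n (d : diag n n) : aug (dlt d) = (d == id_diag n)%:R.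
Proof. by rewrite /aug ffunE eq_sym. Qed.

Lemma aug_one n : aug (one n) = 1.
Proof. by rewrite one_dlt aug_dlt eqxx. Qed.

Lemma aug_mul n (X Y : TL n n) : aug (X *d Y) = aug X * aug Y.
Proof.
elim/TL_ind: X => [|X X' IH IH'|k x]; first by rewrite mul0l_TL aug0 mul0r.
  by rewrite mulDl_TL !augD IH IH' mulrDl.
rewrite mulZl_TL !augZ -mulrA; congr (_ * _).
elim/TL_ind: Y => [|Y Y' IH IH'|k' y]; first by rewrite mul0r_TL aug0 mulr0.
  by rewrite mulDr_TL !augD IH IH' mulrDr.
rewrite mulZr_TL !augZ mulrCA; congr (_ * _); rewrite !aug_dlt.
have [->|nx] := eqVneq x (id_diag n); first by rewrite -one_dlt mul1_TL mul1r aug_dlt.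
have [z [k2 [-> _ zr]]] := mul_dlt_arcs (x : diag n n) y.
rewrite mul0r augZ aug_dlt; case: eqP => [e|_]; last by rewrite mulr0.
have [_ [i [j exij]]] := nonid_arcs nx.
by have := zr _ _ exij; rewrite e id_diagE.
Qed.

Lemma star_dlt m n (d : diag m n) : exists z : diag n m,
  dual (dlt d) = dlt z /\ forall p, z (swap p) = swap (d p).
Proof.
have [z [e zE]] := star_dlt_exists d; exists z; split=> //.
by apply: rep_inj => c u; rewrite rep_dual !rep_dlt -(amplitude_star A_neq0 _ _ zE).
Qed.

Lemma aug_dual n (X : TL n n) : aug (dual X) = aug X.
Proof.
elim/TL_ind: X => [|X X' IH IH'|k x]; first by rewrite dual0.
  by rewrite dualD !augD IH IH'.
rewrite dualZ !augZ; congr (_ * _); have [z [-> zE]] := star_dlt x.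
rewrite !aug_dlt; congr (_%:R); congr nat_of_bool.
have swK (p : 'I_n + 'I_n) : swap (swap p) = p by case: p.
apply/eqP/eqP => [e|e]; apply: eq_diag => p.
  by have := zE p; rewrite e !id_diagE swK => {2}->; rewrite swK.
by rewrite -[p]swK zE e !id_diagE.
Qed.

(** * Jones-Wenzl idempotents *)

Section OrthogonalProjection.
Variable K : fieldType.
Hypothesis K_real : forall (I : finType) (F : I -> K),
  \sum_i F i ^+ 2 = 0 -> forall i, F i = 0.

(** [w] solves the normal equations. They are solvable because the standard form is anisotropic: the
    row space of [B] meets the kernel of the transpose trivially, so [B *m B^T] has the rank of
    [B]. *)
Lemma orthogonal_projection r N (B : 'M[K]_(r, N)) (v : 'rV[K]_N) :
  exists w : 'rV[K]_r, (v - w *m B) *m B^T = 0.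
Proof.
have aniso (u : 'rV[K]_N) : u *m u^T = 0 -> u = 0.
  move=> /matrixP/(_ 0 0); rewrite !mxE => h; apply/rowP => j; rewrite mxE.
  apply: (K_real (F := fun j => u 0 j)); rewrite -[RHS]h.
  by apply: eq_bigr => k _; rewrite mxE.
have capB : (B :&: kermx B^T)%MS = 0.
  apply/eqP/rowV0P => u; rewrite sub_capmx => /andP[/submxP[w ->] /sub_kermxP e].
  by apply: aniso; rewrite trmx_mul mulmxA e mul0mx.
have rk : \rank (B *m B^T) = \rank B.
  by have := mxrank_mul_ker B B^T; rewrite capB mxrank0 addn0.
have sub : (B^T <= B *m B^T)%MS.
  by rewrite -(mxrank_leqif_sup (submxMl B B^T)) rk mxrank_tr.
have /submxP[w e] := submx_trans (submxMl v B^T) sub.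
by exists w; rewrite mulmxBl -mulmxA -e subrr.
Qed.

End OrthogonalProjection.

Section JonesWenzl.
Variable n : nat.
Implicit Types X Y : TL n n.

Definition dot X Y : QA := \sum_c \sum_e rep X c e * rep Y c e.

Lemma dot_eq0 X : dot X X = 0 -> X = 0.
Proof.
move=> h; apply: rep_inj => c e; rewrite rep0.
apply: (@sum_sqr_eq0 _ (fun p => rep X p.1 p.2) _ (c, e)).
by rewrite -[RHS]h /dot pair_big; apply: eq_bigr => p _.
Qed.

Lemma dotDr X Y Y' : dot X (Y + Y') = dot X Y + dot X Y'.
Proof.
rewrite /dot -big_split; apply: eq_bigr => c _; rewrite -big_split.
by apply: eq_bigr => e _; rewrite repD mulrDr.
Qed.

Lemma dotZr k X Y : dot X (k *: Y) = k * dot X Y.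
Proof.
rewrite /dot mulr_sumr; apply: eq_bigr => c _; rewrite mulr_sumr.
by apply: eq_bigr => e _; rewrite repZ mulrCA.
Qed.

Lemma dot_mull X Y Z : dot (Y *d X) Z = dot X (dual Y *d Z).
Proof.
rewrite /dot; apply: eq_bigr => c _.
transitivity (\sum_e \sum_d rep X c d * rep Y d e * rep Z c e).
  by apply: eq_bigr => e _; rewrite rep_mul mulr_suml.
rewrite exchange_big; apply: eq_bigr => d _; rewrite rep_mul mulr_sumr.
by apply: eq_bigr => e _; rewrite rep_dual_endo [rep Z c e * _]mulrC mulrA.
Qed.

Lemma dot_mulr X Y Z : dot (X *d Y) Z = dot X (Z *d dual Y).
Proof.
rewrite /dot.
transitivity (\sum_c \sum_e \sum_d rep Y c d * rep X d e * rep Z c e).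
  by apply: eq_bigr => c _; apply: eq_bigr => e _; rewrite rep_mul mulr_suml.
rewrite exchange_big [RHS]exchange_big; apply: eq_bigr => e _ /=.
rewrite exchange_big; apply: eq_bigr => d _ /=; rewrite rep_mul mulr_sumr.
by apply: eq_bigr => c _; rewrite rep_dual_endo mulrCA -mulrA.
Qed.

Lemma augmentation_projection :
  exists g, aug g = 0 /\ forall Y, aug Y = 0 -> dot (one n - g) Y = 0.
Proof.
pose C := ({ffun 'I_n -> bool} * {ffun 'I_n -> bool})%type.
pose vec X : 'rV[QA]_#|{: C}| := \row_j rep X (enum_val j).1 (enum_val j).2.
(* Putting 0 in place of the identity diagram keeps all diagrams as index set while the rows span
   only the augmentation ideal. *)
pose bas (d : diag n n) : TL n n := if d == id_diag n then 0 else dlt d.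
pose B : 'M[QA]_(#|{: diag n n}|, #|{: C}|) := \matrix_(i, j) vec (bas (enum_val i)) 0 j.
have [w wE] := orthogonal_projection sum_sqr_eq0 B (vec (one n)).
pose g := \sum_i w 0 i *: bas (enum_val i).
have aug_bas d : aug (bas d) = 0.
  by rewrite /bas; case: eqP => [_|ne]; rewrite ?aug0 // aug_dlt; case: eqP.
have augS (I : finType) (F : I -> TL n n) : (forall i, aug (F i) = 0) ->
    aug (\sum_i F i) = 0.
  by move=> F0; elim/big_rec: _ => [|i X _ IH]; rewrite ?aug0 ?augD ?F0 ?IH ?addr0.
have vdot X Y : dot X Y = \sum_j vec X 0 j * vec Y 0 j.
  rewrite /dot pair_big /= (reindex (enum_val : 'I_#|{: C}| -> C)) /=.
    by apply: eq_bigr => j _; rewrite !mxE.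
  by apply: onW_bij; apply: enum_val_bij.
exists g; split; first by apply: augS => i; rewrite augZ aug_bas mulr0.
have gB : vec (one n - g) = vec (one n) - w *m B.
  apply/rowP => j; rewrite !mxE repD repN; congr (_ - _).
  by rewrite rep_sum; apply: eq_bigr => i _; rewrite repZ !mxE.
have dbas d : dot (one n - g) (bas d) = 0.
  rewrite vdot gB; have /matrixP/(_ 0 (enum_rank d)) := wE; rewrite [RHS]mxE mxE.
  move=> e0; rewrite -[RHS]e0; apply: eq_bigr => j _; congr (_ * _).
  by rewrite [RHS]mxE [RHS]mxE enum_rankK.
move=> Y Y0; rewrite [Y]TL_decomp.
have dot0 : dot (one n - g) 0 = 0 by rewrite -(scale0r 0) dotZr mul0r.
have dS (F : diag n n -> TL n n) : (forall d, dot (one n - g) (F d) = 0) ->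
    dot (one n - g) (\sum_d F d) = 0.
  by move=> F0; elim/big_rec: _ => [//|i X _ IH]; rewrite dotDr F0 IH addr0.
apply: dS => d; rewrite dotZr; have := dbas d; rewrite /bas; case: eqP => [->|_ ->].
  by rewrite -/(aug Y) Y0 mul0r.
by rewrite mulr0.
Qed.

(** Take the component of the identity orthogonal to the augmentation ideal. For [Y] in the ideal,
    the square norm of [Y *d (one n - g)] is the dot product of [one n - g] with
    [dual Y *d (Y *d (one n - g))], again in the ideal, so it vanishes. *)
Lemma jones_wenzl_exists : exists f, [/\ aug f = 1,
  forall Y, Y *d f = aug Y *: f & forall Y, f *d Y = aug Y *: f].
Proof.
have [g [g0 gP]] := augmentation_projection; exists (one n - g).
have augN X : aug (- X) = - aug X by rewrite -scaleN1r augZ mulN1r.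
have ker Y : aug Y = 0 -> Y *d (one n - g) = 0 /\ (one n - g) *d Y = 0.
  move=> Y0; split; apply: dot_eq0.
    by rewrite dot_mull gP // aug_mul aug_dual Y0 mul0r.
  by rewrite dot_mulr gP // aug_mul aug_dual Y0 mulr0.
have ker1 Y : aug (Y - aug Y *: one n) = 0.
  by rewrite augD augN augZ aug_one mulr1 subrr.
split=> [|Y|Y]; first by rewrite augD augN g0 aug_one subr0.
  have [/eqP + _] := ker _ (ker1 Y).
  by rewrite mulBl_TL mulZl_TL mul1_TL subr_eq0 => /eqP.
have [_ /eqP] := ker _ (ker1 Y).
by rewrite mulBr_TL mulZr_TL mul_TL1 subr_eq0 => /eqP.
Qed.

End JonesWenzl.

Lemma juxt_dlt m m' n n' (x : diag m n) (y : diag m' n') :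
  exists z : diag (m + m') (n + n'), [/\ juxt (dlt x) (dlt y) = dlt z,
    forall p, z (left_pt m' n' p) = left_pt m' n' (x p) &
    forall p, z (right_pt m n p) = right_pt m n (y p)].
Proof.
have [z [_ zL zR]] := juxtapose_dlt_exists x y; exists z; split=> //.
by apply: rep_inj => c e; rewrite rep_juxt !rep_dlt (amplitude_juxtapose _ _ _ zL zR).
Qed.

Lemma cap_diag_exists : exists d : diag 2 0, forall j, d (inl j) = inl (rev_ord j).
Proof.
pose M (p : 'I_2 + 'I_0) : 'I_2 + 'I_0 :=
  match p with inl j => inl (rev_ord j) | inr j => inr j end.
have [||p q|d dE] := @diag_exists 2 0 M.
- by case=> [j|[]//] /=; rewrite rev_ordK.
- case=> [[[|[|]] lt]|[]//] //=.
- by have := pos_lt q; have := pos_lt (M p); have := pos_lt (M q); lia.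
by exists d => j; rewrite dE.
Qed.

(** Besides the shape of the hook, this records that up to a power of [delta] it factors as
    [dual U *d U] through fewer points. That drives the induction in [vertex_cancel] and gives
    self-duality. *)
Lemma e_gen_spec n i : (i.+1 < n)%N ->
  exists (e : diag n n) n' (U : TL n n') k,
  [/\ e_gen n i = dlt e,
      forall a : 'I_n, a != i :> nat -> a != i.+1 :> nat -> e (inl a) = inr a,
      forall a b : 'I_n, a = i :> nat -> b = i.+1 :> nat -> e (inl a) = inl b,
      (n' < n)%N & dual U *d U = delta ^+ k *: dlt e].
Proof.
move=> lt; have [k nE] : exists k, n = (i + 2 + k)%N by exists (n - (i + 2))%N; lia.
subst n; have [cp cpE] := cap_diag_exists; have [cu [dcp cuE]] := star_dlt cp.
have [e2 [k2 [e2k e2l e2r]]] := mul_dlt_arcs cu cp.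
have [f [fE fL fR]] := juxt_dlt (id_diag i) e2.
have [e [eE eL eR]] := juxt_dlt f (id_diag k).
have e2lE j : e2 (inl j) = inl (rev_ord j) by apply: e2l; rewrite cpE.
have e2rE j : e2 (inr j) = inr (rev_ord j).
  by apply: e2r; rewrite -[inr j]/(swap (inl j)) cuE cpE.
have e_left (a : 'I_i) : e (inl (lshift k (lshift 2 a))) = inr (lshift k (lshift 2 a)).
  rewrite -[inl _]/(left_pt k k (left_pt 2 2 (inl a))) eL fL id_diagE.
  by [].
have e_midl (a : 'I_2) : e (inl (lshift k (rshift i a)))
    = inl (lshift k (rshift i (rev_ord a))).
  by rewrite -[inl _]/(left_pt k k (right_pt i i (inl a))) eL fR e2lE.
have e_midr (a : 'I_2) : e (inr (lshift k (rshift i a)))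
    = inr (lshift k (rshift i (rev_ord a))).
  by rewrite -[inr _]/(left_pt k k (right_pt i i (inr a))) eL fR e2rE.
have e_right (a : 'I_k) : e (inl (rshift (i + 2) a)) = inr (rshift (i + 2) a).
  by rewrite -[inl _]/(right_pt (i + 2) (i + 2) (inl a)) eR id_diagE.
have e_off (a : 'I_(i + 2 + k)) : a != i :> nat -> a != i.+1 :> nat ->
    e (inl a) = inr a.
  case: (split_ordP a) => [b ->|b -> _ _]; last exact: e_right.
  case: (split_ordP b) => [b' -> _ _|b' ->]; first exact: e_left.
  by case: b' => -[|[|]] //= lt'; rewrite ?addn0 ?addn1 ?eqxx.
have e_on (a b : 'I_(i + 2 + k)) : a = i :> nat -> b = i.+1 :> nat ->
    e (inl a) = inl b /\ e (inr a) = inr b.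
  move=> ai bi; have -> : a = lshift k (rshift i (0 : 'I_2)).
    by apply: val_inj; rewrite /= addn0.
  have -> : b = lshift k (rshift i (rev_ord (0 : 'I_2))).
    by apply: val_inj; rewrite /= bi addn1.
  by rewrite e_midl e_midr.
have ia : (i < i + 2 + k)%N by lia.
pose a0 := Ordinal ia; pose b0 := Ordinal lt.
have [ea eb] := e_on a0 b0 erefl erefl.
exists e, (i + 0 + k)%N, (juxt (juxt (one i) (dlt cp)) (one k)), k2; split=> //.
- apply: the_diagE => d /=; apply/andP/eqP => [[/forallP h1 /forallP h2]|->].
    have dab : d (inl a0) = inl b0 /\ d (inr a0) = inr b0.
      have /forallP/(_ b0)/implyP := h1 a0; rewrite !eqxx => /(_ isT).
      by case/andP=> /eqP -> /eqP ->.
    have doff (a : 'I_(i + 2 + k)) : a != i :> nat -> a != i.+1 :> nat -> d (inl a) = inr a.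
      by move=> na nb; have /implyP := h2 a; rewrite na nb => /(_ isT)/eqP.
    case: dab => da db; apply: eq_diag; case=> a.
      have [ai|na] := eqVneq (val a) i.
        have -> : a = a0 by exact: val_inj.
        by rewrite da ea.
      have [bi|nb] := eqVneq (val a) i.+1; last by rewrite doff // e_off.
      have -> : a = b0 by exact: val_inj.
      by rewrite -{1}da -ea !diagK.
    have [ai|na] := eqVneq (val a) i.
      have -> : a = a0 by exact: val_inj.
      by rewrite db eb.
    have [bi|nb] := eqVneq (val a) i.+1.
      have -> : a = b0 by exact: val_inj.
      by rewrite -{1}db -eb !diagK.
    by rewrite -{1}(doff a) // -(e_off a) // !diagK.
  split.
    apply/forallP => a; apply/forallP => b; apply/implyP => /andP[/eqP ai /eqP bi].
    by have [-> ->] := e_on a b ai bi; rewrite !eqxx.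
  by apply/forallP => a; apply/implyP => /andP[na nb]; rewrite e_off.
- by move=> a b ai bi; case: (e_on a b ai bi).
- by lia.
rewrite !dual_juxt !dual1 dcp -!juxt_mul !mul1_TL e2k juxtZr juxtZl.
by congr (_ *: _); rewrite -eE -fE !one_dlt.
Qed.

Lemma delta_expn_neq0 k : delta ^+ k != 0.
Proof. by rewrite expf_eq0 (negPf delta_neq0) andbF. Qed.

(** A hook placed below a diagram with a cap at the same two points only scales it: the other
    strands pass straight through, and the bottom of the hook restores the cap. *)
Lemma mul_e_gen n m (e : diag n n) (d : diag n m) (a b : 'I_n) :
  (forall c : 'I_n, c != a -> c != b -> e (inl c) = inr c) ->
  e (inl a) = inl b -> d (inl a) = inl b ->
  exists k, dlt d *d dlt e = delta ^+ k *: dlt d.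
Proof.
move=> eoff eab dab; have [z [k [-> h]]] := mul_dlt d e; exists k.
congr (_ *: dlt _).
have up p : p != inl a -> p != inl b ->
    connect (glue d e) (@outer n n m p) (@upper n n m p).
  case: p => c na nb; last exact: connect0.
  by have := glue_lower d e (inl c); rewrite eoff.
have zab : z (inl a) = inl b.
  apply: h; last by rewrite -dab eq_sym diag_neq.
  by have := glue_lower d e (inl a); rewrite eab.
apply: eq_diag => p.
have [->|na] := eqVneq p (inl a); first by rewrite zab dab.
have [->|nb] := eqVneq p (inl b); first by rewrite -{1}zab -dab !diagK.
apply: h; last by rewrite eq_sym diag_neq.
have sg : connect_sym (glue d e).
  apply: sym_connect_sym => u v; apply/idP/idP;
  by case/orP => /existsP[q /andP[/eqP -> /eqP ->]]; apply/orP; [left|right];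
    apply/existsP; [exists (e q)|exists (d q)]; rewrite diagK !eqxx.
apply: connect_trans (up _ na nb) _; apply: connect_trans (glue_upper d e p) _.
rewrite sg; apply: up; apply/eqP => f.
  by case/eqP: nb; rewrite -dab -f diagK.
by case/eqP: na; rewrite -(diagK d (inl a)) dab -f diagK.
Qed.

(** A diagram with a cap is thus, up to an invertible scalar, a multiple of some [e_gen n a], so
    whatever all generators annihilate annihilates the diagram. *)
Lemma bottom_cap_e_gen n m (d : diag n m) (a b : 'I_n) :
  b = a.+1 :> nat -> d (inl a) = inl b ->
  exists k, dlt d *d e_gen n a = delta ^+ k *: dlt d.
Proof.
move=> ba dab; have lt : (a.+1 < n)%N by rewrite -ba.
have [e [n' [U [k [-> eoff eon _ _]]]]] := e_gen_spec lt.
apply: (mul_e_gen _ (eon a b erefl ba) dab) => c ca cb.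
by apply: eoff; rewrite -?ba.
Qed.

Lemma dual_e_gen n i : (i.+1 < n)%N -> dual (e_gen n i) = e_gen n i.
Proof.
move=> lt; have [e [n' [U [k [-> _ _ _ UU]]]]] := e_gen_spec lt.
have := congr1 (@dual n n) UU; rewrite dual_mul dualK UU dualZ.
by move/(scalerI (delta_expn_neq0 k)).
Qed.

Lemma top_cup_e_gen n m (d : diag m n) (a b : 'I_n) :
  b = a.+1 :> nat -> d (inr a) = inr b ->
  exists k, e_gen n a *d dlt d = delta ^+ k *: dlt d.
Proof.
move=> ba dab; have lt : (a.+1 < n)%N by rewrite -ba.
have [z [dz zE]] := star_dlt d.
have zab : z (inl a) = inl b by rewrite -[inl a]/(swap (inr a)) zE dab.
have [k] := bottom_cap_e_gen ba zab; rewrite -dz => h; exists k.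
by have := congr1 (@dual n m) h; rewrite dual_mul dualZ !dualK dual_e_gen.
Qed.

Lemma jones_wenzl_kills_top n m (f : TL n n) (d : diag m n) (i j : 'I_n) :
  (forall a, (a.+1 < n)%N -> f *d e_gen n a = 0) -> d (inr i) = inr j ->
  f *d dlt d = 0.
Proof.
move=> fe /top_cup[a [b [ba dba]]].
have lt : (a.+1 < n)%N by rewrite -ba.
have [k h] := top_cup_e_gen ba dba.
apply: (scalerI (delta_expn_neq0 k)); rewrite scaler0 -mulZr_TL -h -mulA_TL.
by rewrite fe // mul0l_TL.
Qed.

Lemma jones_wenzl_kills_bottom n m (f : TL n n) (d : diag n m) (i j : 'I_n) :
  (forall a, (a.+1 < n)%N -> e_gen n a *d f = 0) -> d (inl i) = inl j ->
  dlt d *d f = 0.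
Proof.
move=> fe /bottom_cap[a [b [ba dab _ _]]].
have lt : (a.+1 < n)%N by rewrite -ba.
have [k h] := bottom_cap_e_gen ba dab.
apply: (scalerI (delta_expn_neq0 k)); rewrite scaler0 -mulZl_TL -h mulA_TL.
by rewrite fe // mul0r_TL.
Qed.

Lemma aug_e_gen n i : (i.+1 < n)%N -> aug (e_gen n i) = 0.
Proof.
move=> lt; have [e [_ [_ [_ [-> _ eon _ _]]]]] := e_gen_spec lt.
rewrite aug_dlt; case: eqP => // e1.
by have := eon (Ordinal (ltnW lt)) (Ordinal lt) erefl erefl; rewrite e1 id_diagE.
Qed.

(** Every diagram other than the identity has a cap and a cup and is killed on either side.
    Idempotence then forces [aug f = 1]. *)
Lemma jones_wenzl_absorb n (f : TL n n) : is_jones_wenzl f ->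
  [/\ aug f = 1, forall Y, Y *d f = aug Y *: f & forall Y, f *d Y = aug Y *: f].
Proof.
case=> f0; rewrite mulE => ff fe.
have kl Y : Y *d f = aug Y *: f.
  rewrite {1}[Y]TL_decomp mul_suml_TL (bigD1 (id_diag n)) //= big1 => [|d nd].
    by rewrite addr0 mulZl_TL -one_dlt mul1_TL.
  have [[i [j dij]] _] := nonid_arcs nd; rewrite mulZl_TL.
  rewrite (jones_wenzl_kills_bottom _ dij) ?scaler0 // => a lt.
  by have [] := fe a lt; rewrite !mulE.
have kr Y : f *d Y = aug Y *: f.
  rewrite {1}[Y]TL_decomp mul_sumr_TL (bigD1 (id_diag n)) //= big1 => [|d nd].
    by rewrite addr0 mulZr_TL -one_dlt mul_TL1.
  have [_ [i [j dij]]] := nonid_arcs nd; rewrite mulZr_TL.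
  rewrite (jones_wenzl_kills_top _ dij) ?scaler0 // => a lt.
  by have [] := fe a lt; rewrite !mulE.
split=> //; apply/eqP; rewrite -subr_eq0; apply/negPn/negP => ne; apply: f0.
apply: (scalerI ne); rewrite scaler0 scalerBl scale1r -kl ff subrr //.
Qed.

(** Existence makes the choice by [xget] meaningful; the product [f *d jw n], evaluated by
    absorption on either side, equals both factors. *)
Lemma jones_wenzl_unique n (f : TL n n) :
  aug f = 1 -> (forall Y, f *d Y = aug Y *: f) -> f = jw n.
Proof.
move=> f1 fK; have [g [g1 gl gr]] := jones_wenzl_exists n.
have gJ : is_jones_wenzl g.
  split; first by move=> g0; move: g1; rewrite g0 aug0 => /esym/eqP; rewrite oner_eq0.
    by rewrite mulE gl g1 scale1r.
  by move=> j lt; rewrite !mulE gl gr aug_e_gen // scale0r.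
have jwP : is_jones_wenzl (jw n) by rewrite /jw; apply: (classical_sets.xgetPex 0); exists g.
have [j1 jl jr] := jones_wenzl_absorb jwP.
by have := fK (jw n); rewrite j1 scale1r jl f1 scale1r.
Qed.

Definition jz n : TL n n := locked jw n.

Lemma jzE n : jw n = jz n. Proof. by rewrite /jz -lock. Qed.

Section JW.
Variable n : nat.

Lemma jz_spec : [/\ aug (jz n) = 1, forall Y, Y *d jz n = aug Y *: jz n
  & forall Y, jz n *d Y = aug Y *: jz n].
Proof.
have [f [f1 fl fr]] := jones_wenzl_exists n.
by rewrite -jzE -(jones_wenzl_unique f1 fr).
Qed.

Lemma aug_jz : aug (jz n) = 1. Proof. by case: jz_spec. Qed.
Lemma mul_jz Y : Y *d jz n = aug Y *: jz n. Proof. by case: jz_spec. Qed.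
Lemma jz_mul Y : jz n *d Y = aug Y *: jz n. Proof. by case: jz_spec. Qed.
Lemma jz_idem : jz n *d jz n = jz n. Proof. by rewrite mul_jz aug_jz scale1r. Qed.

Lemma jz_neq0 : jz n <> 0.
Proof. by move=> e; have := aug_jz; rewrite e aug0 => /esym/eqP; rewrite oner_eq0. Qed.

Lemma jz_uniq f : aug f = 1 -> (forall Y, f *d Y = aug Y *: f) -> f = jz n.
Proof. by move=> f1 fr; rewrite (jones_wenzl_unique f1 fr) jzE. Qed.

Lemma dual_jz : dual (jz n) = jz n.
Proof.
apply: jz_uniq => [|Y]; first by rewrite aug_dual aug_jz.
by rewrite -[Y in LHS]dualK -dual_mul mul_jz dualZ aug_dual.
Qed.

Lemma aug_turn (X : TL n n) : aug (turn X) = aug X.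
Proof.
elim/TL_ind: X => [|X X' IH IH'|k x].
- by rewrite -(scale0r 0) turnZ !augZ !mul0r.
- by rewrite turnD !augD IH IH'.
rewrite turnZ !augZ; congr (_ * _); have [z zE] := half_turn_exists x.
have -> : turn (dlt x) = dlt z.
  by apply: rep_inj => c e; rewrite rep_turn !rep_dlt (amplitude_half_turn _ _ A_neq0 zE).
have hs (p : 'I_n + 'I_n) : half_turn (swap p) = swap (half_turn p) by case: p.
rewrite !aug_dlt; congr (_%:R); congr nat_of_bool.
apply/eqP/eqP => e; apply: eq_diag => p.
  apply: (inv_inj (@half_turnK n)).
  by rewrite -zE e !id_diagE hs.
by rewrite -[p]half_turnK zE e !id_diagE hs.
Qed.

Lemma turn_jz : turn (jz n) = jz n.
Proof.
apply: jz_uniq => [|Y]; first by rewrite aug_turn aug_jz.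
by rewrite -[Y in LHS]turnK -turn_mul mul_jz turnZ aug_turn.
Qed.

Lemma jz_e_gen i : (i.+1 < n)%N -> jz n *d e_gen n i = 0.
Proof. by move=> lt; rewrite jz_mul aug_e_gen // scale0r. Qed.

Lemma e_gen_jz i : (i.+1 < n)%N -> e_gen n i *d jz n = 0.
Proof. by move=> lt; rewrite mul_jz aug_e_gen // scale0r. Qed.

Lemma jz_top_arc m (d : diag m n) i j : d (inr i) = inr j -> jz n *d dlt d = 0.
Proof. by apply: jones_wenzl_kills_top => a; exact: jz_e_gen. Qed.

Lemma jz_bottom_arc m (d : diag n m) i j : d (inl i) = inl j -> dlt d *d jz n = 0.
Proof. by apply: jones_wenzl_kills_bottom => a; exact: e_gen_jz. Qed.

End JW.

(** By pigeonhole every diagram has an arc inside the larger of the two sides, and the projector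
    there kills it. *)
Lemma jz_neq_hom m n (X : TL m n) : m != n -> jz n *d X *d jz m = 0.
Proof.
move=> mn; rewrite [X]TL_decomp mul_sumr_TL mul_suml_TL big1 // => d _.
rewrite mulZr_TL mulZl_TL.
have [lt|gt|eq] := ltngtP m n; last by rewrite eq eqxx in mn.
  by have [i [j e]] := top_arc_lt d lt; rewrite (jz_top_arc e) mul0l_TL scaler0.
have [i [j e]] := bottom_arc_lt d gt.
by rewrite mulA_TL (jz_bottom_arc e) mul0r_TL scaler0.
Qed.

Lemma jz_endo n (X : TL n n) : jz n *d X *d jz n = aug X *: jz n.
Proof. by rewrite jz_mul mulZl_TL jz_idem. Qed.

(** As [jz n] is a symmetric idempotent and [turn_wt] is minus a square, the trace is [(-1) ^+ n]
    times a sum of squares, with every matrix entry occurring up to a nonzero factor. *)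
Lemma trace_jz_neq0 n : trace (jz n) != 0.
Proof.
apply/eqP => t0; apply: (@jz_neq0 n); apply: rep_inj => c e; rewrite rep0.
(* A square root of [- turn_wt A]. *)
pose v (b : bool) : QA := if b then A^-1 else A.
have v0 b : v b != 0 by case: b; rewrite /v ?invr_eq0 A_neq0.
have tv (u : {ffun 'I_n -> bool}) : color_char (turn_wt A) u
    = (-1) ^+ n * color_char v u ^+ 2.
  have -> : (-1) ^+ n = \prod_(j < n) (-1) :> QA by rewrite prodr_const card_ord.
  rewrite /color_char -prodrXl -big_split.
  by apply: eq_bigr => j _; rewrite /turn_wt /v; case: (u j); rewrite /= ?exprVn mulN1r.
have h : (-1) ^+ n * \sum_(p : {ffun 'I_n -> bool} * {ffun 'I_n -> bool})
    (color_char v p.1 * rep (jz n) p.2 p.1) ^+ 2 = 0.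
  rewrite -[RHS]t0 trace_rep -(pair_big xpredT xpredT
    (fun u w => (color_char v u * rep (jz n) w u) ^+ 2)) /= mulr_sumr.
  apply: eq_bigr => u _; rewrite tv -mulrA; congr (_ * _).
  rewrite -[jz n in RHS]jz_idem rep_mul mulr_sumr; apply: eq_bigr => w _.
  have -> : rep (jz n) u w = rep (jz n) w u by rewrite -{1}dual_jz rep_dual_endo.
  by rewrite exprMn -expr2.
move/eqP: h; rewrite mulf_eq0 signr_eq0 /= => /eqP h.
have /eqP := sum_sqr_eq0 h (e, c).
by rewrite /= mulf_eq0 (negPf (color_char_neq0 _ v0)) => /eqP.
Qed.

(** The sign relating [dual] to the transpose depends only on [m] and [n]. Hence the diagonal
    entries of [X *d dual X] are, up to one global sign, sums of squares. *)
Lemma rep_parity m n (X : TL m n) c e : rep X c e != 0 ->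
  parity c * parity e = (-1) ^+ (m + (m + n)./2).
Proof.
have [->|/eqP ne] := eqVneq (parity c * parity e) ((-1) ^+ (m + (m + n)./2)) => //.
case/eqP; rewrite /rep big1 // => d _.
have [->|] := eqVneq (amp d c e) 0; first by rewrite mulr0.
rewrite mulf_eq0 => /norP[_ w]; case: ne.
have := wt_charge (@pos_inj m n) A_neq0 (parity_wt QA) (diag_matching d) w.
rewrite (eq_bigl xpredT) => [|p]; last by rewrite in_setT.
rewrite big_sumType /= cardsT card_sum !card_ord mulr1 exprD => <-.
rewrite mulrA; congr (_ * _).
have -> : (-1) ^+ m = \prod_(j < m) (-1) :> QA by rewrite prodr_const card_ord.
rewrite -big_split; apply: eq_bigr => j _.
by case: (c j); rewrite /= ?mulrNN ?mulr1.
Qed.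

Lemma mul_dual_eq0 m n (X : TL m n) : X *d dual X = 0 -> X = 0.
Proof.
move=> h; apply: rep_inj => c e; rewrite rep0.
apply: (@sum_sqr_eq0 _ (fun c => rep X c e)).
apply: (@mulfI _ ((-1) ^+ (m + (m + n)./2))); first by rewrite signr_eq0.
rewrite mulr0 -[RHS](rep0 e e) -[in RHS]h rep_mul mulr_sumr.
apply: eq_bigr => d _; rewrite rep_dual.
have [->|nz] := eqVneq (rep X d e) 0; first by rewrite !mulr0 expr0n mulr0.
by rewrite (rep_parity nz) -mulrA expr2.
Qed.

(** * Trivalent vertices *)

Section Separated.
Variables (x y z : nat).
Implicit Types d : diag (x + y) z.

(** The rectangle is viewed as a triangle whose three sides are the two bottom blocks and the
    top. *)
Definition side (p : 'I_(x + y) + 'I_z) : nat :=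
  match p with inl u => if (u < x)%N then 0%N else 1%N | inr _ => 2%N end.

Definition separated d := forall p, side (d p) != side p.

Lemma sum_interval N a b : (b <= N)%N -> (\sum_(u < N) (a <= u < b)%N = b - a)%N.
Proof.
elim: N b => [|N IH] b; first by rewrite big_ord0; lia.
rewrite leq_eqVlt big_ord_recr /= => /orP[/eqP ->|lt]; last first.
  by rewrite IH //; case: (ltnP N b) => h; rewrite ?andbF ?addn0 //; lia.
rewrite (eq_bigr (fun u : 'I_N => (a <= u < N : nat))) => [|u _]; last first.
  by have := ltn_ord u; case: (ltnP u N); case: (ltnP u N.+1); lia.
by rewrite IH // ltnSn andbT; case: (leqP a N); lia.
Qed.

(** The bracket word is forced: all of [x] opens, the top closes, and in [y] the closers, matched
    into [x], precede the openers, matched to the top. Counting both kinds of bracket fixes the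
    number of closers in [y] and yields admissibility. *)
Lemma separated_openers d : separated d ->
  admissible x y z /\
  forall p, opener (@pos _ _) d p
    = match p with inl u => (u < x)%N || (x + (x + y - z)./2 <= u)%N | inr _ => false end.
Proof.
move=> sd; have dN := @diag_nested _ _ d.
have op_top j : opener (@pos _ _) d (inr j) = false.
  have := sd (inr j); rewrite /opener; case: (d (inr j)) => //= u _.
  by have := ltn_ord u; lia.
have op_x (u : 'I_(x + y)) : (u < x)%N -> opener (@pos _ _) d (inl u).
  move=> ux; have := sd (inl u); rewrite /opener /= ux.
  case: (d (inl u)) => [v|v] /=; last by have := ltn_ord u; lia.
  by case: ltnP => //; lia.
have cl_y (u : 'I_(x + y)) : (x <= u)%N -> ~~ opener (@pos _ _) d (inl u) ->
    exists v : 'I_(x + y), d (inl u) = inl v /\ (v < x)%N.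
  move=> ux; have := sd (inl u); rewrite /opener /= ltnNge ux /=.
  case: (d (inl u)) => [v|v] /=; last by have := ltn_ord u; lia.
  by case: (ltnP v x) => // vx _ _; exists v.
have prefix (u u' : 'I_(x + y)) : (x <= u')%N -> (u' < u)%N ->
    ~~ opener (@pos _ _) d (inl u) -> ~~ opener (@pos _ _) d (inl u').
  move=> xu' u'u cu; have [v [dv vx]] := cl_y u (leq_trans xu' (ltnW u'u)) cu.
  have := dN (inl v) (inl u') (in_setT _) (in_setT _).
  have -> : d (inl v) = inl u by rewrite -dv diagK.
  rewrite /= u'u (leq_trans vx xu') => /(_ isT).
  have := sd (inl u'); rewrite /opener /= ltnNge xu' /=.
  case: (d (inl u')) => [w|w] /=; last by have := ltn_ord u; lia.
  by case: (ltnP w x) => //; lia.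
have [t [xt tN tP]] : exists t, [/\ (x <= t)%N, (t <= x + y)%N &
    forall u : 'I_(x + y), opener (@pos _ _) d (inl u) = (u < x)%N || (t <= u)%N].
  pose Q k := (x <= k)%N && [forall u : 'I_(x + y),
    (k <= u)%N ==> opener (@pos _ _) d (inl u)].
  have exQ : exists k, Q k.
    exists (x + y)%N; rewrite /Q leq_addr; apply/forallP => u.
    by rewrite leqNgt ltn_ord.
  case: (ex_minnP exQ) => t /andP[xt /forallP tP] tmin; exists t; split=> //.
    by apply: tmin; rewrite /Q leq_addr; apply/forallP => u; rewrite leqNgt ltn_ord.
  move=> u; case: (ltnP u x) => [/op_x //|xu] /=.
  case: (leqP t u) => [tu|ut]; first by have := tP u; rewrite tu.
  apply/negbTE/negP => ou; have := tmin u; rewrite leqNgt ut; apply/implyP.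
  rewrite /Q xu /=; apply/forallP => u'; apply/implyP.
  rewrite leq_eqVlt => /orP[/eqP/val_inj <- //|uu'].
  by apply: contraLR ou; apply: prefix.
have eqc : ((\sum_p opener (@pos _ _) d p) = \sum_p ~~ opener (@pos _ _) d p)%N.
  have T (F : _ -> nat) : (\sum_p F p = \sum_(p in [set: 'I_(x + y) + 'I_z]) F p)%N.
    by apply: eq_bigl => p; rewrite in_setT.
  rewrite !T !(big_arcs (@pos_inj _ _) _ _ (diag_matching d)).
  by apply: eq_bigr => p /andP[_ o]; rewrite opener_diag o.
have s1 : (\sum_p opener (@pos _ _) d p
    = \sum_(u < x + y) opener (@pos _ _) d (inl u))%N.
  by rewrite big_sumType /= [X in (_ + X)%N]big1 ?addn0 // => j _; rewrite op_top.
have s2 : (\sum_p ~~ opener (@pos _ _) d p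
    = \sum_(u < x + y) ~~ opener (@pos _ _) d (inl u) + z)%N.
  rewrite big_sumType /=; congr addn; rewrite -[RHS]card_ord -[RHS]sum1_card.
  by apply: eq_bigr => j _; rewrite op_top.
move: eqc; rewrite s1 s2.
have cyc : (\sum_(u < x + y) ~~ opener (@pos _ _) d (inl u) = t - x)%N.
  rewrite -(sum_interval x tN); apply: eq_bigr => u _; rewrite tP negb_or.
  by rewrite -leqNgt -ltnNge.
have cyo : (\sum_(u < x + y) opener (@pos _ _) d (inl u) + (t - x) = x + y)%N.
  rewrite -cyc -big_split /= -[RHS]card_ord -[RHS]sum1_card; apply: eq_bigr => u _.
  by case: opener.
rewrite cyc => eqc.
(* Each closer in [y] has its partner in [x], so there are at most [x] of them; the count runs arc
   by arc. *)
have tx : (t - x <= x)%N.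
  have sx : (\sum_(u < x + y) (0 <= u < x)%N = x)%N.
    by rewrite sum_interval ?subn0 ?leq_addr.
  rewrite -cyc -[leqRHS]sx.
  pose F (p : 'I_(x + y) + 'I_z) : nat :=
    match p with inl u => ~~ opener (@pos _ _) d (inl u) | _ => 0%N end.
  pose F' (p : 'I_(x + y) + 'I_z) : nat :=
    match p with inl u => (0 <= u < x)%N | _ => 0%N end.
  have E (H : _ -> nat) (H0 : forall j, H (inr j) = 0%N) :
      (\sum_(u < x + y) H (inl u) = \sum_(p in [set: 'I_(x + y) + 'I_z]) H p)%N.
    rewrite [RHS](eq_bigl xpredT) => [|p]; last by rewrite in_setT.
    by rewrite big_sumType /= [X in _ = (_ + X)%N]big1 ?addn0.
  rewrite (E F) // (E F') // !(big_arcs (@pos_inj _ _) _ _ (diag_matching d)) /=.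
  apply: leq_sum => p /andP[_ op].
  have Fp : F p = 0%N by move: op; case: (p) => //= u ->.
  rewrite Fp add0n; case e: (d p) => [u|j] //.
  have cu : ~~ opener (@pos _ _) d (inl u) by rewrite -e opener_diag op.
  rewrite /F cu; have xu : (x <= u)%N by rewrite leqNgt; apply: contra cu => /op_x.
  have [v [dv vx]] := cl_y u xu cu.
  by have -> : p = inl v; [rewrite -dv -e diagK | rewrite /F' vx].
have zE : (x + y - z = (t - x).*2)%N by lia.
have tE : (t = x + (x + y - z)./2)%N by rewrite zE doubleK; lia.
split; last by case=> [u|j]; rewrite ?op_top ?tP -?tE.
rewrite /admissible; apply/and4P; split; lia.
Qed.

Lemma separated_unique d d' : separated d -> separated d' -> d = d'.
Proof.
move=> /separated_openers[_ h] /separated_openers[_ h'].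
by apply: opener_inj => p; rewrite h h'.
Qed.

End Separated.

Lemma diag_of_pos m n (g : nat -> nat) :
  (forall k, (k < m + n)%N -> [/\ (g k < m + n)%N, g (g k) = k & g k != k]) ->
  (forall k l, (k < m + n)%N -> (l < m + n)%N ->
    ~~ [&& k < l, l < g k & g k < g l]%N) ->
  exists d : diag m n, forall p, pos (d p) = g (pos p).
Proof.
move=> gP gnc; pose M (p : 'I_m + 'I_n) := odflt p [pick q | @pos m n q == g (pos p)].
have ME p : pos (M p) = g (pos p).
  rewrite /M; case: pickP => [q /eqP //|none].
  have [lt _ _] := gP _ (pos_lt p); have [q e] := pos_onto lt.
  by have := none q; rewrite e eqxx.
have [p|p|p q|d dE] := @diag_exists m n M.
- by apply: (@pos_inj m n); rewrite !ME; case: (gP _ (pos_lt p)).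
- by rewrite -(inj_eq (@pos_inj m n)) ME; case: (gP _ (pos_lt p)).
- by rewrite !ME; apply: gnc; exact: pos_lt.
by exists d => p; rewrite dE ME.
Qed.

Lemma vertex_diag_dlt x y z : admissible x y z ->
  exists d : diag (x + y) z, vertex_diag x y z = dlt d /\ separated d.
Proof.
case/and4P => par l1 l2 l3; set p := ((x + y - z)./2)%N.
have pE : (x + y - z = p.*2)%N.
  have ev : ~~ odd (x + y - z) by rewrite oddB // -oddD.
  by rewrite -[LHS]odd_double_half (negPf ev).
(* The partner map on boundary positions: the first [x - p] points go straight up, the next [p.*2]
   form nested arcs around the border of the two blocks, and the rest of [y] goes up shifted left by
   [p.*2]. The last two lines invert this on the top, read right to left. *)
pose g k := if (k < x - p)%N then (x + y + z - k.+1)%N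
  else if (k < x + p)%N then (x.*2 - k.+1)%N
  else if (k < x + y)%N then (x + y + z + p.*2 - k.+1)%N
  else if (x + y + z - k.+1 < x - p)%N then (x + y + z - k.+1)%N
  else (x + y + z + p.*2 - k.+1)%N.
have gE k : (k < x + y + z)%N ->
  (k < x - p)%N /\ g k = (x + y + z - k.+1)%N \/
  (x - p <= k < x + p)%N /\ g k = (x.*2 - k.+1)%N \/
  (x + p <= k < x + y)%N /\ g k = (x + y + z + p.*2 - k.+1)%N \/
  (x + y <= k)%N /\ (x + y + z - k.+1 < x - p)%N /\ g k = (x + y + z - k.+1)%N \/
  (x + y <= k)%N /\ (x - p <= x + y + z - k.+1)%N /\
    g k = (x + y + z + p.*2 - k.+1)%N.
  move=> lt; rewrite /g; case: (ltnP k (x - p)) => h1; first by left.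
  case: (ltnP k (x + p)) => h2; first by right; left.
  case: (ltnP k (x + y)) => h3; first by right; right; left.
  right; right; right; case: ltnP => h4; [by left | by right].
have [px py] : (p <= x)%N /\ (p <= y)%N by lia.
have gk k : (k < x + y + z)%N -> (g k < x + y + z)%N.
  by move=> lt; have := gE k lt; clear -lt px py pE l3; lia.
have [k lt|k l ltk ltl|d dE] := @diag_of_pos (x + y) z g.
- have h1 := gE k lt; have h2 := gE (g k) (gk k lt); split; first exact: gk.
    by clear -lt px py pE l3 h1 h2; lia.
  by clear -lt px py pE l3 h1; lia.
- have h1 := gE k ltk; have h2 := gE l ltl.
  by clear -ltk ltl px py pE l3 h1 h2; lia.
have low (u : 'I_(x + y)) : (x - p <= u < x + p)%N ->
    exists v : 'I_(x + y), d (inl u) = inl v /\ (u + v).+1 = x.*2.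
  move=> h; have := dE (inl u); have := gE u; have := ltn_ord u => /=.
  case: (d (inl u)) => [v|v] /= hu h1 h2; last by clear -h hu h1 h2 px py; lia.
  by exists v; split=> //; clear -h hu h1 h2 px py; lia.
have high (u : 'I_(x + y)) : ~~ (x - p <= u < x + p)%N ->
    exists v : 'I_z, d (inl u) = inr v /\
      v = (if (u < x - p)%N then nat_of_ord u else (u - p.*2)%N) :> nat.
  move=> h; have := dE (inl u); have := gE u; have := ltn_ord u => /=.
  case: (d (inl u)) => [v|v] /= hu h1 h2.
    by have := ltn_ord v; clear -h hu h1 h2 px py pE l3; lia.
  exists v; split=> //; have := ltn_ord v.
  case: (ltnP u (x - p)) => h3 hv; clear -h h3 hv hu h1 h2 px py pE l3; lia.
pose Q (d' : diag (x + y) z) := [forall u : 'I_(x + y),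
    if (x - p <= u < x + p)%N
    then [exists v, (d' (inl u) == inl v) && ((u + v).+1 == x.*2)%N]
    else [exists v : 'I_z, (d' (inl u) == inr v)
            && (v == (if (u < x - p)%N then nat_of_ord u else (u - p.*2)%N) :> nat)]].
have Qd : Q d.
  apply/forallP => u; case: ifP => h; apply/existsP.
    by have [v [e1 e2]] := low u h; exists v; rewrite e1 e2 !eqxx.
  by have [v [e1 e2]] := high u (negbT h); exists v; rewrite e1 e2 !eqxx.
have Qsep d' : Q d' -> separated d'.
  move=> /forallP q.
  have lowq (u : 'I_(x + y)) : side (d' (inl u)) != side (inl u : _ + 'I_z).
    have := q u; case: ifP => h /existsP[v /andP[/eqP -> /eqP e]] /=.
      by case: (ltnP v x); case: (ltnP u x) => //; clear -h e; lia.
    by case: ltnP.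
  case=> [u|j]; first exact: lowq.
  have hj := ltn_ord j.
  pose k := (if (j < x - p)%N then nat_of_ord j else j + p.*2)%N.
  have kl : (k < x + y)%N by rewrite /k; case: ifP => _; clear -hj pE l3 px py; lia.
  have := q (Ordinal kl); rewrite /=.
  have -> : (x - p <= k < x + p)%N = false.
    by rewrite /k; case: (ltnP j (x - p)); clear -hj pE l3 px py; lia.
  case/existsP=> v /andP[/eqP e1 /eqP e2].
  have -> : j = v.
    apply: val_inj; rewrite /= e2 /k; case: (ltnP j (x - p)) => h; first by rewrite h.
    by case: ltnP => h5; clear -h h5; lia.
  by rewrite -e1 diagK /=; case: ltnP.
exists d; split; last exact: Qsep.
apply: the_diagE => d' /=; rewrite -/(Q d'); apply/idP/eqP => [q|-> //].
by apply: separated_unique; exact: Qsep.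
Qed.

Definition vtx x y z : TL (x + y) z := locked vertex x y z.
Definition ff x y : TL (x + y) (x + y) := juxt (jz x) (jz y).

Lemma vtxE x y z : vertex x y z = vtx x y z.
Proof. by rewrite /vtx -lock. Qed.

Lemma vtx_dlt x y z : admissible x y z ->
  exists2 d : diag (x + y) z, separated d & vtx x y z = jz z *d dlt d *d ff x y.
Proof.
case/vertex_diag_dlt => d [e sd]; exists d => //.
by rewrite -vtxE /vertex e !mulE juxtE !jzE.
Qed.

Definition hook_spec n i (e : diag n n) :=
  (forall a : 'I_n, a != i :> nat -> a != i.+1 :> nat -> e (inl a) = inr a) /\
  (forall a b : 'I_n, a = i :> nat -> b = i.+1 :> nat -> e (inl a) = inl b).

(** By elimination the two top points over the cap can only be joined to each other. This identifies
    the generators acting inside one block of a juxtaposition. *)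
Lemma hook_unique n i (e e' : diag n n) : (i.+1 < n)%N ->
  hook_spec i e -> hook_spec i e' -> e = e'.
Proof.
move=> lt; pose a := Ordinal (ltnW lt); pose b := Ordinal lt.
have H (f : diag n n) : hook_spec i f -> [/\ f (inl a) = inl b, f (inr a) = inr b
    & forall c : 'I_n, c != a -> c != b -> f (inl c) = inr c].
  case=> off on; have offc (c : 'I_n) : c != a -> c != b -> f (inl c) = inr c.
    by move=> ca cb; apply: off.
  have fab := on a b erefl erefl; split=> //.
  case E: (f (inr a)) => [c|c].
    have [ca|ca] := eqVneq c a.
      by move: E; rewrite ca -(diagK f (inl a)) fab => /diag_inj.
    have [cb|cb] := eqVneq c b.
      by move: E; rewrite cb -fab => /diag_inj.
    by move: E; rewrite -(diagK f (inl c)) offc // => /diag_inj [ac]; rewrite ac eqxx in ca.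
  have [ca|ca] := eqVneq c a; first by have := diag_neq f (inr a); rewrite E ca eqxx.
  have [->//|cb] := eqVneq c b.
  by move: E; rewrite -(offc c) // => /diag_inj.
move=> /H[e1 e2 e3] /H[e1' e2' e3']; apply: eq_diag; case=> c.
  have [->|ca] := eqVneq c a; first by rewrite e1 e1'.
  have [->|cb] := eqVneq c b; last by rewrite e3 // e3'.
  by rewrite -{1}e1 -e1' !diagK.
have [->|ca] := eqVneq c a; first by rewrite e2 e2'.
have [->|cb] := eqVneq c b; first by rewrite -{1}e2 -e2' !diagK.
by rewrite -{1}(e3 c) // -(e3' c) // !diagK.
Qed.

Lemma e_gen_hook n i : (i.+1 < n)%N ->
  exists2 e : diag n n, e_gen n i = dlt e & hook_spec i e.
Proof. by move=> /e_gen_spec[e [_ [_ [_ [-> eo en _ _]]]]]; exists e. Qed.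

Lemma e_gen_juxtl x y i : (i.+1 < x)%N ->
  e_gen (x + y) i = juxt (e_gen x i) (one y).
Proof.
move=> lt; have lt' : (i.+1 < x + y)%N by apply: ltn_addr.
have [e -> [eo en]] := e_gen_hook lt; have [e' -> e's] := e_gen_hook lt'.
rewrite one_dlt; have [z [-> zL zR]] := juxt_dlt e (id_diag y); congr dlt.
apply: hook_unique lt' e's _; split=> [a|a b].
  case: (split_ordP a) => c ->.
    move=> ca cb; rewrite -[inl _]/(left_pt y y (inl c)) zL eo //.
  by move=> _ _; rewrite -[inl _]/(right_pt x x (inl c)) zR id_diagE.
case: (split_ordP a) => c ->; last by move=> /= h; have := ltn_ord c; lia.
case: (split_ordP b) => c' ->; last by move=> /= _ h; have := ltn_ord c'; lia.
by move=> ca cb; rewrite -[inl _]/(left_pt y y (inl c)) zL (en c c').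
Qed.

Lemma e_gen_juxtr x y i : (i.+1 < y)%N ->
  e_gen (x + y) (x + i) = juxt (one x) (e_gen y i).
Proof.
move=> lt; have lt' : ((x + i).+1 < x + y)%N by rewrite -addnS ltn_add2l.
have [e -> [eo en]] := e_gen_hook lt; have [e' -> e's] := e_gen_hook lt'.
rewrite one_dlt; have [z [-> zL zR]] := juxt_dlt (id_diag x) e; congr dlt.
apply: hook_unique lt' e's _; split=> [a|a b].
  case: (split_ordP a) => c ->.
    by move=> _ _; rewrite -[inl _]/(left_pt y y (inl c)) zL id_diagE.
  rewrite /= -addnS !eqn_add2l => ca cb.
  by rewrite -[inl _]/(right_pt x x (inl c)) zR eo.
case: (split_ordP a) => c ->; first by move=> /= h; have := ltn_ord c; lia.
case: (split_ordP b) => c' ->; first by move=> /= _ h; have := ltn_ord c'; lia.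
rewrite /= -addnS => /addnI ca /addnI cb.
by rewrite -[inl _]/(right_pt x x (inl c)) zR (en c c').
Qed.

Section Vertex.
Variables (x y : nat).

Lemma ff_idem : ff x y *d ff x y = ff x y.
Proof. by rewrite /ff -juxt_mul !jz_idem. Qed.

Lemma dual_ff : dual (ff x y) = ff x y.
Proof. by rewrite /ff dual_juxt !dual_jz. Qed.

(** With no arc on the top, the offending arc lies inside one bottom block. By the bounds in
    [bottom_cap] an innermost cap under it stays in the block, where the projector kills it. *)
Lemma mul_ff_arc z (d : diag (x + y) z) : ~ separated d ->
  (forall i j, d (inr i) <> inr j) -> dlt d *d ff x y = 0.
Proof.
move=> nsep ntop.
have [p sp] : exists p, side (d p) == side p.
  apply/existsP; case: (boolP [exists p, side (d p) == side p]) => // /existsPn h.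
  by case: nsep => p; exact: h.
case: p sp => [u|i] /=; last first.
  by case e: (d (inr i)) => [v|j] /=; [case: ltnP | case: (ntop _ _ e)].
case e: (d (inl u)) => [v|j] /=; last by case: ltnP.
have [a [b [ba dab lo hi]]] := bottom_cap e; have [k h] := bottom_cap_e_gen ba dab.
have kill : e_gen (x + y) a *d ff x y = 0 -> dlt d *d ff x y = 0.
  move=> e0; apply: (scalerI (delta_expn_neq0 k)).
  by rewrite scaler0 -mulZl_TL -h mulA_TL e0 mul0r_TL.
case: (ltnP v x) => vx; case: (ltnP u x) => ux // _; apply: kill.
  have ax : (a.+1 < x)%N by rewrite -ba; move: hi; rewrite /maxn; case: ltnP; lia.
  by rewrite e_gen_juxtl // /ff -juxt_mul e_gen_jz // juxt0l.
have xa : (x <= a)%N by move: lo; rewrite /minn; case: ltnP; lia.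
have ay : ((a - x).+1 < y)%N by have := ltn_ord b; lia.
by rewrite -(subnKC xa) e_gen_juxtr // /ff -juxt_mul e_gen_jz // juxt0r.
Qed.

Lemma hom_vertex z (X : TL (x + y) z) : jz z *d X *d ff x y != 0 ->
  admissible x y z /\ exists k, jz z *d X *d ff x y = k *: vtx x y z.
Proof.
have dead (d : diag (x + y) z) : ~ separated d -> jz z *d dlt d *d ff x y = 0.
  move=> nsep; have [/existsP[i /existsP[j /eqP e]]|h] :=
    boolP [exists i, exists j, d (inr i) == inr j].
    by rewrite (jz_top_arc e) mul0l_TL.
  rewrite mulA_TL mul_ff_arc ?mul0r_TL // => i j e; case/negP: h.
  by apply/existsP; exists i; apply/existsP; exists j; rewrite e.
have E : jz z *d X *d ff x y = \sum_d X d *: (jz z *d dlt d *d ff x y).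
  rewrite {1}[X]TL_decomp mul_sumr_TL mul_suml_TL; apply: eq_bigr => d _.
  by rewrite mulZr_TL mulZl_TL.
move=> nz; have [d sd] : exists d : diag (x + y) z, separated d.
  have [d _ nd] : exists2 d : diag (x + y) z, true & jz z *d dlt d *d ff x y != 0.
    apply/exists_inP; apply: contraR nz => /exists_inPn h; rewrite E big1 // => d _.
    by have /negPn/eqP -> := h d isT; rewrite scaler0.
  exists d; have [//|/dead e] := pselect (separated d).
  by rewrite e eqxx in nd.
have [adm _] := separated_openers sd; split=> //.
have [d' sd' vE] := vtx_dlt adm; rewrite (separated_unique sd' sd) in vE.
exists (X d); rewrite E (bigD1 d) //= vE big1 ?addr0 // => d2 nd.
rewrite dead ?scaler0 // => sd2; case/eqP: nd; exact: separated_unique.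
Qed.

Variable z : nat.
Hypothesis adm : admissible x y z.

Lemma jz_vtx : jz z *d vtx x y z = vtx x y z.
Proof. by have [d _ ->] := vtx_dlt adm; rewrite -!mulA_TL jz_idem. Qed.

Lemma vtx_ff : vtx x y z *d ff x y = vtx x y z.
Proof. by have [d _ ->] := vtx_dlt adm; rewrite !mulA_TL ff_idem. Qed.

(** The coefficient at the separated diagram is 1. Each projector is the identity plus an element of
    the augmentation ideal, and such an element leaves an arc inside one side, so it cannot
    contribute to that coefficient. *)
Lemma vtx_neq0 : vtx x y z <> 0.
Proof.
have [d sd vE] := vtx_dlt adm.
have ind m (Q : TL m m -> Prop) : Q 0 -> (forall X Y, Q X -> Q Y -> Q (X + Y)) ->
    (forall k e, e != id_diag m -> Q (k *: dlt e)) -> forall X, aug X = 0 -> Q X.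
  move=> Q0 QD Qd X X0; rewrite [X]TL_decomp (bigD1 (id_diag m)) //=.
  rewrite [X (id_diag m)]X0 scale0r add0r; apply: big_ind => // e; exact: Qd.
have coefD (X Y : TL (x + y) z) : (X + Y) d = X d + Y d by rewrite ffunE.
have coef0 : (0 : TL (x + y) z) d = 0 by rewrite ffunE.
have top0 (X : TL z z) (Y : TL (x + y) z) : aug X = 0 -> (X *d Y) d = 0.
  move: X; apply: ind => [|X X' h h'|k e ne]; first by rewrite mul0l_TL.
    by rewrite mulDl_TL coefD h h' addr0.
  rewrite mulZl_TL TL_scaleE [Y]TL_decomp mul_sumr_TL TL_sumE big1 ?mulr0 // => d2 _.
  rewrite mulZr_TL TL_scaleE; have [w [l [-> _ wr]]] := mul_dlt_arcs e d2.
  rewrite TL_scaleE ffunE; case: eqP => [dw|_]; last by rewrite !mulr0.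
  have [_ [i [j eij]]] := nonid_arcs ne.
  by have := sd (inr i); rewrite dw (wr _ _ eij).
have bot0 (Y : TL (x + y) z) (X : TL x x) (X' : TL y y) :
    aug X = 0 \/ aug X' = 0 -> (Y *d juxt X X') d = 0.
  have base (e : diag x x) (e' : diag y y) k : e != id_diag x \/ e' != id_diag y ->
      (Y *d (k *: juxt (dlt e) (dlt e'))) d = 0.
    move=> ne; rewrite mulZr_TL TL_scaleE; have [f [-> fL fR]] := juxt_dlt e e'.
    rewrite [Y]TL_decomp mul_suml_TL TL_sumE big1 ?mulr0 // => d2 _.
    rewrite mulZl_TL TL_scaleE; have [w [l [-> wl _]]] := mul_dlt_arcs d2 f.
    rewrite TL_scaleE ffunE; case: eqP => [dw|_]; last by rewrite !mulr0.
    case: ne => /nonid_arcs[[i [j eij]] _].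
      have := fL (inl i); rewrite eij /= => /wl; rewrite -dw => e3.
      by have := sd (inl (lshift y i)); rewrite e3 /= !ltn_ord.
    have := fR (inl i); rewrite eij /= => /wl; rewrite -dw => e3.
    by have := sd (inl (rshift x i)); rewrite e3 /= !ltnNge !leq_addr.
  case; [move: X|move: X']; apply: ind => [|X1 X2 h1 h2|k e ne].
  - by rewrite juxt0l mul0r_TL.
  - by rewrite juxtDl mulDr_TL coefD h1 h2 addr0.
  - rewrite juxtZl [X']TL_decomp mulZr_TL TL_scaleE.
    rewrite (_ : juxt _ _ = \sum_e' X' e' *: juxt (dlt e) (dlt e')); last first.
      elim/big_rec2: _ => [|e' u v _ <-]; first by rewrite juxt0r.
      by rewrite juxtDr juxtZr.
    rewrite mul_sumr_TL TL_sumE big1 ?mulr0 // => e' _; apply: base; by left.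
  - by rewrite juxt0r mul0r_TL.
  - by rewrite juxtDr mulDr_TL coefD h1 h2 addr0.
  - rewrite juxtZr mulZr_TL TL_scaleE [X]TL_decomp juxt_suml mul_sumr_TL TL_sumE.
    by rewrite big1 ?mulr0 // => e' _; rewrite juxtZl; apply: base; right.
have aug1 m : aug (jz m - one m) = 0.
  by rewrite augD -scaleN1r augZ aug_jz aug_one mulN1r subrr.
have split_jz m : jz m = one m + (jz m - one m) by rewrite addrC subrK.
move=> v0; have : (vtx x y z) d = 1.
  rewrite vE mulA_TL {1}[jz z]split_jz mulDl_TL mul1_TL coefD (top0 _ _ (aug1 z)) addr0.
  rewrite /ff {1}[jz x]split_jz juxtDl mulDr_TL coefD.
  rewrite [X in _ + X]bot0 ?addr0; last by left.
  rewrite {1}[jz y]split_jz juxtDr mulDr_TL coefD.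
  rewrite [X in _ + X]bot0 ?addr0; last by right.
  by rewrite juxt1 mul_TL1 ffunE eqxx.
by rewrite v0 coef0 => /esym/eqP; rewrite oner_eq0.
Qed.

(** The theta net divided by [Delta]: absorption makes the vertex times its dual a multiple of
    [jz z], and the trace reads off the scalar. *)
Definition kappa : QA := trace (vtx x y z *d dual (vtx x y z)) / trace (jz z).

Lemma vtx_dual : vtx x y z *d dual (vtx x y z) = kappa *: jz z.
Proof.
have E : vtx x y z *d dual (vtx x y z)
    = aug (vtx x y z *d dual (vtx x y z)) *: jz z.
  rewrite -{1 2}jz_vtx dual_mul dual_jz.
  by rewrite -[X in X = _]mulA_TL [X in X *d jz z]mulA_TL jz_endo.
by rewrite /kappa {2}E traceZ mulfK ?trace_jz_neq0.
Qed.

Lemma kappa_neq0 : kappa != 0.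
Proof.
apply/eqP => k0; apply: vtx_neq0; apply: mul_dual_eq0.
by rewrite vtx_dual k0 scale0r.
Qed.

End Vertex.

Lemma vtx_ortho x y z z' : admissible x y z -> admissible x y z' -> z != z' ->
  vtx x y z *d dual (vtx x y z') = 0.
Proof.
move=> adm adm' ne; rewrite -(jz_vtx adm) -(jz_vtx adm') dual_mul dual_jz.
by rewrite -mulA_TL [X in X *d jz z']mulA_TL jz_neq_hom // eq_sym.
Qed.

(** By strong induction on [n], every [D] out of [x + y] kills [Q]; the identity is the case wanted.
    [jz n *d D] acts on [Q] as a multiple of a vertex or as 0, and [one n - jz n] is a combination
    of diagrams with caps, which factor through fewer points. *)
Lemma vertex_cancel x y w (Q : TL w (x + y)) : ff x y *d Q = Q ->
  (forall c, admissible x y c -> vtx x y c *d Q = 0) -> Q = 0.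
Proof.
move=> fQ vQ; suff H n : forall D : TL (x + y) n, D *d Q = 0.
  by rewrite -(mul1_TL Q) H.
elim/ltn_ind: n => n IH D.
have jD : jz n *d D *d Q = 0.
  rewrite -fQ -mulA_TL; have [-> |nz] := eqVneq (jz n *d D *d ff x y) 0.
    by rewrite mul0l_TL.
  have [adm [k ->]] := hom_vertex nz.
  by rewrite mulZl_TL vQ // scaler0.
have Y0 : aug (one n - jz n) = 0.
  by rewrite augD -scaleN1r augZ aug_jz aug_one mulN1r subrr.
have -> : D *d Q = (one n - jz n) *d D *d Q.
  by rewrite !mulBl_TL jD subr0 mul1_TL.
rewrite [one n - jz n]TL_decomp !mul_suml_TL big1 // => d _; rewrite !mulZl_TL.
have [->|nd] := eqVneq d (id_diag n).
  by rewrite -/(aug (one n - jz n)) Y0 scale0r.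
have [[i [j dij]] _] := nonid_arcs nd; have [a [b [ba dab _ _]]] := bottom_cap dij.
have lt : (a.+1 < n)%N by rewrite -ba.
have [k h] := bottom_cap_e_gen ba dab.
have [e [n' [U [k' [ee _ _ ltn' UU]]]]] := e_gen_spec lt.
have eD : e_gen n a *d (D *d Q) = 0.
  rewrite ee; apply: (scalerI (delta_expn_neq0 k')).
  by rewrite scaler0 -mulZl_TL -UU mulA_TL -(mulA_TL U) IH ?mul0r_TL.
suff -> : dlt d *d D *d Q = 0 by rewrite scaler0.
apply: (scalerI (delta_expn_neq0 k)).
by rewrite scaler0 -2!mulZl_TL -h !mulA_TL eD mul0r_TL.
Qed.

Theorem fusion x y : ff x y = \sum_(c < (x + y).+1 | admissible x y c)
  (kappa x y c)^-1 *: (dual (vtx x y c) *d vtx x y c).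
Proof.
apply/eqP; rewrite -subr_eq0; apply/eqP; apply: (@vertex_cancel x y).
  rewrite mulBr_TL ff_idem mul_sumr_TL; congr (_ - _); apply: eq_bigr => c adm.
  by rewrite mulZr_TL -mulA_TL -{1}dual_ff -dual_mul vtx_ff.
move=> c adm; have clt : (c < (x + y).+1)%N by case/and4P: adm => _ _ _; rewrite ltnS.
rewrite mulBr_TL vtx_ff // mul_sumr_TL (bigD1 (Ordinal clt)) //= big1 => [|c' /andP[adm' ne]].
  by rewrite addr0 mulZr_TL -mulA_TL vtx_dual // mulZl_TL jz_vtx // scalerA
    mulVf ?kappa_neq0 // scale1r subrr.
rewrite mulZr_TL -mulA_TL vtx_ortho ?mul0l_TL ?scaler0 //.
by apply: contra ne => /eqP e; apply/eqP/val_inj.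
Qed.

(** * Rotation of the theta net *)

Lemma color_charM (K : fieldType) (g h : bool -> K) m (c : {ffun 'I_m -> bool}) :
  color_char g c * color_char h c = color_char (fun b => g b * h b) c.
Proof. by rewrite /color_char -big_split. Qed.

Lemma eq_color_char (K : fieldType) (g h : bool -> K) m (c : {ffun 'I_m -> bool}) :
  g =1 h -> color_char g c = color_char h c.
Proof. by move=> e; apply: eq_bigr => j _; exact: e. Qed.

Lemma split_lshift m n (j : 'I_m) : split (lshift n j) = inl j.
Proof. exact: (unsplitK (inl j)). Qed.

Lemma split_rshift m n (j : 'I_n) : split (rshift m j) = inr j.
Proof. exact: (unsplitK (inr j)). Qed.

(** The balance at one point of the edge [x] when the net is rotated: trace weight and sign against
    two amplitude factors. [parity_cap_turn] is the balance on the edge [z]. *)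
Lemma turn_parity_cap (K : fieldType) (A : K) e : A != 0 ->
  turn_wt A (~~ ~~ e) * parity_wt K (~~ e)
    * (turn_wt A (~~ e) / cap_wt A e (~~ e) * (turn_wt A (~~ e) / cap_wt A e (~~ e)))
  = parity_wt K e.
Proof.
by move=> A0; case: e; rewrite /turn_wt /cap_wt /cup_wt /parity_wt /= ?opprK
  ?invrN ?invrK; field.
Qed.

Lemma turn_cap_neq0 (K : fieldType) (A : K) e : A != 0 ->
  turn_wt A (~~ e) / cap_wt A e (~~ e) != 0.
Proof.
move=> A0; rewrite mulf_neq0 ?turn_wt_neq0 // invr_eq0 oppr_eq0.
by rewrite cup_wt_neq0.
Qed.

Lemma parity_cap_turn (K : fieldType) (A : K) e : A != 0 ->
  parity_wt K (~~ e) * (cap_wt A (~~ e) e * cap_wt A (~~ e) e)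
    = turn_wt A e * parity_wt K e.
Proof. by move=> A0; case: e; rewrite /turn_wt /cap_wt /cup_wt /parity_wt /=; field. Qed.

Notation color n := {ffun 'I_n -> bool}.

(** Closing on the other side: the trace is invariant under a half turn, which inverts the
    weights. *)
Lemma trace_turned n (X : TL n n) :
  trace X = \sum_c color_char (fun b => turn_wt A (~~ b)) c * rep X c c.
Proof.
rewrite -trace_turn trace_rep (reindex_inj (inv_inj (@turn_colorK n))).
by apply: eq_bigr => c _; rewrite rep_turn turn_colorK color_char_turn.
Qed.

(** The closing weight [k] is a parameter because the two nets to be compared are closed with
    different weights. *)
Lemma theta_net_sum x y z (d : diag (x + y) z) (k : color z -> QA) :
  \sum_c k c * rep (jz z *d (dlt d *d ff x y *d dual (dlt d))) c c =
  \sum_(u : color x * color x) \sum_(v : color y * color y)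
    \sum_(w : color z * color z)
      k w.1 * (parity w.1 * (parity u.1 * parity v.1)) *
      (amp d (join_color (u.1, v.1)) w.1 * amp d (join_color (u.2, v.2)) w.2) *
      (rep (jz x) u.1 u.2 * rep (jz y) v.1 v.2 * rep (jz z) w.2 w.1).
Proof.
pose T u v w : QA := k w.1 * (parity w.1 * (parity u.1 * parity v.1)) *
      (amp d (join_color (u.1, v.1)) w.1 * amp d (join_color (u.2, v.2)) w.2) *
      (rep (jz x) u.1 u.2 * rep (jz y) v.1 v.2 * rep (jz z) w.2 w.1).
have pE (a : color x) (b : color y) : parity (join_color (a, b)) = parity a * parity b.
  rewrite /color_char big_split_ord; congr (_ * _); apply: eq_bigr => i _.
    by rewrite ffunE split_lshift.
  by rewrite ffunE split_rshift.
transitivity (\sum_c \sum_c' \sum_a \sum_b \sum_a' \sum_b' T (a, a') (b, b') (c, c')).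
  apply: eq_bigr => c _; rewrite rep_mul mulr_sumr; apply: eq_bigr => c' _.
  rewrite mulA_TL rep_mul.
  transitivity (\sum_e k c * ((\sum_g rep (dual (dlt d)) c g * rep (ff x y) g e)
      * rep (dlt d) e c' * rep (jz z) c' c)).
    rewrite mulr_suml mulr_sumr; apply: eq_bigr => e _.
    by rewrite rep_mul.
  transitivity (\sum_e \sum_g k c * (rep (dual (dlt d)) c g * rep (ff x y) g e
      * rep (dlt d) e c' * rep (jz z) c' c)).
    by apply: eq_bigr => e _; rewrite !mulr_suml mulr_sumr.
  rewrite exchange_big sum_color_split; apply: eq_bigr => a _; apply: eq_bigr => b _.
  rewrite sum_color_split; apply: eq_bigr => a' _; apply: eq_bigr => b' _.
  rewrite /T /= rep_dual !rep_dlt rep_juxt !lcolor_join !rcolor_join pE /=.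
  ring.
transitivity (\sum_w \sum_a \sum_b \sum_a' \sum_b' T (a, a') (b, b') w).
  by rewrite pair_big /=; apply: eq_bigr => -[].
transitivity (\sum_w \sum_u \sum_v T u v w).
  apply: eq_bigr => w _.
  transitivity (\sum_a \sum_a' \sum_b \sum_b' T (a, a') (b, b') w).
    by apply: eq_bigr => a _; rewrite exchange_big.
  rewrite pair_big /=; apply: eq_bigr => -[a a'] _ /=.
  by rewrite pair_big /=; apply: eq_bigr => -[].
rewrite exchange_big; apply: eq_bigr => u _ /=; exact: exchange_big.
Qed.

Section ThetaRotation.
Variables x y z : nat.

(** The block [x] passes from bottom to top and [z] from top to bottom. Both are reversed, since
    boundary order reads the top from right to left. *)
Definition rotate_pt (p : 'I_(x + y) + 'I_z) : 'I_(y + z) + 'I_x :=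
  match p with
  | inl i => match split i with inl j => inr (rev_ord j) | inr j => inl (lshift z j) end
  | inr j => inl (rshift y (rev_ord j))
  end.

Definition unrotate_pt (p : 'I_(y + z) + 'I_x) : 'I_(x + y) + 'I_z :=
  match p with
  | inl i => match split i with inl j => inl (rshift x j) | inr j => inr (rev_ord j) end
  | inr j => inl (lshift y (rev_ord j))
  end.

Lemma rotate_pt_bij : bijective rotate_pt.
Proof.
exists unrotate_pt; case=> [i|j] /=.
- by case: (split_ordP i) => j ->; rewrite ?split_lshift ?split_rshift //= ?split_lshift ?rev_ordK.
- by rewrite split_rshift rev_ordK.
- by case: (split_ordP i) => j ->; rewrite ?split_lshift ?split_rshift //= ?split_rshift ?rev_ordK.
- by rewrite split_lshift rev_ordK.
Qed.

Lemma pos_rotate_pt p : pos (rotate_pt p)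
  = if (pos p < x)%N then (pos p + (x + y + z - x))%N else (pos p - x)%N.
Proof.
case: p => [i|j] /=; last first.
  have hj := ltn_ord j; have -> : (x + y + (z - j.+1) < x)%N = false by lia.
  by lia.
by case: (split_ordP i) => j ->; have hj := ltn_ord j; rewrite /=; lia.
Qed.

(** Rotation permutes the three sides, so the rotated diagram is again separated, and a separated
    diagram is unique. *)
Lemma rotate_separated (d : diag (x + y) z) (d' : diag (y + z) x) :
  separated d -> separated d' -> forall p, d' (rotate_pt p) = rotate_pt (d p).
Proof.
move=> sd sd'; have b_le : (x <= x + y + z)%N by lia.
have [e eE] := rotate_exists rotate_pt_bij b_le pos_rotate_pt d.
suff se : separated e by rewrite (separated_unique sd' se).
have sideE p : side (rotate_pt p)
    = match side p with 0 => 2%N | 1 => 0%N | _ => 1%N end.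
  case: p => [i|j] /=; last by rewrite ltnNge leq_addr.
  by case: (split_ordP i) => j _ //=; rewrite ltn_ord.
have side3 m n l (p : 'I_(m + n) + 'I_l) : (side p < 3)%N.
  by case: p => i //=; case: ifP.
have [g fK gK] := rotate_pt_bij.
move=> q; rewrite -[q]gK eE !sideE; have := sd (g q).
have := side3 _ _ _ (d (g q)); have := side3 _ _ _ (g q).
by case: (side (d (g q))) => [|[|[|]]] //; case: (side (g q)) => [|[|[|]]].
Qed.

(** The factor on [a] is the turn weight of the moved points divided by the bend weight they no
    longer carry; the factor on [c] is the bend weight gained when [z] reaches the bottom. *)
Lemma amplitude_rotate (d : diag (x + y) z) (d' : diag (y + z) x)
    (a : color x) (b : color y) (c : color z) :
  (forall p, d' (rotate_pt p) = rotate_pt (d p)) ->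
  amp d' (join_color (b, turn_color c)) (turn_color a)
    = amp d (join_color (a, b)) c
      * (color_char (fun e => turn_wt A (~~ e) / cap_wt A e (~~ e)) a
         * color_char (fun e => cap_wt A (~~ e) e) c).
Proof.
move=> dE; have b_le : (x <= x + y + z)%N by lia.
have E := arcs_wt_rotate rotate_pt_bij b_le pos_rotate_pt
  (boundary (join_color (b, turn_color c)) (turn_color a)) A_neq0 dE.
have X p : boundary (join_color (b, turn_color c)) (turn_color a) (rotate_pt p)
    = boundary (join_color (a, b)) c p.
  case: p => [i|j] /=; last by rewrite !ffunE split_rshift !ffunE rev_ordK !negbK.
  case: (split_ordP i) => j ->; rewrite ?split_lshift ?split_rshift /= !ffunE.
    by rewrite rev_ordK split_lshift.
  by rewrite split_lshift split_rshift.
rewrite /amplitude E !bend_split !lcolor_join !rcolor_join /=.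
have -> : arcs_wt A d (boundary (join_color (b, turn_color c)) (turn_color a)
    \o rotate_pt) = arcs_wt A d (boundary (join_color (a, b)) c).
  by apply: eq_wt; [exact: diag_matching | move=> p _; exact: X].
have -> : \prod_(p | (pos p < x)%N) turn_wt A
      (boundary (join_color (b, turn_color c)) (turn_color a) (rotate_pt p))
    = color_char (fun e => turn_wt A (~~ e)) a.
  rewrite big_sumType /= [X in _ * X]big_pred0 ?mulr1 => [|j]; last first.
    by have := ltn_ord j; lia.
  rewrite big_split_ord /= [X in _ * X]big_pred0 ?mulr1 => [|j]; last first.
    by rewrite ltnNge leq_addr.
  apply: eq_big => [j|j _]; first by rewrite ltn_ord.
  by rewrite split_lshift /= ffunE rev_ordK.
have -> : bend A (turn_color c) = color_char (fun e => cap_wt A (~~ e) e) c.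
  rewrite -[LHS]/(color_char (fun e => cap_wt A e (~~ e)) (turn_color c)).
  by rewrite color_char_turn; apply: eq_color_char => e; rewrite negbK.
have aE : color_char (fun e => turn_wt A (~~ e)) a
    = bend A a * color_char (fun e => turn_wt A (~~ e) / cap_wt A e (~~ e)) a.
  rewrite -[bend A a]/(color_char (fun e => cap_wt A e (~~ e)) a) color_charM.
  apply: eq_color_char => e; rewrite mulrC divfK //.
  by rewrite oppr_eq0 cup_wt_neq0 ?A_neq0.
rewrite aE.
move: (bend A a) (bend A b) (arcs_wt A d _) (color_char _ a) (color_char _ c).
by move=> u v w s t; ring.
Qed.

Lemma vtx_trace a b c : admissible a b c -> exists2 d : diag (a + b) c,
  separated d & trace (vtx a b c *d dual (vtx a b c))
    = trace (jz c *d (dlt d *d ff a b *d dual (dlt d))).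
Proof.
move=> adm; have [d sd vE] := vtx_dlt adm; exists d => //.
rewrite vE !dual_mul dual_ff dual_jz.
have -> : jz c *d dlt d *d ff a b *d (ff a b *d (dual (dlt d) *d jz c))
    = jz c *d (dlt d *d (ff a b *d ff a b) *d dual (dlt d)) *d jz c.
  by rewrite !mulA_TL.
by rewrite ff_idem traceC -mulA_TL jz_idem.
Qed.

(** Both nets become state sums over the same edge colours, with those of [x] and [z] turned. The
    projectors are invariant under turning, and charge conservation across each of them lets the
    rotation factors at its two ends be collected at one end. *)
Theorem vtx_trace_rotate : admissible x y z ->
  trace (vtx y z x *d dual (vtx y z x)) = trace (vtx x y z *d dual (vtx x y z)).
Proof.
move=> adm; have adm' : admissible y z x.
  by case/and4P: adm => p l1 l2 l3; apply/and4P; split=> //; lia.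
have [d sd ->] := vtx_trace adm; have [d' sd' ->] := vtx_trace adm'.
have dE := rotate_separated sd sd'.
(* The net ending in [x] is closed on the other side, the one ending in [z] in the standard way;
   with this choice the factors cancel point by point. *)
rewrite trace_turned trace_rep !theta_net_sum.
pose tc2 n (u : color n * color n) := (turn_color u.1, turn_color u.2).
have tc2_inj n : injective (@tc2 n).
  by apply: (can_inj (g := @tc2 n)) => -[u u']; rewrite /tc2 /= !turn_colorK.
pose g1 e : QA := turn_wt A (~~ e) / cap_wt A e (~~ e).
pose g2 e : QA := cap_wt A (~~ e) e.
have cap0 e : cap_wt A e (~~ e) != 0 by rewrite oppr_eq0 cup_wt_neq0 ?A_neq0.
have g10 e : g1 e != 0 by exact: turn_cap_neq0 A_neq0.
have g20 e : g2 e != 0 by have := cap0 (~~ e); rewrite negbK.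
pose F u v w : QA := color_char (fun e => turn_wt A (~~ e)) u.1 *
  (parity u.1 * (parity v.1 * parity w.1)) *
  (amp d' (join_color (v.1, w.1)) u.1 * amp d' (join_color (v.2, w.2)) u.2) *
  (rep (jz y) v.1 v.2 * rep (jz z) w.1 w.2 * rep (jz x) u.2 u.1).
transitivity (\sum_(u : color x * color x) \sum_(v : color y * color y)
    \sum_(w : color z * color z) F u v w).
  transitivity (\sum_(v : color y * color y) \sum_(u : color x * color x)
    \sum_(w : color z * color z) F u v w); last by rewrite exchange_big.
  by apply: eq_bigr => v _; rewrite exchange_big.
rewrite (reindex_inj (tc2_inj x)); apply: eq_bigr => u _; apply: eq_bigr => v _.
rewrite (reindex_inj (tc2_inj z)); apply: eq_bigr => w _; rewrite /F /=.
rewrite !(amplitude_rotate _ _ _ dE) -!rep_turn !turn_jz.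
have [->|nu] := eqVneq (rep (jz x) u.1 u.2) 0; first by rewrite !mul0r !mulr0.
have [->|nw] := eqVneq (rep (jz z) w.2 w.1) 0; first by rewrite !(mul0r, mulr0).
rewrite -/g1 -/g2 !color_char_turn.
rewrite -(rep_charge_endo g10 nu) (rep_charge_endo g20 nw).
have I1 : color_char (fun e => turn_wt A (~~ ~~ e)) u.1
    * color_char (fun e => parity_wt QA (~~ e)) u.1
    * (color_char g1 u.1 * color_char g1 u.1) = parity u.1.
  rewrite !color_charM; apply: eq_color_char => e; rewrite /g1.
  exact: turn_parity_cap A_neq0.
have I2 : color_char (fun e => parity_wt QA (~~ e)) w.1
    * (color_char g2 w.1 * color_char g2 w.1) = turn_char w.1 * parity w.1.
  rewrite !color_charM; apply: eq_color_char => e; rewrite /g2.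
  exact: parity_cap_turn A_neq0.
move: I1 I2.
move: (color_char _ u.1) (color_char (fun e => parity_wt QA (~~ e)) u.1)
  (color_char g1 u.1) (parity u.1) (color_char (fun e => parity_wt QA (~~ e)) w.1)
  (color_char g2 w.1) (turn_char w.1) (parity w.1) (parity v.1) (amp d _ _)
  (amp d _ _) (rep _ _ _) (rep _ _ _) (rep _ _ _).
move=> a1 a2 a3 a4 a5 a6 a7 a8 a9 b1 b2 b3 b4 b5 I1 I2.
transitivity ((a1 * a2 * (a3 * a3)) * (a5 * (a6 * a6)) * a9 * (b1 * b2)
  * (b3 * b4 * b5)); first by ring.
by rewrite I1 I2; ring.
Qed.

End ThetaRotation.

(** * Resolutions of an idempotent into matrix units *)

Section Resolution.
Variables (K : fieldType) (H : nat -> nat -> lmodType K).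
Variable mul : forall l m n, H m n -> H l m -> H l n.
Variable dual : forall m n, H m n -> H n m.
Variable jz : forall n, H n n.
Local Notation "X *h Y" := (mul X Y) (at level 40, left associativity).
Hypothesis mulDlH : forall l m n (X X' : H m n) (Y : H l m),
  (X + X') *h Y = X *h Y + X' *h Y.
Hypothesis mulDrH : forall l m n (X : H m n) (Y Y' : H l m),
  X *h (Y + Y') = X *h Y + X *h Y'.
Hypothesis mulZlH : forall l m n k (X : H m n) (Y : H l m),
  (k *: X) *h Y = k *: (X *h Y).
Hypothesis mulZrH : forall l m n k (X : H m n) (Y : H l m),
  X *h (k *: Y) = k *: (X *h Y).
Hypothesis mulAH : forall j l m n (X : H m n) (Y : H l m) (Z : H j l),
  X *h Y *h Z = X *h (Y *h Z).
Hypothesis dual_mul : forall l m n (X : H m n) (Y : H l m),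
  dual (X *h Y) = dual Y *h dual X.
Hypothesis dual_jz : forall n, dual (jz n) = jz n.
Hypothesis jz_neq0 : forall n, jz n <> 0.
Hypothesis jz_neq_hom : forall m n (X : H m n), m != n -> jz n *h X *h jz m = 0.
Hypothesis jz_endo : forall n (X : H n n), exists k, jz n *h X *h jz n = k *: jz n.

Variables (N : nat) (F : H N N) (I : eqType) (r : seq I) (lam : I -> nat).
Variables (w : forall t, H N (lam t)) (et : I -> K).
Hypothesis uniq_r : uniq r.
Hypothesis dualF : dual F = F.
Hypothesis et_neq0 : forall t, t \in r -> et t != 0.
Hypothesis wF : forall t, t \in r -> w t *h F = w t.
Hypothesis jw_w : forall t, t \in r -> jz (lam t) *h w t = w t.
Hypothesis ww : forall t, t \in r -> w t *h dual (w t) = et t *: jz (lam t).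
Hypothesis w_ortho : forall s t, s \in r -> t \in r -> s != t ->
  w s *h dual (w t) = 0.

Definition proj t : H N N := (et t)^-1 *: (dual (w t) *h w t).

Hypothesis F_sum : F = \sum_(t <- r) proj t.

Lemma mul0lH l m n (Y : H l m) : (0 : H m n) *h Y = 0.
Proof. by rewrite -(scale0r (0 : H m n)) mulZlH scale0r. Qed.

Lemma mul0rH l m n (X : H m n) : X *h (0 : H l m) = 0.
Proof. by rewrite -(scale0r (0 : H l m)) mulZrH scale0r. Qed.

Lemma mul_sumlH l m n (J : Type) (q : seq J) P (f : J -> H m n) (Y : H l m) :
  (\sum_(j <- q | P j) f j) *h Y = \sum_(j <- q | P j) f j *h Y.
Proof.
by elim/big_rec2: _ => [|j u v _ <-]; rewrite ?mul0lH // mulDlH.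
Qed.

Lemma mul_sumrH l m n (J : Type) (q : seq J) P (X : H m n) (f : J -> H l m) :
  X *h (\sum_(j <- q | P j) f j) = \sum_(j <- q | P j) X *h f j.
Proof.
by elim/big_rec2: _ => [|j u v _ <-]; rewrite ?mul0rH // mulDrH.
Qed.

Lemma F_proj t : t \in r -> F *h proj t = proj t.
Proof.
by move=> rt; rewrite /proj mulZrH -mulAH -{1}dualF -dual_mul wF.
Qed.

Lemma proj_F t : t \in r -> proj t *h F = proj t.
Proof. by move=> rt; rewrite /proj mulZlH mulAH wF. Qed.

Lemma proj_idem t : t \in r -> proj t *h proj t = proj t.
Proof.
move=> rt; rewrite /proj mulZlH mulZrH mulAH -(mulAH (w t)) ww //.
by rewrite mulZlH jw_w // mulZrH scalerK ?et_neq0.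
Qed.

Lemma proj_ortho s t : s \in r -> t \in r -> s != t -> proj s *h proj t = 0.
Proof.
move=> rs rt st; rewrite /proj mulZlH mulZrH mulAH -(mulAH (w s)).
by rewrite w_ortho // mul0lH mul0rH !scaler0.
Qed.

Lemma proj_neq0 t : t \in r -> proj t <> 0.
Proof.
move=> rt g0; apply: (@jz_neq0 (lam t)); apply: (scalerI (et_neq0 rt)).
have : w t *h proj t *h dual (w t) = 0 by rewrite g0 mul0rH mul0lH.
rewrite /proj mulZrH mulZlH -mulAH ww // mulZlH jw_w // mulZlH ww //.
by rewrite scalerA mulVf ?et_neq0 // scale1r scaler0.
Qed.

(** Since [w t] absorbs its projector, the middle factor can be sandwiched between [jz (lam s)] and
    [jz (lam t)], where the two Schur-type hypotheses apply. *)
Lemma proj_corner s t X : s \in r -> t \in r ->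
  proj s *h X *h proj t = (et s)^-1 *: ((et t)^-1 *:
    (dual (w s) *h (jz (lam s) *h (w s *h X *h dual (w t)) *h jz (lam t)) *h w t)).
Proof.
move=> rs rt; rewrite /proj !mulZlH mulZrH.
have <- : w s *h X *h dual (w t)
    = jz (lam s) *h (w s *h X *h dual (w t)) *h jz (lam t).
  by rewrite -[in LHS](jw_w rs) -[in LHS](jw_w rt) dual_mul dual_jz !mulAH.
by rewrite !mulAH.
Qed.

Lemma proj_endo t X : t \in r -> exists k, proj t *h X *h proj t = k *: proj t.
Proof.
move=> rt; rewrite proj_corner //; have [k ->] := jz_endo (w t *h X *h dual (w t)).
exists ((et t)^-1 * k); rewrite mulZrH mulZlH mulAH jw_w // /proj.
by move: (et t)^-1 (dual _ *h _) => c X'; rewrite -scalerA; congr (_ *: _);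
  rewrite !scalerA mulrC.
Qed.

Lemma proj_hom0 s t X : s \in r -> t \in r -> lam s != lam t ->
  proj s *h X *h proj t = 0.
Proof.
move=> rs rt st; rewrite proj_corner // jz_neq_hom 1?eq_sym //.
by rewrite mul0rH mul0lH !scaler0.
Qed.

(** [L] is an off-diagonal matrix unit, up to a scalar. *)
Lemma proj_link s t : s \in r -> t \in r -> lam s = lam t ->
  exists L : H N N, [/\ L <> 0, proj s *h L = L & L *h proj t = L].
Proof.
move=> rs rt st.
(* [lam s] and [lam t] are only propositionally equal, so [w t] is replaced by a map into the object
   [lam s], known through the three equations used below. *)
have [w' [w'w' jw' gt]] : exists w' : H N (lam s), [/\ w' *h dual w' = et t *: jz (lam s),
    jz (lam s) *h w' = w' & proj t = (et t)^-1 *: (dual w' *h w')].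
  by rewrite st; exists (w t); rewrite ww // jw_w.
exists (dual (w s) *h w'); split.
- move=> h; apply: (@jz_neq0 (lam s)).
  apply: (scalerI (et_neq0 rs)); apply: (scalerI (et_neq0 rt)).
  have : w s *h (dual (w s) *h w') *h dual w' = 0 by rewrite h mul0rH mul0lH.
  rewrite -mulAH ww // mulZlH jw' mulZlH w'w' => e.
  by rewrite !scaler0 -[RHS]e !scalerA mulrC.
- rewrite /proj mulZlH mulAH -(mulAH (w s)) ww // mulZlH jw' mulZrH.
  by rewrite scalerA mulVf ?et_neq0 // scale1r.
- rewrite gt mulZrH mulAH -(mulAH w') w'w' mulZlH jw' mulZrH.
  by rewrite scalerA mulVf ?et_neq0 // scale1r.
Qed.

Definition in_corner Y := F *h Y = Y /\ Y *h F = Y.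

Lemma proj_corner_mem t : t \in r -> in_corner (proj t).
Proof. by move=> rt; split; [exact: F_proj | exact: proj_F]. Qed.

Lemma scalar_idempotent (k : K) (e : H N N) : e <> 0 ->
  (k *: e) *h (k *: e) = k *: e -> e *h e = e -> k = 0 \/ k = 1.
Proof.
move=> e0; rewrite mulZlH mulZrH => + ee; rewrite ee scalerA => h.
have : (k * k - k) *: e = 0 by rewrite scalerBl h subrr.
move=> /eqP; rewrite scaler_eq0 => /orP[|/eqP //].
rewrite -{3}[k]mulr1 -mulrBr mulf_eq0 => /orP[/eqP|]; first by left.
by rewrite subr_eq0 => /eqP; right.
Qed.

(** A summand [a] satisfies [proj t *h a *h proj t = a], so it is a multiple of [proj t]; an
    idempotent multiple is 0 or everything. *)
Lemma proj_primitive t a b : t \in r -> a *h a = a -> a <> 0 -> b <> 0 ->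
  a *h b = 0 -> b *h a = 0 -> proj t <> a + b.
Proof.
move=> rt aa a0 b0 ab ba gE.
have ga : proj t *h a = a by rewrite gE mulDlH aa ba addr0.
have ag : a *h proj t = a by rewrite gE mulDrH aa ab addr0.
have [k kE] := proj_endo a rt; rewrite ga ag in kE.
have := aa; rewrite kE => h.
have [k0|k1] := scalar_idempotent (proj_neq0 rt) h (proj_idem rt).
  by apply: a0; rewrite kE k0 scale0r.
by apply: b0; apply: (addrI a); rewrite -gE addr0 kE k1 scale1r.
Qed.

Definition block l : H N N := \sum_(t <- r | lam t == l) proj t.

Lemma block_proj t l : t \in r -> block l *h proj t = if lam t == l then proj t else 0.
Proof.
move=> rt; rewrite /block mul_sumlH big_mkcond (bigD1_seq t) //= proj_idem //.
rewrite big_seq_cond big1 ?addr0 // => s /andP[rs st].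
by case: ifP => // _; rewrite proj_ortho.
Qed.

Lemma block_idem l : block l *h block l = block l.
Proof.
rewrite {2}/block mul_sumrH big_seq_cond [RHS]big_seq_cond.
by apply: eq_bigr => t /andP[rt lt]; rewrite block_proj // lt.
Qed.

Lemma block_ortho l l' : l != l' -> block l *h block l' = 0.
Proof.
move=> ne; rewrite /block mul_sumlH big_seq_cond big1 // => s /andP[rs /eqP ls].
rewrite mul_sumrH big_seq_cond big1 // => t /andP[rt /eqP lt].
rewrite proj_ortho //; apply: contra ne => /eqP e; by rewrite -ls -lt e.
Qed.

Lemma block_mem l : in_corner (block l).
Proof.
rewrite /in_corner /block mul_sumrH mul_sumlH.
by split; rewrite big_seq_cond [RHS]big_seq_cond; apply: eq_bigr => t /andP[rt _];
  [exact: F_proj | exact: proj_F].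
Qed.

(** Expanding [X] by [F_sum] on either side, the components between different weights vanish, so
    both products equal [block l *h X *h block l]. *)
Lemma block_central l X : in_corner X -> block l *h X = X *h block l.
Proof.
case=> FX XF.
have -> : block l *h X = block l *h X *h block l.
  rewrite -{1}XF -mulAH {1}F_sum mul_sumrH /block mul_sumrH [RHS]big_mkcond.
  apply: eq_big_seq => t rt; case: eqP => // ne.
  rewrite !mul_sumlH big_seq_cond big1 // => s /andP[rs /eqP ls].
  by rewrite proj_hom0 // ls eq_sym; apply/eqP.
rewrite -{2}FX {1}F_sum mul_sumlH mul_sumlH mulAH /block mul_sumlH.
rewrite big_mkcond; apply: eq_big_seq => s rs; case: eqP => [ls|ne].
  by rewrite mulAH.
rewrite mul_sumrH big_seq_cond big1 // => t /andP[rt /eqP lt].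
by rewrite proj_hom0 // lt; apply/eqP.
Qed.

Lemma block_neq0 t : t \in r -> block (lam t) <> 0.
Proof. by move=> rt z0; apply: (proj_neq0 rt); have := block_proj (lam t) rt; rewrite z0 eqxx mul0lH. Qed.

(** A central idempotent [a] acts on every [proj s] by a scalar. The links between sequences of
    equal weight force these scalars to coincide, so [a] is a multiple of the block. *)
Lemma block_primitive t a b : t \in r -> a *h a = a -> a <> 0 -> b <> 0 ->
  (forall X, in_corner X -> a *h X = X *h a) -> a *h b = 0 -> b *h a = 0 ->
  block (lam t) <> a + b.
Proof.
move=> rt aa a0 b0 ca ab ba zE.
have az : a *h block (lam t) = a by rewrite zE mulDrH aa ab addr0.
have cag s : s \in r -> a *h proj s = proj s *h a.
  by move=> rs; exact: ca (proj_corner_mem rs).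
have agk s : s \in r -> exists k, a *h proj s = k *: proj s.
  move=> rs; have [k kE] := proj_endo a rs; exists k.
  by rewrite -kE -cag // mulAH proj_idem.
have [k kE] := agk t rt.
have ak s : s \in r -> lam s = lam t -> a *h proj s = k *: proj s.
  move=> rs st; have [k' k'E] := agk s rs.
  have [L [L0 sL Lt]] := proj_link rs rt st.
  have SL : in_corner L.
    split; first by rewrite -sL -mulAH F_proj.
    by rewrite -Lt mulAH proj_F.
  have aL : a *h L = k' *: L by rewrite -sL -mulAH k'E mulZlH.
  have La : L *h a = k *: L.
    by rewrite -{1}Lt mulAH -cag // kE mulZrH Lt.
  have := ca _ SL; rewrite aL La => e; rewrite k'E.
  suff -> : k' = k by [].
  apply/eqP; rewrite -subr_eq0; apply/negPn/negP => ne; apply: L0.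
  by apply: (scalerI ne); rewrite scaler0 scalerBl e subrr.
have aE : a = k *: block (lam t).
  rewrite -{1}az /block mul_sumrH scaler_sumr big_seq_cond [RHS]big_seq_cond.
  by apply: eq_bigr => s /andP[rs /eqP ls]; exact: ak.
have := aa; rewrite aE => h.
have [k0|k1] := scalar_idempotent (block_neq0 rt) h (block_idem _).
  by apply: a0; rewrite aE k0 scale0r.
by apply: b0; apply: (addrI a); rewrite -zE addr0 aE k1 scale1r.
Qed.

Theorem resolution :
  [/\ forall t, t \in r ->
         [/\ in_corner (proj t), proj t *h proj t = proj t & proj t <> 0],
      forall s t, s \in r -> t \in r -> s != t -> proj s *h proj t = 0,
      forall t a b, t \in r -> a *h a = a -> a <> 0 -> b <> 0 ->
        a *h b = 0 -> b *h a = 0 -> proj t <> a + b &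
  [/\ forall l, [/\ in_corner (block l), block l *h block l = block l &
         forall X, in_corner X -> block l *h X = X *h block l],
      forall l l', l != l' -> block l *h block l' = 0,
      forall t, t \in r -> block (lam t) <> 0 &
      forall t a b, t \in r -> a *h a = a -> a <> 0 -> b <> 0 ->
        (forall X, in_corner X -> a *h X = X *h a) -> a *h b = 0 -> b *h a = 0 ->
        block (lam t) <> a + b]].
Proof.
split; [|exact: proj_ortho|exact: proj_primitive|].
  by move=> t rt; split; [exact: proj_corner_mem | exact: proj_idem | exact: proj_neq0].
split; [|exact: block_ortho|exact: block_neq0|exact: block_primitive].
by move=> l; split; [exact: block_mem | exact: block_idem | exact: block_central].
Qed.

End Resolution.

(** * Admissible sequences *)

Lemma thetaE x y z : theta x y z = trace (vtx x y z *d dual (vtx x y z)).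
Proof. by rewrite /theta traceE mulE dualE vtxE. Qed.

Lemma DeltaE n : Delta n = trace (jz n).
Proof. by rewrite /Delta traceE jzE. Qed.

Lemma admissible_swap x y z : admissible x y z = admissible x z y.
Proof. by rewrite /admissible addnAC; congr (_ && _); lia. Qed.

Lemma admissible_rotate x y z : admissible x y z = admissible z x y.
Proof. by rewrite /admissible -addnA addnC addnC; congr (~~ odd _ && _); lia. Qed.

(** [eta] lists the edges of the theta net in another cyclic order than the vertex from [a] and [i]
    to [b], which defines [kappa]; the rotation bridges the two. *)
Lemma theta_Delta a i b : admissible a i b -> theta b a i / Delta b = kappa a i b.
Proof.
rewrite admissible_rotate => adm.
by rewrite thetaE DeltaE /kappa (vtx_trace_rotate adm).
Qed.

Definition vpath i s k : TL (width i k) (entry i s k) := locked v i s k.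
Definition jwpow i k : TL (width i k) (width i k) := locked tens_pow i k.

Lemma vpathE i s k : v i s k = vpath i s k.
Proof. by rewrite /vpath -lock. Qed.

Lemma jwpowE i k : tens_pow i k = jwpow i k.
Proof. by rewrite /jwpow -lock. Qed.

Lemma vpath1 i s : vpath i s 1 = jz i.
Proof. by rewrite -vpathE -jzE. Qed.

Lemma vpath_step i s k : vpath i s k.+2
  = vtx (entry i s k.+1) i (entry i s k.+2) *d juxt (vpath i s k.+1) (one i).
Proof. by rewrite -vtxE -vpathE -vpathE -oneE -juxtE -mulE. Qed.

Lemma jwpow_step i k : jwpow i k.+1 = juxt (jwpow i k) (jz i).
Proof. by rewrite -!jwpowE -jzE -juxtE. Qed.

Lemma jwpow1 i : jwpow i 1 = jz i.
Proof. by rewrite jwpow_step -jwpowE /= oneE juxt_id0. Qed.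

Lemma dual_jwpow i k : dual (jwpow i k) = jwpow i k.
Proof.
elim: k => [|k IH]; first by rewrite -jwpowE /= oneE dual1.
by rewrite jwpow_step dual_juxt IH dual_jz.
Qed.

Lemma jwpow_idem i k : jwpow i k *d jwpow i k = jwpow i k.
Proof.
elim: k => [|k IH]; first by rewrite -jwpowE /= oneE mul1_TL.
by rewrite jwpow_step -juxt_mul IH jz_idem.
Qed.

Lemma etaS k i s : eta k.+2 i s
  = eta k.+1 i s * (theta (entry i s k.+2) (entry i s k.+1) i / Delta (entry i s k.+2)).
Proof. by rewrite /eta big_nat_recr. Qed.

Lemma eta1 i s : eta 1 i s = 1.
Proof. by rewrite /eta big_geq. Qed.

Section Prefix.
Variables (i : nat).

(** [k] counts the steps, so [k.+1] entries are involved. The colour [i] stands in the middle to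
    match [vtx a i b]. *)
Definition adm_prefix s k :=
  forall j, (j < k)%N -> admissible (entry i s j.+1) i (entry i s j.+2).

Lemma adm_prefixW s k : adm_prefix s k.+1 -> adm_prefix s k.
Proof. by move=> h j jk; apply: h; exact: ltnW. Qed.

Lemma vtx_juxt a b w (X : TL w a) : admissible a i b ->
  vtx a i b *d juxt X (one i) = vtx a i b *d juxt (jz a *d X) (jz i).
Proof.
by move=> adm; rewrite -{1}(vtx_ff adm) mulA_TL /ff -juxt_mul mul_TL1.
Qed.

Lemma jz_vpath s k : adm_prefix s k -> jz (entry i s k.+1) *d vpath i s k.+1 = vpath i s k.+1.
Proof.
case: k => [|k] h; first by rewrite vpath1 jz_idem.
by rewrite vpath_step -mulA_TL jz_vtx // h.
Qed.

Lemma vpath_jwpow s k : adm_prefix s k -> vpath i s k.+1 *d jwpow i k.+1 = vpath i s k.+1.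
Proof.
elim: k => [|k IH] h; first by rewrite vpath1 jwpow1 jz_idem.
have h' := adm_prefixW h; rewrite vpath_step (vtx_juxt _ (h _ (ltnSn k))) jz_vpath //.
by rewrite jwpow_step mulA_TL -juxt_mul IH // jz_idem.
Qed.

(** Peel off the last vertex: the inner paths contract to a multiple of a projector, which the
    vertex absorbs, and the vertex with its dual contributes one factor [kappa]. *)
Lemma vpath_dual s k : adm_prefix s k ->
  vpath i s k.+1 *d dual (vpath i s k.+1) = eta k.+1 i s *: jz (entry i s k.+1).
Proof.
elim: k => [|k IH] h; first by rewrite eta1 scale1r vpath1 dual_jz jz_idem.
have h' := adm_prefixW h; have adm := h _ (ltnSn k).
rewrite etaS theta_Delta // vpath_step.
move: (vpath i s k.+1) (eta _ _ _) (IH h') => V e VV {IH}.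
rewrite dual_mul dual_juxt dual1 mulA_TL -(mulA_TL (juxt _ _)) -juxt_mul VV.
rewrite mul1_TL juxtZl mulZl_TL mulZr_TL -mulA_TL.
have -> : vtx (entry i s k.+1) i (entry i s k.+2) *d juxt (jz (entry i s k.+1)) (one i)
    = vtx (entry i s k.+1) i (entry i s k.+2).
  by rewrite vtx_juxt // jz_idem -/(ff _ _) vtx_ff.
by rewrite vtx_dual // scalerA.
Qed.

Lemma eta_neq0 s k : adm_prefix s k -> eta k.+1 i s != 0.
Proof.
elim: k => [|k IH] h; first by rewrite eta1 oner_neq0.
by rewrite etaS theta_Delta ?h // mulf_neq0 ?kappa_neq0 ?h // IH //; exact: adm_prefixW.
Qed.

(** If the last entries differ, the two projectors annihilate what lies between them; otherwise the
    difference is at an earlier entry and already kills the inner paths. *)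
Lemma vpath_ortho s t k j : adm_prefix s k -> adm_prefix t k -> (j <= k)%N ->
  entry i s j.+1 != entry i t j.+1 -> vpath i s k.+1 *d dual (vpath i t k.+1) = 0.
Proof.
elim: k => [|k IH] hs ht jk ne; first by case: j jk ne => //= _; rewrite eqxx.
have [e|e] := eqVneq (entry i s k.+2) (entry i t k.+2); last first.
  rewrite -(jz_vpath hs) -(jz_vpath ht) dual_mul dual_jz -!mulA_TL (mulA_TL (jz _)).
  by rewrite jz_neq_hom // eq_sym.
have jk' : (j <= k)%N.
  by move: jk; rewrite leq_eqVlt => /orP[/eqP jk|//]; rewrite jk e eqxx in ne.
have O := IH (adm_prefixW hs) (adm_prefixW ht) jk' ne.
rewrite !vpath_step dual_mul dual_juxt dual1 mulA_TL -(mulA_TL (juxt _ _)) -juxt_mul O.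
by rewrite juxt0l mul0l_TL mul0r_TL.
Qed.

(** The codomain of a path depends on the sequence, so equality is stated between dependent
    pairs. *)
Lemma vpath_prefix s t k : (forall j, (j <= k)%N -> entry i s j = entry i t j) ->
  existT (fun a => TL (width i k) a) (entry i s k) (vpath i s k)
    = existT (fun a => TL (width i k) a) (entry i t k) (vpath i t k).
Proof.
elim: k => [|k IH] h; first by rewrite -!vpathE.
case: k IH h => [|k] IH h; first by rewrite !vpath1.
(* One step of the recursion as a function of a packed path, so that the induction hypothesis can be
   rewritten inside it. *)
pose R b (x : {a & TL (width i k.+1) a}) : {a & TL (width i k.+2) a} :=
  existT _ b (vtx (projT1 x) i b *d juxt (projT2 x) (one i)).
transitivity (R (entry i s k.+2) (existT _ _ (vpath i s k.+1))).
  by rewrite vpath_step.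
rewrite IH => [|j jk]; last by apply: h; exact: leqW.
by rewrite h // /R /= -vpath_step.
Qed.

Definition next_entries t :=
  [seq c <- index_iota 0 (last 0 t + i).+1 | admissible (last 0 t) i c].

Fixpoint seqs k : seq (seq nat) :=
  if k is k'.+1 then
    [seq rcons t c | t <- seqs k', c <- next_entries t]
  else [:: [:: i]].

Lemma seqs_uniq k : uniq (seqs k).
Proof.
elim: k => //= k IH; apply: allpairs_uniq_dep => // [t _|].
  by rewrite filter_uniq // iota_uniq.
by move=> [t c] [t' c'] _ _ /= /rcons_inj[-> ->].
Qed.

Lemma mem_seqs k s : s \in seqs k <-> adm_seq k.+1 i s.
Proof.
elim: k s => [|k IH] s.
  rewrite inE; split=> [/eqP -> //|[]].
  by case: s => [|a [|b s]] //= _ ->.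
split=> [/allpairsPdep[t [c [/IH[st ht srt]]]]|].
  rewrite mem_filter => /andP[adm _] ->; split; first by rewrite size_rcons st.
    by case: t st ht {srt adm}.
  case: t st ht srt adm => //= a t _ _ srt adm.
  by rewrite rcons_path srt /= admissible_swap.
case/lastP: s => [[]//|t c [st ht srt]]; apply/allpairsPdep; exists t, c.
move: st; rewrite size_rcons => -[st].
case: t st ht srt => //= a t st ha; rewrite rcons_path => /andP[srt adm].
rewrite admissible_swap in adm.
split=> //; first by apply/IH; split.
rewrite mem_filter adm mem_index_iota ltnS.
by case/and4P: adm.
Qed.

Lemma entry_nth s j : head 0%N s = i -> entry i s j.+1 = nth 0%N s j.
Proof. by case: j => // <-; case: s. Qed.

Lemma adm_prefix_seq k s : adm_seq k.+1 i s -> adm_prefix s k.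
Proof.
case=> sz hd /(sortedP 0%N) h j jk; rewrite !entry_nth // admissible_swap h //.
by rewrite sz ltnS.
Qed.

Lemma weight_entry k s : adm_seq k.+1 i s -> weight s = entry i s k.+1.
Proof. by case=> sz hd _; rewrite entry_nth // /weight -nth_last sz. Qed.

Lemma seqs_neq k s t : adm_seq k.+1 i s -> adm_seq k.+1 i t -> s != t ->
  exists2 j, (j <= k)%N & entry i s j.+1 != entry i t j.+1.
Proof.
case=> zs hs _ [zt ht _] ne.
have [/existsP[j nj]|/existsPn e] := boolP [exists j : 'I_k.+1, nth 0%N s j != nth 0%N t j].
  exists (nat_of_ord j); first exact: (ltn_ord j).
  by rewrite (entry_nth _ hs) (entry_nth _ ht).
case/eqP: ne; apply: (@eq_from_nth _ 0%N) => [|j]; first by rewrite zs.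
by rewrite zs => jk; have /negPn/eqP := e (Ordinal jk).
Qed.

(** With one more colour, each term for [t] contains [ff] on the last entry of [t] and [i] between
    its two halves. Fusion there produces exactly the one-step extensions of [t]. *)
Lemma jwpow_sum k : jwpow i k.+1
  = \sum_(t <- seqs k) (eta k.+1 i t)^-1 *: (dual (vpath i t k.+1) *d vpath i t k.+1).
Proof.
elim: k => [|k IH].
  by rewrite big_seq1 vpath1 dual_jz jz_idem jwpow1 eta1 invr1 scale1r.
rewrite jwpow_step IH juxt_suml big_allpairs_dep /=.
apply: eq_big_seq => t /mem_seqs at_.
have adm := adm_prefix_seq at_; have [sz hd srt] := at_.
have lastE : last 0%N t = entry i t k.+1 by rewrite -(weight_entry at_).
pose Q b (x : {a & TL (width i k.+1) a}) : TL (width i k.+2) (width i k.+2) :=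
  dual (vtx (projT1 x) i b *d juxt (projT2 x) (one i))
    *d (vtx (projT1 x) i b *d juxt (projT2 x) (one i)).
have entS c j : (j <= k.+1)%N -> entry i (rcons t c) j = entry i t j.
  case: j => // j jk; rewrite !entry_nth // ?nth_rcons ?sz ?jk //.
  by case: (t) sz hd.
have entL c : entry i (rcons t c) k.+2 = c.
  by rewrite /= nth_rcons sz ltnn eqxx.
have gE c : dual (vpath i (rcons t c) k.+2) *d vpath i (rcons t c) k.+2
    = Q c (existT _ (entry i t k.+1) (vpath i t k.+1)).
  transitivity (Q (entry i (rcons t c) k.+2) (existT _ _ (vpath i (rcons t c) k.+1))).
    by rewrite vpath_step.
  by rewrite entL (vpath_prefix (entS c)).
have etaE c : eta k.+1 i (rcons t c) = eta k.+1 i t.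
  rewrite /eta; apply: eq_big_nat => j /andP[_ jk].
  by rewrite !entS // ltnW.
(* The path absorbs [jz] at its end, so the whole of [ff] may be placed between the halves. *)
have juxtE : juxt (dual (vpath i t k.+1) *d vpath i t k.+1) (jz i)
    = dual (juxt (vpath i t k.+1) (one i)) *d ff (entry i t k.+1) i
      *d juxt (vpath i t k.+1) (one i).
  by rewrite /ff dual_juxt dual1 -!juxt_mul mul1_TL mul_TL1 mulA_TL jz_vpath.
rewrite juxtZl juxtE fusion mul_sumr_TL mul_suml_TL scaler_sumr.
rewrite /next_entries [RHS]big_filter lastE big_mkord; apply: eq_bigr => c admc.
rewrite gE etaS etaE !entL !entS // (theta_Delta admc).
rewrite mulZr_TL mulZl_TL; move: (eta k.+1 i t) (kappa _ _ _) => e e'.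
rewrite scalerA -invfM; congr (_ *: _).
by rewrite /Q /= dual_mul !mulA_TL.
Qed.

End Prefix.

(* The idempotents of the coloured algebra *)
From mathcomp Require Import boolp classical_sets functions cardinality fsbigop.
Local Open Scope classical_set_scope.
Local Open Scope ring_scope.

Definition seqs_of_weight i k l := [seq t <- seqs i k | entry i t k.+1 == l].

(** Each admissible step changes the parity of the entry by that of [i]. Together with the bound
    [adm_seq_le] this puts the weight in [Lambda]. *)
Lemma odd_entry i s k : adm_prefix i s k -> odd (entry i s k.+1) = odd (k.+1 * i).
Proof.
elim: k => [|k IH] h; first by rewrite mul1n.
have /and4P[+ _ _ _] := h _ (ltnSn k).
rewrite (mulSn k.+1) [odd (i + _)]oddD -(IH (adm_prefixW h)) 2!oddD.
by move: (odd i) (odd (entry i s k.+1)) (odd (entry i s k.+2)) => [] [] [].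
Qed.

Lemma weight_Lambda i k s : adm_seq k.+1 i s -> Lambda k.+1 i (weight s).
Proof.
move=> sP; have le_w : (weight s <= k.+1 * i)%N.
  apply: (adm_seq_le sP); rewrite /weight; case: sP => + _ _.
  by case: s => //= a s _; exact: mem_last.
have := odd_entry (adm_prefix_seq sP); rewrite -(weight_entry sP) => par.
have e : ~~ odd (k.+1 * i - weight s) by rewrite oddB // par addbb.
exists ((k.+1 * i - weight s)./2) => /=; first by rewrite half_leq // leq_subr.
have := even_halfK e; lia.
Qed.

Lemma T_seqs i k l : T k.+1 i l = [set` seqs_of_weight i k l].
Proof.
apply/seteqP; split=> s; rewrite /mkset mem_filter.
  by case=> sP <-; rewrite (weight_entry sP) eqxx; apply/mem_seqs.
by case/andP=> /eqP <- /mem_seqs sP; rewrite -(weight_entry sP).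
Qed.

Lemma TLambda_seqs i k : TLambda k.+1 i = [set` seqs i k].
Proof.
apply/seteqP; split=> [s [l _ [sP _]]|s /mem_seqs sP]; first exact/mem_seqs.
by exists (weight s); [exact: weight_Lambda | split].
Qed.

Lemma weights_seqs i k : [set l | Lambda k.+1 i l /\ T k.+1 i l !=set0]
  = [set` undup [seq entry i t k.+1 | t <- seqs i k]].
Proof.
apply/seteqP; split=> l; rewrite /mkset mem_undup.
  case=> _ [s]; rewrite T_seqs /mkset mem_filter => /andP[/eqP <- rs].
  exact: map_f.
case/mapP => s rs ->; have sP : adm_seq k.+1 i s by apply/mem_seqs.
split; first by rewrite -(weight_entry sP); exact: weight_Lambda.
by exists s; rewrite T_seqs /mkset mem_filter eqxx.
Qed.

Lemma colored_TLP i k Y : colored_TL k i Y <-> jwpow i k *d Y = Y /\ Y *d jwpow i k = Y.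
Proof.
split=> [[X ->]|[e1 e2]]; last by exists Y; rewrite jwpowE !mulE e1 e2.
by rewrite jwpowE !mulE -!mulA_TL jwpow_idem !mulA_TL jwpow_idem.
Qed.

Definition gpath i k t : TL (width i k) (width i k) :=
  (eta k i t)^-1 *: (dual (vpath i t k) *d vpath i t k).

Lemma GE i k t : G k i t = gpath i k t.
Proof. by rewrite /G mulE dualE vpathE. Qed.

Definition blocks i k l : TL (width i k.+1) (width i k.+1) :=
  \sum_(t <- seqs i k | entry i t k.+1 == l) gpath i k.+1 t.

Lemma sum_T i k l : \sum_(t \in T k.+1 i l) G k.+1 i t = blocks i k l.
Proof.
rewrite T_seqs -fsbig_seq ?filter_uniq ?seqs_uniq // big_filter.
by apply: eq_bigr => t _; exact: GE.
Qed.

(** Each sequence contributes to one block only, that of its own weight; [undup] keeps every weight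
    from being counted more than once. *)
Lemma sum_blocks i k : \sum_(l <- undup [seq entry i t k.+1 | t <- seqs i k]) blocks i k l
  = jwpow i k.+1.
Proof.
rewrite (exchange_big_dep xpredT) // jwpow_sum; apply: eq_big_seq => t rt.
rewrite -big_filter (@eq_filter _ _ (pred1 (entry i t k.+1))) => [|l]; last first.
  exact: eq_sym.
rewrite filter_pred1_uniq ?undup_uniq ?big_seq1 // mem_undup.
by apply/mapP; exists t.
Qed.

Lemma colored_resolution i k :
  let r := seqs i k in
  let g := gpath i k.+1 in
  let z := blocks i k in
  let S := colored_TL k.+1 i in
  [/\ forall t, t \in r -> [/\ S (g t), g t *d g t = g t & g t <> 0],
      forall s t, s \in r -> t \in r -> s != t -> g s *d g t = 0,
      forall t a b, t \in r -> a *d a = a -> a <> 0 -> b <> 0 ->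
        a *d b = 0 -> b *d a = 0 -> g t <> a + b &
  [/\ forall l, [/\ S (z l), z l *d z l = z l &
         forall X, S X -> z l *d X = X *d z l],
      forall l l', l != l' -> z l *d z l' = 0,
      forall t, t \in r -> z (entry i t k.+1) <> 0 &
      forall t a b, t \in r -> a *d a = a -> a <> 0 -> b <> 0 ->
        (forall X, S X -> a *d X = X *d a) -> a *d b = 0 -> b *d a = 0 ->
        z (entry i t k.+1) <> a + b]].
Proof.
have adm t : t \in seqs i k -> adm_prefix i t k.
  by move=> /mem_seqs; exact: adm_prefix_seq.
have ortho s t : s \in seqs i k -> t \in seqs i k -> s != t ->
    vpath i s k.+1 *d dual (vpath i t k.+1) = 0.
  move=> rs rt st; have [|||j jk ne] := @seqs_neq i k s t; rewrite -?mem_seqs //.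
  exact: vpath_ortho (adm _ rs) (adm _ rt) jk ne.
have endo n (X : TL n n) : exists c, jz n *d X *d jz n = c *: jz n.
  by exists (aug X); exact: jz_endo.
have [P1 P2 P3 [P4 P5 P6 P7]] := @resolution QA (fun m n => TL m n) mul dual jz
  mulDl_TL mulDr_TL mulZl_TL mulZr_TL mulA_TL dual_mul dual_jz jz_neq0
  jz_neq_hom endo _ (jwpow i k.+1) _ (seqs i k) (fun t => entry i t k.+1)
  (fun t => vpath i t k.+1) (eta k.+1 i) (seqs_uniq i k) (dual_jwpow i k.+1)
  (fun t rt => eta_neq0 (adm t rt)) (fun t rt => vpath_jwpow (adm t rt))
  (fun t rt => jz_vpath (adm t rt)) (fun t rt => vpath_dual (adm t rt)) ortho
  (jwpow_sum i k).
split; [|exact: P2|exact: P3|].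
  by move=> t rt; have [/colored_TLP] := P1 t rt.
split; [|exact: P5|exact: P6|].
  move=> l; have [/colored_TLP Sz zz cz] := P4 l; split=> // X /colored_TLP.
  exact: cz.
move=> t a b rt aa a0 b0 ca; apply: P7 => // X SX; apply: ca; exact/colored_TLP.
Qed.

Theorem corollary6p5 (k i : nat) (hk : (1 <= k)%N) (hi : (1 <= i)%N) :
  [/\ forall t, TLambda k i t ->
        primitive_idempotent (colored_TL k i) (G k i t),
      forall lam, Lambda k i lam -> T k i lam !=set0 ->
        primitive_central_idempotent (colored_TL k i)
          (\sum_(t \in T k i lam) G k i t),
      complete_orthogonal_idempotents (colored_TL k i) (tens_pow i k)
        (TLambda k i) (G k i) &
      complete_orthogonal_idempotents (colored_TL k i) (tens_pow i k)
        [set lam | Lambda k i lam /\ T k i lam !=set0]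
        (fun lam => \sum_(t \in T k i lam) G k i t)].
Proof.
case: k hk => // k _.
have [P1 P2 P3 [P4 P5 P6 P7]] := colored_resolution i k.
split.
- move=> t; rewrite TLambda_seqs GE => /= rt; have [Sg gg g0] := P1 t rt.
  split=> //; first by split=> //; rewrite mulE.
  case=> a [b [[[_ aa] a0] [[_ bb] b0] [ab ba]]]; rewrite !mulE in aa bb ab ba.
  exact: P3.
- move=> l _ [s]; rewrite sum_T T_seqs /mkset mem_filter => /andP[/eqP <- rs].
  have [Sz zz cz] := P4 (entry i s k.+1).
  split; [by split=> //; rewrite mulE | | exact: P6 |].
    by move=> X SX; rewrite !mulE; exact: cz.
  case=> a [b [[[_ aa] ca a0] [_ _ b0] [ab ba]]]; rewrite !mulE in aa ab ba.
  apply: P7 => // X SX; have := ca X SX; by rewrite !mulE.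
- split.
  + move=> t; rewrite TLambda_seqs GE => rt; have [Sg gg _] := P1 t rt.
    by split=> //; rewrite mulE.
  + move=> s t; rewrite TLambda_seqs !GE => rs rt /eqP st.
    by split; rewrite mulE P2 // eq_sym.
  + rewrite TLambda_seqs -fsbig_seq ?seqs_uniq // jwpowE jwpow_sum.
    by apply: eq_bigr => t _; exact: GE.
- rewrite weights_seqs; split.
  + by move=> l _; rewrite sum_T; have [Sz zz _] := P4 l; split=> //; rewrite mulE.
  + by move=> l l' _ _ /eqP ne; rewrite !sum_T; split; rewrite mulE P5 // eq_sym.
  + rewrite -fsbig_seq ?undup_uniq // jwpowE -sum_blocks.
    by apply: eq_bigr => l _; exact: sum_T.
Qed.
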